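(* Let $N\geqslant 1$ be an integer, let $k$ be a field, $R$ a $k$-algebra, ${}_R\mathrm{Mod}$ the category of left $R$-modules, and let $\mathscr{X}$ be the category of $N$-periodic chain complexes over ${}_R\mathrm{Mod}$. Let $(\mathscr{A},\mathscr{B})$ be a hereditary cotorsion pair in ${}_R\mathrm{Mod}$. (i) There are hereditary, compatible cotorsion pairs $\big(\Phi(\mathscr{A}),\Phi(\mathscr{A})^{\perp}\big)$ and $\big({}^{\perp}\Psi(\mathscr{B}),\Psi(\mathscr{B})\big)$ in $\mathscr{X}$, where $$\Phi(\mathscr{A})=\{X\in\mathscr{X}\mid \text{if } 0\leqslant q\leqslant N-1 \text{ then } \operatorname{Coker}(\partial_q^X)\in\mathscr{A} \text{ and } \operatorname{H}_q(X)=0\},$$ $$\Psi(\mathscr{B})=\{X\in\mathscr{X}\mid \text{if } 0\leqslant q\leqslant N-1 \text{ then } \operatorname{Ker}(\partial_q^X)\in\mathscr{B} \text{ and } \operatorname{H}_q(X)=0\}.$$ (ii) If $\mathscr{A}$ is closed under pure quotients and $(\mathscr{A},\mathscr{B})$ is generated by a set, then the cotorsion pairs in part (i) are complete.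
   Context: An $N$-periodic chain complex $X$ over ${}_R\mathrm{Mod}$ consists of left $R$-modules $X_q$ and $R$-homomorphisms $\partial^X_q:X_q\to X_{q-1}$ for $q\in\mathbb{Z}/N$ (indices $0,\dots,N-1$ taken modulo $N$, so $\partial_0^X:X_0\to X_{N-1}$) with $\partial^X_{q-1}\partial^X_q=0$ for all $q$; morphisms are families of homomorphisms commuting with the $\partial$'s. For $N=1$ this is a module $X_0$ with an endomorphism $\partial_0^X$ squaring to $0$. The homology is $\operatorname{H}_q(X)=\operatorname{Ker}(\partial^X_q)/\operatorname{Im}(\partial^X_{q+1})$, indices modulo $N$. Cotorsion pairs. Let $\mathscr{Y}$ be an abelian category. For classes of objects $\Gamma,\Delta$ put $\Gamma^{\perp}=\{Y\mid \operatorname{Ext}^1_{\mathscr{Y}}(C,Y)=0 \text{ for all } C\in\Gamma\}$ and ${}^{\perp}\Delta=\{Y\mid \operatorname{Ext}^1_{\mathscr{Y}}(Y,D)=0 \text{ for all } D\in\Delta\}$. A cotorsion pair is a pair $(\Gamma,\Delta)$ with $\Gamma={}^{\perp}\Delta$ and $\Gamma^{\perp}=\Delta$. It is complete if each $Y\in\mathscr{Y}$ permits short exact sequences $0\to D\to C\to Y\to 0$ and $0\to Y\to D'\to C'\to 0$ with $C,C'\in\Gamma$ and $D,D'\in\Delta$. It is hereditary if $\Gamma$ is closed under kernels of epimorphisms and $\Delta$ is closed under cokernels of monomorphisms. It is generated by a class $\mathscr{C}$ if $\Delta=\mathscr{C}^{\perp}$. Cotorsion pairs $(\Phi,\Phi^{\perp})$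 and $({}^{\perp}\Psi,\Psi)$ (in this order) are compatible if $\operatorname{Ext}^1_{\mathscr{Y}}(F,P)=0$ for all $F\in\Phi$, $P\in\Psi$, and $\Phi\cap\Phi^{\perp}={}^{\perp}\Psi\cap\Psi$. A class $\mathscr{A}$ of left $R$-modules is closed under pure quotients if for each pure short exact sequence $0\to A'\to A\to A''\to 0$ (one which stays exact after applying $B\otimes_R-$ for every right $R$-module $B$) with $A\in\mathscr{A}$ one has $A''\in\mathscr{A}$. *)

(* Defs.v *)
From HB Require Import structures.
From mathcomp Require Import all_boot all_algebra.
From mathcomp Require Import boolp.
From mathcomp Require Import freeg.

(* A left module over a ring R is an lmodType R, a right module
   is an lmodType R^c. By boolp every type carries a choice structure, so
   lmodType R comprises all left R-modules in its universe. *)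

Set Implicit Arguments.
Unset Strict Implicit.
Unset Printing Implicit Defensive.

Import GRing.Theory.
Local Open Scope ring_scope.
Local Open Scope quotient_scope.

(* Of the structure of an abelian category, the notions below only refer to
   morphisms, composition and zero morphisms. *)
Record zcategory := ZCategory {
  Ob :> Type;
  Mor : Ob -> Ob -> Type;
  idm : forall X, Mor X X;
  compm : forall X Y Z, Mor Y Z -> Mor X Y -> Mor X Z;
  zerom : forall X Y, Mor X Y;
  compmA : forall X Y Z T (h : Mor Z T) (g : Mor Y Z) (f : Mor X Y),
    compm h (compm g f) = compm (compm h g) f;
  comp1m : forall X Y (f : Mor X Y), compm (idm Y) f = f;
  compm1 : forall X Y (f : Mor X Y), compm f (idm X) = f;
  comp0m : forall X Y Z (f : Mor X Y), compm (zerom Y Z) f = zerom X Z;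
  compm0 : forall X Y Z (f : Mor Y Z), compm f (zerom X Y) = zerom X Z }.

Arguments Mor {z} X Y.
Arguments idm {z} X.
Arguments compm {z X Y Z} g f.
Arguments zerom {z} X Y.

Section Cotorsion.
Variable Y : zcategory.

Definition monic (A B : Y) (f : Mor A B) : Prop :=
  forall (T : Y) (u v : Mor T A), compm f u = compm f v -> u = v.

Definition epic (A B : Y) (f : Mor A B) : Prop :=
  forall (T : Y) (u v : Mor B T), compm u f = compm v f -> u = v.

Definition is_kernel (K A B : Y) (i : Mor K A) (f : Mor A B) : Prop :=
  compm f i = zerom K B /\
  forall (T : Y) (h : Mor T A), compm f h = zerom T B ->
    exists! u : Mor T K, compm i u = h.

Definition is_cokernel (A B C : Y) (p : Mor B C) (f : Mor A B) : Prop :=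
  compm p f = zerom A C /\
  forall (T : Y) (h : Mor B T), compm h f = zerom A T ->
    exists! u : Mor C T, compm u p = h.

Definition short_exact (A B C : Y) (f : Mor A B) (g : Mor B C) : Prop :=
  is_kernel f g /\ is_cokernel g f.

(* Ext^1(C, D) in the sense of Yoneda: its elements are the short exact
   sequences 0 -> D -> E -> C -> 0 up to equivalence. A morphism E -> E' as in
   ext_equiv is an isomorphism by the five lemma. *)
Record extension (C D : Y) := Extension {
  ext_mid : Y;
  ext_in : Mor D ext_mid;
  ext_out : Mor ext_mid C;
  ext_exact : short_exact ext_in ext_out }.

Definition ext_equiv (C D : Y) (e e' : extension C D) : Prop :=
  exists u : Mor (ext_mid e) (ext_mid e'),
    compm u (ext_in e) = ext_in e' /\ compm (ext_out e') u = ext_out e.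

(* The group Ext^1(C, D) is zero: it has only one element. *)
Definition Ext1_zero (C D : Y) : Prop :=
  forall e e' : extension C D, ext_equiv e e'.

Definition rperp (G : Y -> Prop) : Y -> Prop :=
  fun D => forall C, G C -> Ext1_zero C D.

Definition lperp (D : Y -> Prop) : Y -> Prop :=
  fun C => forall X, D X -> Ext1_zero C X.

Definition same_class (G D : Y -> Prop) : Prop := forall X, G X <-> D X.

Definition cotorsion_pair (G D : Y -> Prop) : Prop :=
  same_class G (lperp D) /\ same_class (rperp G) D.

Definition complete_pair (G D : Y -> Prop) : Prop :=
  forall X : Y,
    (exists (D0 C0 : Y) (f : Mor D0 C0) (g : Mor C0 X),
       [/\ D D0, G C0 & short_exact f g]) /\
    (exists (D1 C1 : Y) (f : Mor X D1) (g : Mor D1 C1),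
       [/\ D D1, G C1 & short_exact f g]).

Definition closed_epi_kernels (G : Y -> Prop) : Prop :=
  forall (K A B : Y) (i : Mor K A) (f : Mor A B),
    epic f -> is_kernel i f -> G A -> G B -> G K.

Definition closed_mono_cokernels (D : Y -> Prop) : Prop :=
  forall (A B C : Y) (f : Mor A B) (p : Mor B C),
    monic f -> is_cokernel p f -> D A -> D B -> D C.

Definition hereditary_pair (G D : Y -> Prop) : Prop :=
  closed_epi_kernels G /\ closed_mono_cokernels D.

Definition generated_by (C G D : Y -> Prop) : Prop := same_class D (rperp C).

Definition compatible_pairs (G1 D1 G2 D2 : Y -> Prop) : Prop :=
  (forall F P, G1 F -> D2 P -> Ext1_zero F P) /\
  same_class (fun X => G1 X /\ D1 X) (fun X => G2 X /\ D2 X).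

End Cotorsion.

Section LinearExt.
Variables (R : pzRingType) (U V : lmodType R).

Lemma linear_ext (f g : {linear U -> V}) : f =1 g -> f = g.
Proof.
case: f => f cf; case: g => g cg /= fg.
have {}fg : f = g by apply: funext.
subst g; congr GRing.Linear.Pack.
case: cf => -[a1] [b1]; case: cg => -[a2] [b2].
by rewrite (Prop_irrelevance a1 a2) (Prop_irrelevance b1 b2).
Qed.

End LinearExt.

Section ModCat.
Variable R : pzRingType.

Definition lin_id (U : lmodType R) : {linear U -> U} := idfun.
Definition lin_comp (U V W : lmodType R) (g : {linear V -> W})
  (f : {linear U -> V}) : {linear U -> W} := g \o f.
Definition lin_zero (U V : lmodType R) : {linear U -> V} := \0.

Definition modCat : zcategory.
Proof.
apply: (@ZCategory (lmodType R) (fun U V => {linear U -> V})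
          lin_id lin_comp lin_zero) => *; apply: linear_ext => x //=.
exact: linear0.
Defined.

End ModCat.

Section SubQuot.
Variables (R : pzRingType) (V : lmodType R).

Section Sub.
Variable S : submodClosed V.

Record submod := Submod { submod_val :> V; submod_in : submod_val \in S }.

HB.instance Definition _ := [isSub for submod_val].
HB.instance Definition _ := [Choice of submod by <:].
HB.instance Definition _ := [SubChoice_isSubLmodule of submod by <:].

End Sub.

Section Quot.
Variable T : submodClosed V.

(* T as a subgroup: submodClosed does not inherit from zmodClosed. *)
Definition sub_pred : {pred V} := T.
Fact sub_pred_submod : subsemimod_closed sub_pred.
Proof.
split; [split|] => [|x y|a x].
- exact: (@GRing.rpred0 _ T).
- exact: (@GRing.rpredD _ T).
- exact: (@GRing.rpredZ _ _ T).
Qed.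
HB.instance Definition _ := GRing.isSubmodClosed.Build R V sub_pred sub_pred_submod.
Local Notation S := sub_pred.

(* The quotient abelian group is the one of ring_quotient; only the action of R
   is added here. *)
Definition quotmod : Type := {ideal_quot S}.
HB.instance Definition _ := GRing.Zmodule.on quotmod.

Definition quotmod_pi (v : V) : quotmod := \pi_{ideal_quot S} v.

Definition quotmod_scale (a : R) (x : quotmod) : quotmod :=
  quotmod_pi (a *: repr (x : {ideal_quot S})).

Lemma quotmod_piP (x : quotmod) : exists v, quotmod_pi v = x.
Proof.
by exists (repr (x : {ideal_quot S})); apply: reprK.
Qed.

Lemma quotmod_pi_eq (u v : V) : (quotmod_pi u == quotmod_pi v) = (u - v \in S).
Proof. by rewrite (Quotient.idealrBE S). Qed.

Lemma quotmod_piB : zmod_morphism quotmod_pi.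
Proof. exact: raddfB. Qed.

Lemma quotmod_piD : {morph quotmod_pi : u v / u + v}.
Proof. exact: raddfD. Qed.

Lemma quotmod_scaleE a (v : V) :
  quotmod_scale a (quotmod_pi v) = quotmod_pi (a *: v).
Proof.
apply/eqP; rewrite quotmod_pi_eq -scalerBr rpredZ // -quotmod_pi_eq.
by apply/eqP; apply: reprK.
Qed.

Fact quotmod_scalerA a b (v : quotmod) :
  quotmod_scale a (quotmod_scale b v) = quotmod_scale (a * b) v.
Proof. by case: (quotmod_piP v) => u <-; rewrite !quotmod_scaleE scalerA. Qed.

Fact quotmod_scale1r : left_id 1 quotmod_scale.
Proof. by move=> v; case: (quotmod_piP v) => u <-; rewrite quotmod_scaleE scale1r. Qed.

Fact quotmod_scalerDr : right_distributive quotmod_scale +%R.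
Proof.
move=> a v w; case: (quotmod_piP v) => u <-; case: (quotmod_piP w) => t <-.
by rewrite -quotmod_piD !quotmod_scaleE -quotmod_piD scalerDr.
Qed.

Fact quotmod_scalerDl (v : quotmod) : {morph quotmod_scale^~ v : a b / a + b}.
Proof.
move=> a b; case: (quotmod_piP v) => u <-.
by rewrite !quotmod_scaleE -quotmod_piD scalerDl.
Qed.

HB.instance Definition _ := GRing.Zmodule_isLmodule.Build R quotmod
  quotmod_scalerA quotmod_scale1r quotmod_scalerDr quotmod_scalerDl.

Fact quotmod_pi_is_linear : linear quotmod_pi.
Proof.
by move=> a u v; rewrite quotmod_piD -quotmod_scaleE.
Qed.
HB.instance Definition _ :=
  GRing.isLinear.Build R V quotmod _ quotmod_pi quotmod_pi_is_linear.

End Quot.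
End SubQuot.

Section KerIm.
Variables (R : pzRingType) (U V : lmodType R) (f : {linear U -> V}).

Definition ker_pred : {pred U} := fun x => f x == 0.
Fact ker_pred_submod : subsemimod_closed ker_pred.
Proof.
split; [split|] => [|x y|a x]; rewrite !unfold_in ?linear0 //.
  by rewrite linearD => /eqP-> /eqP->; rewrite addr0.
by move=> /eqP fx0; rewrite linearZ /= fx0 scaler0.
Qed.
HB.instance Definition _ := GRing.isSubmodClosed.Build R U ker_pred ker_pred_submod.

Definition im_pred : {pred V} := fun y => `[< exists x, f x = y >].
Fact im_pred_submod : subsemimod_closed im_pred.
Proof.
split; [split|] => [|x y|a x]; rewrite !unfold_in.
- by apply/asboolP; exists 0; rewrite linear0.
- move=> /asboolP[u <-] /asboolP[v <-]; apply/asboolP.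
  by exists (u + v); rewrite linearD.
- by move=> /asboolP[u <-]; apply/asboolP; exists (a *: u); rewrite linearZ.
Qed.
HB.instance Definition _ := GRing.isSubmodClosed.Build R V im_pred im_pred_submod.

End KerIm.

Section Homology.
Variables (R : pzRingType) (U V W : lmodType R).

Definition Ker (f : {linear U -> V}) : lmodType R := submod (ker_pred f).
Definition Coker (f : {linear U -> V}) : lmodType R := quotmod (im_pred f).

Variables (f : {linear U -> V}) (g : {linear V -> W}).

Definition bound_pred : {pred submod (ker_pred g)} :=
  fun z => val z \in im_pred f.
Fact bound_pred_submod : subsemimod_closed bound_pred.
Proof.
split; [split|].
- by change (0 \in im_pred f); apply: rpred0.
- move=> x y xI yI; change (val x + val y \in im_pred f).
  by apply: rpredD; [exact: xI|exact: yI].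
- move=> a x xI; change (a *: val x \in im_pred f).
  by apply: rpredZ; exact: xI.
Qed.
HB.instance Definition _ :=
  GRing.isSubmodClosed.Build R (submod (ker_pred g)) bound_pred bound_pred_submod.

(* Ker g / Im f, meant for g \o f = 0. *)
Definition homology : lmodType R := quotmod bound_pred.

End Homology.

Definition zero_module (R : pzRingType) (M : lmodType R) : Prop :=
  forall x : M, x = 0.

Section PeriodicComplexes.
Variables (R : pzRingType) (N : nat).

(* Z/N is 'I_N with its cyclic successor ordS and predecessor ord_pred. *)
Record pcomplex := PComplex {
  pc_ob :> 'I_N -> lmodType R;
  pc_d : forall q, {linear pc_ob q -> pc_ob (ord_pred q)};
  pc_dd : forall q x, pc_d (ord_pred q) (pc_d q x) = 0 }.

Record pcmap (X Y : pcomplex) := PCMap {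
  pc_map :> forall q, {linear X q -> Y q};
  pc_comm : forall q x, pc_map (ord_pred q) (pc_d X q x) = pc_d Y q (pc_map q x) }.

Lemma pcmap_ext (X Y : pcomplex) (f g : pcmap X Y) :
  (forall q, f q =1 g q) -> f = g.
Proof.
case: f g => [f cf] [g cg] /= fg.
have {}fg : f = g by apply: functional_extensionality_dep => q; exact: linear_ext (fg q).
by subst g; congr PCMap; apply: Prop_irrelevance.
Qed.

Definition pc_id (X : pcomplex) : pcmap X X :=
  @PCMap X X (fun q => lin_id (X q)) (fun q x => erefl).

Fact pc_comp_comm (X Y Z : pcomplex) (g : pcmap Y Z) (f : pcmap X Y) q x :
  lin_comp (g (ord_pred q)) (f (ord_pred q)) (pc_d X q x) =
  pc_d Z q (lin_comp (g q) (f q) x).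
Proof. by rewrite /= !pc_comm. Qed.

Definition pc_comp (X Y Z : pcomplex) (g : pcmap Y Z) (f : pcmap X Y) :
  pcmap X Z := @PCMap X Z (fun q => lin_comp (g q) (f q)) (pc_comp_comm g f).

Definition pc_zero (X Y : pcomplex) : pcmap X Y :=
  @PCMap X Y (fun q => lin_zero (X q) (Y q))
    (fun q x => esym (linear0 (pc_d Y q))).

Definition pcCat : zcategory.
Proof.
apply: (@ZCategory pcomplex pcmap pc_id pc_comp pc_zero) => *;
  apply: pcmap_ext => q x //=.
exact: linear0.
Defined.

(* The differential X_(q+1) -> X_q: q+1-1 and q are equal but not convertible,
   whence the transport along ordSK. *)
Definition pc_din (X : pcomplex) (q : 'I_N) : {linear X (ordS q) -> X q} :=
  ecast i {linear X (ordS q) -> X i} (ordSK q) (pc_d X (ordS q)).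

Definition pc_H (X : pcomplex) (q : 'I_N) : lmodType R :=
  homology (pc_din X q) (pc_d X q).

Definition Phi (A : modCat R -> Prop) : pcCat -> Prop := fun X : pcomplex =>
  forall q : 'I_N, A (Coker (pc_d X q)) /\ zero_module (pc_H X q).

Definition Psi (B : modCat R -> Prop) : pcCat -> Prop := fun X : pcomplex =>
  forall q : 'I_N, B (Ker (pc_d X q)) /\ zero_module (pc_H X q).

End PeriodicComplexes.

Section Tensor.
Variables (R : pzRingType) (B : lmodType R^c).

Section Object.
Variable M : lmodType R.

Definition free_pairs : zmodType := {freeg (B * M)%type / int}.

Definition pair_gen (b : B) (m : M) : free_pairs := << (b, m) >>.

(* The action of r : R^c on b : B is b . r. *)
Definition tens_relation (x : free_pairs) : Prop :=
  [\/ exists b b' m, x = pair_gen (b + b') m - pair_gen b m - pair_gen b' m,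
      exists b m m', x = pair_gen b (m + m') - pair_gen b m - pair_gen b m' |
      exists b (r : R) m,
        x = pair_gen ((r : R^c) *: b) m - pair_gen b (r *: m)].

(* the subgroup generated by the relations *)
Definition tens_pred : {pred free_pairs} := fun x =>
  `[< forall S : {pred free_pairs}, zmod_closed S ->
        (forall y, tens_relation y -> y \in S) -> x \in S >].

Fact tens_pred_zmod : zmod_closed tens_pred.
Proof.
split=> [|x y]; rewrite !unfold_in.
  by apply/asboolP => S [].
move=> /asboolP Sx /asboolP Sy; apply/asboolP => S Sz Sr.
by case: (Sz) => _; apply; [apply: Sx|apply: Sy].
Qed.
HB.instance Definition _ := GRing.isZmodClosed.Build free_pairs tens_pred tens_pred_zmod.

Definition tensor : zmodType := {ideal_quot tens_pred}.

Definition tens (b : B) (m : M) : tensor := \pi_{ideal_quot tens_pred} (pair_gen b m).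

End Object.

Section Theory.
Variable M : lmodType R.
Implicit Types (b : B) (m : M).

Lemma tens_rel0 x : tens_relation x -> \pi_{ideal_quot (@tens_pred M)} x = 0.
Proof.
move=> xr; rewrite -[0](raddf0 (\pi_{ideal_quot (@tens_pred M)})).
apply/eqP; rewrite -Quotient.idealrBE subr0 unfold_in.
by apply/asboolP => S _; apply.
Qed.

Lemma tensDl b b' m : tens (b + b') m = tens b m + tens b' m.
Proof.
have := @tens_rel0 (pair_gen (b + b') m - pair_gen b m - pair_gen b' m).
rewrite !raddfB => H; apply/eqP; rewrite -subr_eq0 opprD addrA.
by apply/eqP/H/Or31; exists b, b', m.
Qed.

Lemma tensDr b m m' : tens b (m + m') = tens b m + tens b m'.
Proof.
have := @tens_rel0 (pair_gen b (m + m') - pair_gen b m - pair_gen b m').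
rewrite !raddfB => H; apply/eqP; rewrite -subr_eq0 opprD addrA.
by apply/eqP/H/Or32; exists b, m, m'.
Qed.

Lemma tens_balanced b (r : R) m : tens ((r : R^c) *: b) m = tens b (r *: m).
Proof.
have := @tens_rel0 (pair_gen ((r : R^c) *: b) m - pair_gen b (r *: m)).
rewrite !raddfB => H; apply/eqP; rewrite -subr_eq0.
by apply/eqP/H/Or33; exists b, r, m.
Qed.

End Theory.

Section Map.
Variables (M M' : lmodType R) (f : {linear M -> M'}).

Definition free_map : free_pairs M -> tensor M' :=
  fglift (fun z : B * M => tens z.1 (f z.2) : zmodule (tensor M')).

(* B (x) f, the additive map sending b (x) m to b (x) f m. *)
Definition tensor_map (t : tensor M) : tensor M' :=
  free_map (repr (t : {ideal_quot (@tens_pred M)})).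

Lemma free_mapB : zmod_morphism free_map.
Proof.
exact: (lift_is_additive
          (fun z : (B * M)%type => tens z.1 (f z.2) : zmodule (tensor M'))).
Qed.

Lemma free_map_gen b m : free_map (pair_gen b m) = tens b (f m).
Proof. by rewrite /free_map /pair_gen liftU scale1r. Qed.

Lemma free_map0 x : x \in @tens_pred M -> free_map x = 0.
Proof.
rewrite unfold_in => /asboolP /(_ (fun y => free_map y == 0)) H; apply/eqP.
apply: H => [|y].
  split=> [|y z]; rewrite !unfold_in.
    by rewrite -(subrr (0 : free_pairs M)) free_mapB subrr.
  by rewrite free_mapB => /eqP-> /eqP->; rewrite subrr.
rewrite unfold_in.
by case=> [[b [b' [m ->]]]|[b [m [m' ->]]]|[b [r [m ->]]]];
  rewrite !free_mapB !free_map_gen ?linearD ?linearZ /=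
    ?tensDl ?tensDr ?tens_balanced -?addrA ?addrA; rewrite ?addrK ?subrr //;
  rewrite addrAC addrK subrr.
Qed.

Lemma tensor_map_pi x :
  tensor_map (\pi_{ideal_quot (@tens_pred M)} x) = free_map x.
Proof.
apply/eqP; rewrite -subr_eq0 -free_mapB free_map0 //.
by rewrite Quotient.idealrBE reprK.
Qed.

Lemma tensor_map_tens b m : tensor_map (tens b m) = tens b (f m).
Proof. by rewrite tensor_map_pi free_map_gen. Qed.

Lemma tensor_mapB : zmod_morphism tensor_map.
Proof.
move=> t u; rewrite -[t](reprK (t : {ideal_quot (@tens_pred M)})).
rewrite -[u](reprK (u : {ideal_quot (@tens_pred M)})).
by rewrite -raddfB !tensor_map_pi free_mapB.
Qed.

End Map.
End Tensor.

Section Hypotheses.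
Variable R : pzRingType.

Definition short_exact_ab (U V W : zmodType) (f : U -> V) (g : V -> W) : Prop :=
  [/\ injective f, forall y, g y = 0 <-> (exists x, f x = y)
    & forall z, exists y, g y = z].

Definition pure_exact (A1 A2 A3 : lmodType R)
    (f : {linear A1 -> A2}) (g : {linear A2 -> A3}) : Prop :=
  short_exact (f : @Mor (modCat R) A1 A2) (g : @Mor (modCat R) A2 A3) /\
  forall B : lmodType R^c,
    short_exact_ab (tensor_map (B := B) f) (tensor_map (B := B) g).

Definition closed_pure_quotients (A : modCat R -> Prop) : Prop :=
  forall (A1 A2 A3 : lmodType R)
    (f : {linear A1 -> A2}) (g : {linear A2 -> A3}),
    pure_exact f g -> A A2 -> A A3.

(* A set, as opposed to a proper class, is indexed by a type in the universe of
   the carriers of modules; with a larger index universe every class of modules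
   would be a set. *)
Definition modIndex := Type@{GRing.Lmodule.axioms_.u0}.

Definition generated_by_set (A B : modCat R -> Prop) : Prop :=
  exists (I : modIndex) (S : I -> modCat R),
    generated_by (fun M => exists i, M = S i) A B.

End Hypotheses.

(* Main.v *)
(* Both classes consist of the exact complexes all of whose cycle modules lie in
   A (for Phi), respectively in B (for Psi). With S(M) the complex that has M in
   every degree and zero differential, Phi = {X | Ext(X, S(V)) = 0 for V in B} and
   Psi = {Y | Ext(S(M), Y) = 0 for M in A or M = R}; exactness is tested with
   injective modules Hom_k(R, M) on one side and with R on the other. The sequence
   0 -> X -> cone X -> shift X -> 0 yields Ext(Phi, Psi) = 0 by a homotopy argument
   and the compatibility by contracting X.
   For completeness, Psi is the right class of a set of complexes, so the small
   object argument applies; it is run as an initial algebra of infinitary terms,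
   which replaces transfinite induction. The same argument embeds every complex X
   into some I with exact cokernel E, I being right orthogonal to all exact
   complexes, because these are filtered by exact ones of bounded size. The
   horseshoe lemma gives 0 -> P -> Q -> E -> 0 with P in Psi and Q in Phi, and the
   pullback of Q along I -> E is the required special preenvelope of X for Phi. *)

Require Import Defs.
From HB Require Import structures.
From mathcomp Require Import all_boot all_algebra.
From mathcomp Require Import boolp classical_sets.

Set Implicit Arguments.
Unset Strict Implicit.
Unset Printing Implicit Defensive.

Import GRing.Theory.
Local Open Scope ring_scope.

(** Differentials lower the degree by [ord_pred], which [ordS] inverts only up to a propositional
    equality, and for [N = 1] all degrees coincide, so no degree can be singled out. Statements are
    therefore phrased at [p q], where the incoming differential is typed without transport, and
    carried to all degrees afterwards. Modules and complexes share their diagram chases through an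
    interface of categories with elements. Only Hom and the vanishing of Ext^1 occur: what a long
    exact sequence or Ext^2 would give is expressed by extending or lifting maps. The initial
    algebra serves twice: morphisms out of it show that X embeds, and the uniqueness of its
    endomorphisms turns a comparison map into a splitting. The embedding of X into I is made
    orthogonal to one exact complex per presentation by terms; Zorn's lemma on partial sections then
    reaches all exact complexes. The field enters through Hom_k(R, V): k-linear maps extend from
    subspaces, so there are enough injectives. These test exactness and also provide the target that
    shows X embeds. *)

Lemma dep_choice (I : Type) (T : I -> Type) (P : forall i, T i -> Prop) :
  (forall i, exists y, P i y) -> exists f, forall i, P i (f i).
Proof.
move=> H; exists (fun i => sval (cid (H i))) => i; exact: (svalP (cid (H i))).
Qed.

(** * Abelian categories with elements *)

(* Elements have sorts, so that a complex has elements of every degree. *)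
Record concrete (Y : zcategory) := Concrete {
  srt : Type;
  el : Y -> srt -> zmodType;
  ap : forall (A B : Y), Mor A B -> forall i, el A i -> el B i;
  msub : forall (A B : Y), Mor A B -> Mor A B -> Mor A B;
  ap_sub : forall (A B : Y) (f g : Mor A B) i (x : el A i),
    ap (msub f g) x = ap f x - ap g x;
  apB : forall (A B : Y) (f : Mor A B) i (x y : el A i), ap f (x - y) = ap f x - ap f y;
  ap_ext : forall (A B : Y) (f g : Mor A B),
    (forall i (x : el A i), ap f x = ap g x) -> f = g;
  ap_comp : forall (A B C : Y) (g : Mor B C) (f : Mor A B) i (x : el A i),
    ap (compm g f) x = ap g (ap f x);
  ap_id : forall (A : Y) i (x : el A i), ap (idm A) x = x;
  ap_zero : forall (A B : Y) i (x : el A i), ap (zerom A B) x = 0;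
  ker_ex : forall (A B : Y) (f : Mor A B), exists (K : Y) (k : Mor K A),
    (forall i (x : el K i), ap k x = 0 -> x = 0) /\
    forall i (x : el A i), ap f x = 0 <-> exists y, ap k y = x;
  coker_ex : forall (A B : Y) (f : Mor A B), exists (C : Y) (p : Mor B C),
    (forall i (y : el C i), exists x, ap p x = y) /\
    forall i (y : el B i), ap p y = 0 <-> exists x, ap f x = y;
  prod_ex : forall A B : Y, exists (P : Y) (p1 : Mor P A) (p2 : Mor P B),
    [/\ forall i (x : el A i) (y : el B i), exists z, ap p1 z = x /\ ap p2 z = y,
        forall i (z : el P i), ap p1 z = 0 -> ap p2 z = 0 -> z = 0 &
        forall (T : Y) (f : Mor T A) (g : Mor T B),
          exists h : Mor T P, compm p1 h = f /\ compm p2 h = g];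
  fac_inj : forall (A B T : Y) (m : Mor A B) (h : Mor T B),
    (forall i (x : el A i), ap m x = 0 -> x = 0) ->
    (forall i (x : el T i), exists y, ap m y = ap h x) -> exists u, compm m u = h;
  fac_surj : forall (A B T : Y) (p : Mor A B) (h : Mor A T),
    (forall i (y : el B i), exists x, ap p x = y) ->
    (forall i (x : el A i), ap p x = 0 -> ap h x = 0) -> exists u, compm u p = h }.

Arguments el {Y} c A i.
Arguments ap {Y} c {A B} f {i} x.
Arguments msub {Y} c {A B} f g.
Arguments ap_ext {Y} c {A B f g}.
Arguments ap_id {Y} c {A i} x.
Arguments fac_inj {Y} c {A B T} m h.
Arguments fac_surj {Y} c {A B T} p h.

Section Generic.
Variables (Y : zcategory) (cY : concrete Y).
Local Notation "f $ x" := (ap cY f x) (at level 11, left associativity).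

Definition minj (A B : Y) (f : Mor A B) := forall i (x : el cY A i), f $ x = 0 -> x = 0.
Definition msurj (A B : Y) (f : Mor A B) :=
  forall i (y : el cY B i), exists x, f $ x = y.
Definition sex (A B C : Y) (f : Mor A B) (g : Mor B C) :=
  [/\ minj f, forall i (y : el cY B i), g $ y = 0 <-> exists x, f $ x = y & msurj g].

Lemma ap0 (A B : Y) (f : Mor A B) i : f $ (0 : el cY A i) = 0.
Proof. by rewrite -(subrr (0 : el cY A i)) apB subrr. Qed.
Lemma apN (A B : Y) (f : Mor A B) i (x : el cY A i) : f $ (- x) = - (f $ x).
Proof. by rewrite -[- x]sub0r apB ap0 sub0r. Qed.
Lemma apD (A B : Y) (f : Mor A B) i (x y : el cY A i) : f $ (x + y) = f $ x + f $ y.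
Proof. by rewrite -[y in x + y]opprK apB apN opprK. Qed.

Lemma comp_ap (A B C D : Y) (g : Mor B D) (f : Mor A B) (g' : Mor C D) (f' : Mor A C) :
  compm g f = compm g' f' ->
  forall i (x : el cY A i), g $ (f $ x) = g' $ (f' $ x).
Proof. by move=> e i x; rewrite -!ap_comp e. Qed.
Lemma comp_ap1 (A B C : Y) (g : Mor B C) (f : Mor A B) (h : Mor A C) :
  compm g f = h -> forall i (x : el cY A i), g $ (f $ x) = h $ x.
Proof. by move=> e i x; rewrite -!ap_comp e. Qed.
Lemma comp_ap_id (A B : Y) (g : Mor B A) (f : Mor A B) :
  compm g f = idm A -> forall i (x : el cY A i), g $ (f $ x) = x.
Proof. by move=> e i x; rewrite -ap_comp e ap_id. Qed.

Lemma minjE (A B : Y) (f : Mor A B) i (x y : el cY A i) :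
  minj f -> f $ x = f $ y -> x = y.
Proof.
by move=> fi e; apply/eqP; rewrite -subr_eq0; apply/eqP/fi; rewrite apB e subrr.
Qed.

Lemma minj_monic (A B : Y) (f : Mor A B) : minj f -> Defs.monic f.
Proof.
move=> fi T u v e; apply: (ap_ext cY) => i x; apply: (minjE fi).
exact: comp_ap e i x.
Qed.

Lemma msurj_epic (A B : Y) (f : Mor A B) : msurj f -> epic f.
Proof.
move=> fs T u v e; apply: (ap_ext cY) => i y; have [x <-] := fs i y.
exact: comp_ap e i x.
Qed.

(** The elementwise kernel from [ker_ex] is the test object: a monic [f] forces its inclusion to be
    zero. *)
Lemma monic_minj (A B : Y) (f : Mor A B) : Defs.monic f -> minj f.
Proof.
move=> fm i x fx0; have [K [k [_ kE]]] := ker_ex cY f.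
have k0 : k = zerom K A.
  apply: fm; rewrite compm0; apply: (ap_ext cY) => j y.
  by rewrite ap_comp ap_zero; apply/kE; exists y.
by have [y <-] := (kE i x).1 fx0; rewrite k0 ap_zero.
Qed.

Lemma epic_msurj (A B : Y) (f : Mor A B) : epic f -> msurj f.
Proof.
move=> fe i y; have [C [p [_ pE]]] := coker_ex cY f.
have p0 : p = zerom B C.
  apply: fe; rewrite comp0m; apply: (ap_ext cY) => j x.
  by rewrite ap_comp ap_zero; apply/pE; exists x.
by apply/pE; rewrite p0 ap_zero.
Qed.

Lemma kernel_sex (K A B : Y) (k : Mor K A) (f : Mor A B) :
  is_kernel k f -> epic f -> sex k f.
Proof.
case=> fk0 ku fe; have kmon : Defs.monic k.
  move=> T u v e; have fku : compm f (compm k u) = zerom T B.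
    by rewrite compmA fk0 comp0m.
  by have [w [_ wU]] := ku T _ fku; rewrite -(wU u) // -(wU v).
split; [exact: monic_minj| |exact: epic_msurj].
move=> i y; split=> [fy0|[x <-]]; last by rewrite -ap_comp fk0 ap_zero.
have [K' [k' [_ kE]]] := ker_ex cY f.
have fk' : compm f k' = zerom K' B.
  by apply: (ap_ext cY) => j z; rewrite ap_comp ap_zero; apply/kE; exists z.
have [u [ku' _]] := ku _ _ fk'; have [z <-] := (kE i y).1 fy0.
by exists (u $ z); rewrite -ap_comp ku'.
Qed.

Lemma cokernel_sex (A B C : Y) (f : Mor A B) (p : Mor B C) :
  Defs.monic f -> is_cokernel p f -> sex f p.
Proof.
move=> fm [pf0 pu]; have pe : epic p.
  move=> T u v e; have pfu : compm (compm u p) f = zerom A T.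
    by rewrite -compmA pf0 compm0.
  by have [w [_ wU]] := pu T _ pfu; rewrite -(wU u) // -(wU v).
split; [exact: monic_minj| |exact: epic_msurj].
move=> i y; split=> [py0|[x <-]]; last by rewrite -ap_comp pf0 ap_zero.
have [C' [p' [_ pE]]] := coker_ex cY f; apply/pE.
have pf' : compm p' f = zerom A C'.
  by apply: (ap_ext cY) => j z; rewrite ap_comp ap_zero; apply/pE; exists z.
by have [u [<- _]] := pu _ _ pf'; rewrite ap_comp py0 ap0.
Qed.

Lemma sex_comp0 (A B C : Y) (f : Mor A B) (g : Mor B C) : sex f g -> compm g f = zerom A C.
Proof.
case=> _ ex _; apply: (ap_ext cY) => i x.
by rewrite ap_comp ap_zero; apply/ex; exists x.
Qed.

Lemma sex_ap0 (A B C : Y) (f : Mor A B) (g : Mor B C) :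
  sex f g -> forall i (x : el cY A i), g $ (f $ x) = 0.
Proof. by case=> _ ex _ i x; apply/ex; exists x. Qed.

Lemma short_exactP (A B C : Y) (f : Mor A B) (g : Mor B C) :
  short_exact f g <-> sex f g.
Proof.
split=> [[fk gc]|fg].
  apply: kernel_sex => //; case: gc => gf0 gu T u v e.
  have ugf : compm (compm u g) f = zerom A T by rewrite -compmA gf0 compm0.
  by have [w [_ wU]] := gu T _ ugf; rewrite -(wU u) // -(wU v).
have [fi ex gs] := fg; split; split; rewrite ?(sex_comp0 fg) // => T h h0.
  have [i x|u e] := fac_inj cY f h fi.
    by apply/ex; rewrite -ap_comp h0 ap_zero.
  by exists u; split=> // v ve; apply: (minj_monic fi); rewrite ve.
have [i x /ex[y <-]|u e] := fac_surj cY g h gs.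
  by rewrite -ap_comp h0 ap_zero.
by exists u; split=> // v ve; apply: (msurj_epic gs); rewrite ve.
Qed.

(** ** Pushouts and pullbacks *)

(** [W] is the cokernel of [(h, -m)] from [K] to [D x P]. Since it is only asserted to exist,
    generation by the two images, their intersection and the universal property are recorded for
    later chases. *)
Lemma pushout (K P X D : Y) (m : Mor K P) (p : Mor P X) (h : Mor K D) : sex m p ->
  exists (W : Y) (a : Mor D W) (b : Mor P W) (c : Mor W X),
  [/\ sex a c, compm a h = compm b m, compm c b = p,
      forall i (w : el cY W i), exists d x, w = a $ d + b $ x &
      (forall i (d : el cY D i) x, a $ d = b $ x -> exists k, h $ k = d /\ m $ k = x) /\
      forall (T : Y) (u : Mor D T) (v : Mor P T), compm u h = compm v m ->
        exists w : Mor W T, compm w a = u /\ compm w b = v].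
Proof.
move=> mp; have [mi ex ps] := mp.
have [Q [p1 [p2 [pp pi pU]]]] := prod_ex cY D P.
have [j [j1 j2]] := pU _ h (msub cY (zerom K P) m).
have [i1 [i11 i12]] := pU _ (idm D) (zerom D P).
have [i2 [i21 i22]] := pU _ (zerom P D) (idm P).
have [W [r [rs rE]]] := coker_ex cY j.
have E1 i (d : el cY D i) : p1 $ (i1 $ d) = d by exact: comp_ap_id i11 _ _.
have E2 i (d : el cY D i) : p2 $ (i1 $ d) = 0 by rewrite (comp_ap1 i12) ap_zero.
have E3 i (d : el cY P i) : p1 $ (i2 $ d) = 0 by rewrite (comp_ap1 i21) ap_zero.
have E4 i (d : el cY P i) : p2 $ (i2 $ d) = d by exact: comp_ap_id i22 _ _.
have Ej1 i (k : el cY K i) : p1 $ (j $ k) = h $ k by exact: comp_ap1 j1 _ _.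
have Ej2 i (k : el cY K i) : p2 $ (j $ k) = - (m $ k).
  by rewrite (comp_ap1 j2) ap_sub ap_zero sub0r.
have dec i (z : el cY Q i) : z = i1 $ (p1 $ z) + i2 $ (p2 $ z).
  apply/eqP; rewrite -subr_eq0; apply/eqP/pi.
    by rewrite apB apD E1 E3 addr0 subrr.
  by rewrite apB apD E2 E4 add0r subrr.
have U (T : Y) (u : Mor D T) (v : Mor P T) : compm u h = compm v m ->
    exists w : Mor W T, compm w (compm r i1) = u /\ compm w (compm r i2) = v.
  move=> e; pose t := msub cY (compm u p1) (msub cY (zerom Q T) (compm v p2)).
  have tE i z : t $ z = u $ (p1 $ z) + v $ (p2 $ z) :> el cY T i.
    by rewrite !ap_sub ap_zero !ap_comp sub0r opprK.
  have [i z|w wE] := fac_surj cY r t rs.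
    by move=> /rE[k <-]; rewrite tE Ej1 Ej2 apN (comp_ap e) subrr.
  exists w; split; apply: (ap_ext cY) => i x; rewrite !ap_comp (comp_ap1 wE) tE.
    by rewrite E1 E2 ap0 addr0.
  by rewrite E3 E4 ap0 add0r.
have [c [ca cb]] : exists c : Mor W X, compm c (compm r i1) = zerom D X /\
   compm c (compm r i2) = p.
  by apply: U; rewrite (sex_comp0 mp) comp0m.
have gen i (w : el cY W i) : exists d x, w = compm r i1 $ d + compm r i2 $ x.
  have [z <-] := rs i w; exists (p1 $ z), (p2 $ z).
  by rewrite !ap_comp -apD -dec.
have inter i (d : el cY D i) x :
    compm r i1 $ d = compm r i2 $ x -> exists k, h $ k = d /\ m $ k = x.
  rewrite !ap_comp => /eqP; rewrite -subr_eq0 -apB => /eqP /rE[k kE].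
  exists k; rewrite -Ej1 kE; split; first by rewrite apB E1 E3 subr0.
  by rewrite -[m $ k]opprK -Ej2 kE apB E2 E4 sub0r opprK.
exists W, (compm r i1), (compm r i2), c; split=> //; last first.
  apply: (ap_ext cY) => i k; rewrite !ap_comp; apply/eqP.
  rewrite -subr_eq0 -apB; apply/eqP/rE; exists k.
  by rewrite [LHS]dec Ej1 Ej2 apN.
split.
- move=> i d d0; have [|k [<- mk0]] := inter i d 0; first by rewrite d0 ap0.
  by rewrite (mi _ _ mk0) ap0.
- move=> i w; split=> [cw0|[d <-]]; last by rewrite (comp_ap1 ca) ap_zero.
  have [d [x E]] := gen i w; move: cw0; rewrite E apD (comp_ap1 ca) ap_zero add0r.
  rewrite (comp_ap1 cb) => /ex[k <-]; exists (d + h $ k); rewrite apD; congr (_ + _).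
  rewrite !ap_comp; apply/eqP; rewrite -subr_eq0 -apB; apply/eqP/rE; exists k.
  by rewrite [LHS]dec Ej1 Ej2 apN.
- by move=> i y; have [x <-] := ps i y; exists (compm r i2 $ x); rewrite (comp_ap1 cb).
Qed.

Lemma pushout_sex (K P X D G : Y) (m : Mor K P) (p : Mor P X) (h : Mor K D)
    (g : Mor D G) : sex m p -> sex h g ->
  exists (W : Y) (a : Mor D W) (b : Mor P W) (c : Mor W X) (e : Mor W G),
  [/\ sex a c, sex b e, compm a h = compm b m, compm c b = p & compm e a = g].
Proof.
move=> mp hg; have [hi hex gs] := hg; have [mi mex ps] := mp.
have [W [a [b [c [ac ah cb gen [inter U]]]]]] := pushout h mp.
have [|e [ea eb]] := U G g (zerom P G); first by rewrite (sex_comp0 hg) comp0m.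
have eb0 i (x : el cY P i) : e $ (b $ x) = 0 by rewrite (comp_ap1 eb) ap_zero.
exists W, a, b, c, e; split=> //; split.
- move=> i x bx0; have [|k [hk mk]] := inter i 0 x; first by rewrite bx0 ap0.
  by rewrite -mk (hi _ _ hk) ap0.
- move=> i w; split=> [|[x <-]//]; have [d [x ->]] := gen i w.
  rewrite apD (comp_ap1 ea) eb0 addr0 => /hex[k <-].
  by exists (m $ k + x); rewrite apD (comp_ap ah).
- by move=> i y; have [d <-] := gs i y; exists (a $ d); rewrite (comp_ap1 ea).
Qed.

Lemma pullback (D E C T : Y) (f : Mor D E) (g : Mor E C) (h : Mor T C) : sex f g ->
  exists (W : Y) (a : Mor D W) (b : Mor W E) (c : Mor W T),
  [/\ sex a c, compm b a = f, compm g b = compm h c,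
      forall i (w : el cY W i), b $ w = 0 -> c $ w = 0 -> w = 0 &
      (forall i (e : el cY E i) t, g $ e = h $ t -> exists w, b $ w = e /\ c $ w = t) /\
      forall (S : Y) (u : Mor S E) (v : Mor S T), compm g u = compm h v ->
        exists w : Mor S W, compm b w = u /\ compm c w = v].
Proof.
move=> fg; have [fi ex gs] := fg.
have [Q [p1 [p2 [pp pi pU]]]] := prod_ex cY E T.
pose t := msub cY (compm g p1) (compm h p2).
have tE i z : t $ z = g $ (p1 $ z) - h $ (p2 $ z) :> el cY C i.
  by rewrite !ap_sub !ap_comp.
have [W [k [ki kE]]] := ker_ex cY t.
have U (S : Y) (u : Mor S E) (v : Mor S T) : compm g u = compm h v ->
    exists w : Mor S W, compm (compm p1 k) w = u /\ compm (compm p2 k) w = v.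
  move=> e; have [z [z1 z2]] := pU _ u v.
  have [i x|w wE] := fac_inj cY k z ki.
    by apply/kE; rewrite tE (comp_ap1 z1) (comp_ap1 z2) (comp_ap e) subrr.
  by exists w; rewrite -!compmA wE.
have comm : compm g (compm p1 k) = compm h (compm p2 k).
  apply: (ap_ext cY) => i w; rewrite !ap_comp; apply/eqP.
  by rewrite -subr_eq0 -tE; apply/eqP/kE; exists w.
have mono i (w : el cY W i) : compm p1 k $ w = 0 -> compm p2 k $ w = 0 -> w = 0.
  by rewrite !ap_comp => w1 w2; apply: ki; apply: pi.
have full i (e : el cY E i) t' : g $ e = h $ t' ->
    exists w, compm p1 k $ w = e /\ compm p2 k $ w = t'.
  move=> eq; have [z [z1 z2]] := pp i e t'.
  have [|w wz] := (kE i z).1; first by rewrite tE z1 z2 eq subrr.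
  by exists w; rewrite !ap_comp wz.
have [|a [a1 a2]] := U D f (zerom D T); first by rewrite (sex_comp0 fg) compm0.
exists W, a, (compm p1 k), (compm p2 k); split=> //; split.
- by move=> i x ax0; apply: fi; rewrite -a1 ap_comp ax0 ap0.
- move=> i w; split=> [w0|[x <-]]; last by rewrite (comp_ap1 a2) ap_zero.
  have /ex[x fx] : g $ (compm p1 k $ w) = 0 by rewrite (comp_ap comm) w0 ap0.
  exists x; apply/eqP; rewrite -subr_eq0; apply/eqP/mono.
    by rewrite apB (comp_ap1 a1) fx subrr.
  by rewrite apB (comp_ap1 a2) ap_zero w0 subrr.
- move=> i y; have [e eE] := gs i (h $ y).
  by have [w [_ wy]] := full i e y eE; exists w.
Qed.

Lemma pullback_sex (D E C T K : Y) (f : Mor D E) (g : Mor E C) (l : Mor K T)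
    (h : Mor T C) : sex f g -> sex l h ->
  exists (W : Y) (a : Mor D W) (b : Mor W E) (c : Mor W T) (e : Mor K W),
  [/\ sex a c, sex e b, compm b a = f & compm g b = compm h c].
Proof.
move=> fg lh; have [li lex hs] := lh; have [fi fex gs] := fg.
have [W [a [b [c [ac ba gb mono [full U]]]]]] := pullback h fg.
have [|e [be ce]] := U K (zerom K E) l; first by rewrite (sex_comp0 lh) compm0.
exists W, a, b, c, e; split=> //; split.
- by move=> i x ex0; apply: li; rewrite -(comp_ap1 ce) ex0 ap0.
- move=> i w; split=> [bw0|[x <-]]; last by rewrite (comp_ap1 be) ap_zero.
  have /lex[x lx] : h $ (c $ w) = 0 by rewrite -(comp_ap gb) bw0 ap0.
  exists x; apply/eqP; rewrite -subr_eq0; apply/eqP/mono; rewrite apB.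
    by rewrite (comp_ap1 be) ap_zero bw0 subrr.
  by rewrite (comp_ap1 ce) lx subrr.
- move=> i y; have [t tE] := hs i (g $ y).
  by have [w [wy _]] := full i y t (esym tE); exists w.
Qed.

(** ** Vanishing of Ext *)

Lemma section_retraction (D E C : Y) (f : Mor D E) (g : Mor E C) (s : Mor C E) :
  sex f g -> compm g s = idm C ->
  exists r : Mor E D, compm r f = idm D /\
    forall i (x : el cY E i), f $ (r $ x) = x - s $ (g $ x).
Proof.
move=> fg gs; have [fi ex _] := fg.
have [|i x|r rE] := fac_inj cY f (msub cY (idm E) (compm s g)) => //.
  by apply/ex; rewrite ap_sub ap_id ap_comp apB (comp_ap_id gs) subrr.
have E1 i (x : el cY E i) : f $ (r $ x) = x - s $ (g $ x).
  by rewrite (comp_ap1 rE) ap_sub ap_id ap_comp.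
exists r; split=> //; apply: (ap_ext cY) => i x; apply: (minjE fi).
by rewrite ap_comp E1 (sex_ap0 fg) ap0 subr0 ap_id.
Qed.

Lemma retraction_section (D E C : Y) (f : Mor D E) (g : Mor E C) (r : Mor E D) :
  sex f g -> compm r f = idm D -> exists s : Mor C E, compm g s = idm C.
Proof.
move=> fg rf; have [fi ex gs] := fg.
have [|i x /ex[y <-]|s sE] :=
    fac_surj cY g (msub cY (idm E) (compm f r)) => //.
  by rewrite ap_sub ap_id ap_comp (comp_ap_id rf) subrr.
exists s; apply: (ap_ext cY) => i y; have [x <-] := gs i y.
by rewrite ap_comp (comp_ap1 sE) ap_sub !ap_comp !ap_id apB (sex_ap0 fg) subr0.
Qed.

Lemma Ext0P (C D : Y) : Ext1_zero C D <->
  forall (E : Y) (f : Mor D E) (g : Mor E C), sex f g -> exists s, compm g s = idm C.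
Proof.
split=> [ext0 E f g fg|split_ [E f g fg] [E' f' g' fg']].
  have [P [p1 [p2 [pp pi pU]]]] := prod_ex cY D C.
  have [i1 [i11 i12]] := pU _ (idm D) (zerom D C).
  have [i2 [i21 i22]] := pU _ (zerom C D) (idm C).
  have ip : sex i1 p2.
    split.
    - by move=> i x x0; rewrite -(comp_ap_id i11 x) x0 ap0.
    - move=> i z; split=> [z0|[x <-]]; last by rewrite (comp_ap1 i12) ap_zero.
      exists (p1 $ z); apply/eqP; rewrite -subr_eq0; apply/eqP/pi.
        by rewrite apB (comp_ap_id i11) subrr.
      by rewrite apB (comp_ap1 i12) ap_zero z0 subrr.
    - by move=> i y; exists (i2 $ y); rewrite (comp_ap_id i22).
  have [u [_ /= gu]] := ext0 (Extension ((short_exactP _ _).2 ip))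
                             (Extension ((short_exactP _ _).2 fg)).
  by exists (compm u i2); rewrite compmA gu.
have sfg := (short_exactP _ _).1 fg; have sfg' := (short_exactP _ _).1 fg'.
have [s gs] := split_ _ _ _ sfg; have [s' gs'] := split_ _ _ _ sfg'.
have [r [rf _]] := section_retraction sfg gs.
(* This is [f' r + s' g]: the retraction of one extension and the section of the other identify both
   with the split one. Sums are written by differences, the only operation on morphisms in the
   interface. *)
exists (msub cY (compm f' r) (msub cY (zerom E E') (compm s' g))) => /=.
split; apply: (ap_ext cY) => i x.
  by rewrite !(ap_comp, ap_sub) ap_zero (comp_ap_id rf) (sex_ap0 sfg) ap0 !subr0.
rewrite !(ap_comp, ap_sub) ap_zero sub0r opprK apD (sex_ap0 sfg') add0r.
by rewrite (comp_ap_id gs').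
Qed.

Lemma Ext0_extend (K P C D : Y) (m : Mor K P) (p : Mor P C) (h : Mor K D) :
  sex m p -> Ext1_zero C D -> exists h' : Mor P D, compm h' m = h.
Proof.
move=> mp /Ext0P ext0; have [W [a [b [c [ac ah _ _ _]]]]] := pushout h mp.
have [s cs] := ext0 _ _ _ ac; have [r [ra _]] := section_retraction ac cs.
by exists (compm r b); rewrite -compmA -ah compmA ra comp1m.
Qed.

Lemma Ext0_lift (D I Q C : Y) (f : Mor D I) (g : Mor I Q) (h : Mor C Q) :
  sex f g -> Ext1_zero C D -> exists h' : Mor C I, compm g h' = h.
Proof.
move=> fg /Ext0P ext0; have [W [a [b [c [ac _ gb _ _]]]]] := pullback h fg.
have [s cs] := ext0 _ _ _ ac.
by exists (compm b s); rewrite compmA gb -compmA cs compm1.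
Qed.

(** Exactness of Hom(P,D) -> Hom(K,D) -> Ext(C,D) -> Ext(P,D), without connecting maps: [p] lifts to
    [E], the lift restricts to a map from [K] to [D], and an extension of this map to [P] corrects
    the lift until it factors through [C]. *)
Lemma Ext0_shiftl (K P C D : Y) (m : Mor K P) (p : Mor P C) :
  sex m p -> Ext1_zero P D ->
  (forall h : Mor K D, exists h' : Mor P D, compm h' m = h) -> Ext1_zero C D.
Proof.
move=> mp extP ext; apply/Ext0P => E f g fg; have [mi mex ps] := mp.
have [fi fex gs] := fg.
have [l gl] := Ext0_lift p fg extP.
have [//|i x|h hE] := fac_inj cY f (compm l m).
  by apply/fex; rewrite ap_comp (comp_ap1 gl) (sex_ap0 mp).
have [h' h'E] := ext h.
have [//|i x /mex[k <-]|s sE] :=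
    fac_surj cY p (msub cY l (compm f h')).
  by rewrite ap_sub ap_comp (comp_ap1 h'E) (comp_ap1 hE) ap_comp subrr.
exists s; apply: (ap_ext cY) => i y; have [x <-] := ps i y.
by rewrite ap_comp (comp_ap1 sE) ap_sub apB ap_comp (sex_ap0 fg) (comp_ap1 gl) subr0 ap_id.
Qed.

Lemma Ext0_shiftr (D I Q C : Y) (f : Mor D I) (g : Mor I Q) :
  sex f g -> Ext1_zero C I ->
  (forall h : Mor C Q, exists h' : Mor C I, compm g h' = h) -> Ext1_zero C D.
Proof.
move=> fg extI lift; apply/Ext0P => E m p mp; have [mi mex ps] := mp.
have [fi fex gs] := fg.
suff [r rm] : exists r : Mor E D, compm r m = idm D by exact: retraction_section mp rm.
have [l lm] := Ext0_extend f mp extI.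
have [//|i x /mex[k <-]|h hE] := fac_surj cY p (compm g l).
  by rewrite ap_comp (comp_ap1 lm) (sex_ap0 fg).
have [h' h'E] := lift h.
have [//|i x|r rE] := fac_inj cY f (msub cY l (compm h' p)).
  apply/fex; rewrite ap_sub ap_comp apB (comp_ap1 h'E) (comp_ap1 hE) ap_comp.
  by rewrite subrr.
exists r; apply: (ap_ext cY) => i y; apply: (minjE fi).
by rewrite ap_comp (comp_ap1 rE) ap_sub ap_comp (sex_ap0 mp) ap0 subr0 (comp_ap1 lm) ap_id.
Qed.

Lemma Ext0_retractl (C C' D : Y) (j : Mor C C') (r : Mor C' C) :
  compm r j = idm C -> Ext1_zero C' D -> Ext1_zero C D.
Proof.
move=> rj ext0; apply/Ext0P => E f g fg; have [t gt] := Ext0_lift r fg ext0.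
by exists (compm t j); rewrite compmA gt.
Qed.

Lemma Ext0_retractr (C D D' : Y) (j : Mor D D') (r : Mor D' D) :
  compm r j = idm D -> Ext1_zero C D' -> Ext1_zero C D.
Proof.
move=> rj ext0; apply/Ext0P => E f g fg; have [t tf] := Ext0_extend j fg ext0.
by apply: (retraction_section (r := compm r t) fg); rewrite -compmA tf.
Qed.

(** A lift [t] of [C1] into [E] is divided out. The quotient is an extension of [C2] by [D], and a
    retraction of it is a retraction of [f]. *)
Lemma Ext0_extl (C1 C C2 D : Y) (j : Mor C1 C) (p : Mor C C2) :
  sex j p -> Ext1_zero C1 D -> Ext1_zero C2 D -> Ext1_zero C D.
Proof.
move=> jp ext1 ext2; apply/Ext0P => E f g fg; have [ji jex ps] := jp.
have [fi fex gs] := fg.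
have [t gt] := Ext0_lift j fg ext1.
have [E' [q [qs qE]]] := coker_ex cY t.
have [//|i x /qE[c <-]|g' g'E] := fac_surj cY q (compm p g).
  by rewrite ap_comp (comp_ap1 gt) (sex_ap0 jp).
have qf : sex (compm q f) g'.
  split.
  - move=> i d; rewrite ap_comp => /qE[c cE].
    have c0 : c = 0 by apply: ji; rewrite -(comp_ap1 gt) cE (sex_ap0 fg).
    by apply: fi; rewrite -cE c0 ap0.
  - move=> i e'; have [e <-] := qs i e'; rewrite (comp_ap1 g'E) ap_comp.
    split=> [/jex[c cE]|[d]].
      have /fex[d dE] : g $ (e - t $ c) = 0 by rewrite apB (comp_ap1 gt) cE subrr.
      exists d; rewrite ap_comp dE apB -[RHS]subr0; congr (_ - _).
      by apply/qE; exists c.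
    rewrite ap_comp => qfd.
    have /qE[c cE] : q $ (e - f $ d) = 0 by rewrite apB qfd subrr.
    have -> : e = t $ c + f $ d by rewrite cE subrK.
    by rewrite apD (sex_ap0 fg) addr0 (comp_ap1 gt) (sex_ap0 jp).
  - move=> i y; have [c <-] := ps i y; have [e <-] := gs i c.
    by exists (q $ e); rewrite (comp_ap1 g'E) ap_comp.
have [s gs'] := (Ext0P _ _).1 ext2 _ _ _ qf.
have [r [rq _]] := section_retraction qf gs'.
by apply: (retraction_section (r := compm r q) fg); rewrite -compmA.
Qed.

(** Dually, [p] extends to [t] on [E], and the kernel of [t] is an extension of [C] by [D1] whose
    section serves for [g]. *)
Lemma Ext0_extr (C D1 D D2 : Y) (j : Mor D1 D) (p : Mor D D2) :
  sex j p -> Ext1_zero C D1 -> Ext1_zero C D2 -> Ext1_zero C D.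
Proof.
move=> jp ext1 ext2; apply/Ext0P => E f g fg; have [ji jex ps] := jp.
have [fi fex gs] := fg.
have [t tf] := Ext0_extend p fg ext2.
have [E' [k [ki kE]]] := ker_ex cY t.
have [//|i x|f' f'E] := fac_inj cY k (compm f j).
  by apply/kE; rewrite ap_comp (comp_ap1 tf) (sex_ap0 jp).
have fk : sex f' (compm g k).
  split.
  - move=> i d d0; apply: ji; apply: fi.
    by rewrite -ap_comp -(comp_ap1 f'E) d0 ap0.
  - move=> i e; rewrite ap_comp; split=> [/fex[d dE]|[d <-]]; last first.
      by rewrite (comp_ap1 f'E) ap_comp (sex_ap0 fg).
    have /jex[c cE] : p $ d = 0.
      by rewrite -(comp_ap1 tf) dE; apply/kE; exists e.
    by exists c; apply: (minjE ki); rewrite (comp_ap1 f'E) ap_comp cE dE.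
  - move=> i y; have [e eE] := gs i y; have [d dE] := ps i (t $ e).
    have /kE[e' e'E] : t $ (e - f $ d) = 0 by rewrite apB (comp_ap1 tf) dE subrr.
    by exists e'; rewrite ap_comp e'E apB (sex_ap0 fg) subr0.
have [s gs'] := (Ext0P _ _).1 ext1 _ _ _ fk.
by exists (compm k s); rewrite compmA.
Qed.

Lemma sex_ker (A B : Y) (f : Mor A B) : msurj f -> exists (K : Y) (k : Mor K A), sex k f.
Proof. by move=> fs; have [K [k [ki kE]]] := ker_ex cY f; exists K, k. Qed.

Lemma sex_coker (A B : Y) (f : Mor A B) :
  minj f -> exists (C : Y) (p : Mor B C), sex f p.
Proof. by move=> fi; have [C [p [ps pE]]] := coker_ex cY f; exists C, p. Qed.

(* Salce's lemma *)
Lemma salce (G D : Y -> Prop) (X P K : Y) (m : Mor K P) (p : Mor P X) :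
  (forall (A B C : Y) (f : Mor A B) (g : Mor B C), sex f g -> G A -> G C -> G B) ->
  sex m p -> G P ->
  (exists (D1 G1 : Y) (f : Mor K D1) (g : Mor D1 G1), [/\ D D1, G G1 & sex f g]) ->
  exists (D0 G0 : Y) (f : Mor D0 G0) (g : Mor G0 X), [/\ D D0, G G0 & sex f g].
Proof.
move=> Gext mp GP [D1 [G1 [f [g [DD GG fg]]]]].
have [W [a [b [c [e [ac be _ _ _]]]]]] := pushout_sex mp fg.
by exists D1, W, a, c; split=> //; apply: Gext be GP GG.
Qed.

End Generic.

(** * Modules *)

Section Modules.
Variable R : pzRingType.
Implicit Types U V W T : lmodType R.

Section MkLin.
Variables (U V : lmodType R) (f : U -> V) (fP : linear f).
Definition mklin_fun : U -> V := f.
HB.instance Definition _ := GRing.isLinear.Build R U V _ mklin_fun fP.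
Definition mklin : {linear U -> V} := mklin_fun.
End MkLin.

Definition lin_closed (V : lmodType R) (P : V -> Prop) : Prop :=
  P 0 /\ forall a x y, P x -> P y -> P (a *: x + y).

Section SubPred.
Variables (V : lmodType R) (P : V -> Prop) (PP : lin_closed P).
(** The closure proof is an argument so that inference of the submodule structure recovers it from
    the predicate. *)
Definition prop_pred of lin_closed P : {pred V} := fun x => `[< P x >].
Fact prop_pred_submod : subsemimod_closed (prop_pred PP).
Proof.
have [P0 PD] := PP.
split; [split|] => [|x y|a x]; rewrite !unfold_in.
- exact/asboolP.
- move=> /asboolP Px /asboolP Py; apply/asboolP.
  by rewrite -[x]scale1r; apply: PD.
- by move=> /asboolP Px; apply/asboolP; rewrite -[_ *: _]addr0; apply: PD.
Qed.
HB.instance Definition _ := GRing.isSubmodClosed.Build R V (prop_pred PP) prop_pred_submod.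

Lemma sub_exM : exists (U : lmodType R) (i : {linear U -> V}),
  injective i /\ forall x, P x <-> exists y, i y = x.
Proof.
exists (submod (prop_pred PP)).
have vl : linear (fun x : submod (prop_pred PP) => submod_val x) by [].
exists (mklin vl); split=> [x y|x].
  by move=> e; apply: val_inj.
split=> [Px|[y <-]]; last by apply/asboolP; exact: submod_in y.
have Px' : x \in prop_pred PP by apply/asboolP.
by exists (Submod Px').
Qed.

Lemma quo_exM : exists (U : lmodType R) (p : {linear V -> U}),
  (forall y, exists x, p x = y) /\ forall x, p x = 0 <-> P x.
Proof.
exists (quotmod (prop_pred PP)), (@quotmod_pi _ _ (prop_pred PP)); split.
  exact: quotmod_piP.
move=> x; rewrite -(linear0 (@quotmod_pi _ _ (prop_pred PP))); split.
  by move=> /eqP; rewrite quotmod_pi_eq subr0 => /asboolP.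
by move=> Px; apply/eqP; rewrite quotmod_pi_eq subr0; apply/asboolP.
Qed.

End SubPred.

Lemma fac_injM U V W (m : {linear U -> V}) (h : {linear W -> V}) :
  (forall x, m x = 0 -> x = 0) -> (forall x, exists y, m y = h x) ->
  exists u : {linear W -> U}, forall x, m (u x) = h x.
Proof.
move=> mi /choice[u uE].
have ul : linear u.
  move=> a x y; apply/eqP; rewrite -subr_eq0; apply/eqP/mi.
  by rewrite linearB linearP !uE linearP subrr.
by exists (mklin ul).
Qed.

Lemma fac_surjM U V W (p : {linear U -> V}) (h : {linear U -> W}) :
  (forall y, exists x, p x = y) -> (forall x, p x = 0 -> h x = 0) ->
  exists u : {linear V -> W}, forall x, u (p x) = h x.
Proof.
move=> /choice[s sE] ph.
have eqh x y : p x = p y -> h x = h y.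
  move=> e; apply/eqP; rewrite -subr_eq0 -linearB; apply/eqP/ph.
  by rewrite linearB e subrr.
have ul : linear (fun y => h (s y)).
  by move=> a x y; rewrite -linearP; apply: eqh; rewrite linearP !sE.
by exists (mklin ul) => x; apply: eqh; apply: sE.
Qed.

Lemma ker_lin_closed U V (f : {linear U -> V}) : lin_closed (fun x => f x = 0).
Proof.
by split=> [|a x y fx fy]; rewrite ?linear0 // linearP fx fy scaler0 addr0.
Qed.

Lemma im_lin_closed U V (f : {linear U -> V}) : lin_closed (fun y => exists x, f x = y).
Proof.
split=> [|a x y [u <-] [v <-]]; first by exists 0; rewrite linear0.
by exists (a *: u + v); rewrite linearP.
Qed.

Lemma fst_linear U V : linear (fun z : (U * V)%type => z.1). Proof. by []. Qed.
Lemma snd_linear U V : linear (fun z : (U * V)%type => z.2). Proof. by []. Qed.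
Lemma pair_linear U V W (f : {linear W -> U}) (g : {linear W -> V}) :
  linear (fun x => (f x, g x)).
Proof. by move=> a x y; rewrite !linearP. Qed.

Lemma inj_linear U V (f : {linear U -> V}) :
  (forall x, f x = 0 -> x = 0) -> injective f.
Proof.
by move=> fi x y e; apply/eqP; rewrite -subr_eq0; apply/eqP/fi; rewrite linearB e subrr.
Qed.

Lemma pair_eq0 U V (z : (U * V)%type) : z.1 = 0 -> z.2 = 0 -> z = 0.
Proof. by case: z => x y /= -> ->. Qed.

Lemma prod_exM U V : exists (P : lmodType R) (p1 : {linear P -> U}) (p2 : {linear P -> V}),
  [/\ forall x y, exists z, p1 z = x /\ p2 z = y,
      forall z, p1 z = 0 -> p2 z = 0 -> z = 0 &
      forall W (f : {linear W -> U}) (g : {linear W -> V}), exists h : {linear W -> P},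
        forall x, p1 (h x) = f x /\ p2 (h x) = g x].
Proof.
exists (U * V)%type, (mklin (@fst_linear U V)), (mklin (@snd_linear U V)).
split=> [x y|z z1 z2|W f g]; [by exists (x, y)|exact: pair_eq0 z1 z2|].
by exists (mklin (pair_linear f g)).
Qed.

(** A module has elements of a single sort. The definition is transparent so that [el] and [ap]
    reduce to the carrier and to application. *)
Definition modConc : concrete (modCat R).
Proof.
pose el (A : modCat R) (i : unit) : zmodType := (A : lmodType R).
pose ap (A B : modCat R) (f : Mor A B) i (x : el A i) : el B i :=
  (f : {linear _ -> _}) x.
pose msub (A B : modCat R) (f g : Mor A B) : Mor A B :=
  ((f : {linear _ -> _}) \- (g : {linear _ -> _}))%R.
apply: (@Concrete (modCat R) unit el ap msub).
- by [].
- by move=> A B f i x y; apply: linearB.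
- by move=> A B f g e; apply: linear_ext => x; apply: (e tt).
- by [].
- by [].
- by [].
- move=> A B f; have [K [k [ki kE]]] := sub_exM (ker_lin_closed f).
  exists K, k; split=> i x; last exact: kE.
  by move=> kx; apply: ki; rewrite linear0.
- move=> A B f; have [C [p [ps pE]]] := quo_exM (im_lin_closed f).
  by exists C, p; split=> i x; [apply: ps|apply: pE].
- move=> A B; have [P [p1 [p2 [H1 H2 H3]]]] := prod_exM A B.
  exists P, p1, p2; split=> [i|i|T f g]; [exact: H1|exact: H2|].
  by have [h hE] := H3 T f g; exists h; split; apply: linear_ext => x; case: (hE x).
- move=> A B T m h mi hE; have [||u uE] := @fac_injM A B T m h.
  + exact: (mi tt).
  + exact: (hE tt).
  by exists u; apply: linear_ext.
- move=> A B T p h ps pE; have [||u uE] := @fac_surjM A B T p h.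
  + exact: (ps tt).
  + exact: (pE tt).
  by exists u; apply: linear_ext.
Defined.

End Modules.

(** * Periodic complexes *)

Section Complexes.
Variables (R : pzRingType) (N : nat).
Local Notation p := (@ord_pred N).
Local Notation d X := (pc_d X _).
Implicit Types X Y Z : pcomplex R N.

(** Constructions with differentials yield data in degree [p q]. The transport along [ordSK] that
    turns them into a family over all degrees is confined to this lemma. *)
Lemma pred_fam (T : 'I_N -> Type) (F : forall q, T (p q)) :
  exists h : forall q, T q, forall q, h (p q) = F q.
Proof.
exists (fun q => ecast i (T i) (ordSK q) (F (ordS q))) => q.
suff H r (e : p r = p q) : r = q -> ecast i (T i) e (F r) = F q.
  by apply: H; apply: ord_predK.
by move=> er; subst r; rewrite (eq_axiomK e).
Qed.

Lemma pred_all (P : 'I_N -> Prop) : (forall q, P (p q)) -> forall q, P q.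
Proof. by move=> H q; rewrite -(ordSK q). Qed.

Lemma sub_ex X (P : forall q, X q -> Prop) :
  (forall q, lin_closed (P q)) -> (forall q x, P q x -> P (p q) (d X x)) ->
  exists (K : pcomplex R N) (k : pcmap K X), forall q,
    injective (k q) /\ forall x, P q x <-> exists y, k q y = x.
Proof.
move=> PP Pd.
have [K /dep_choice[k kE]] := dep_choice (fun q => sub_exM (PP q)).
have [dK dKE] : exists dK : forall q, {linear K q -> K (p q)},
    forall q x, k (p q) (dK q x) = d X (k q x).
  apply: (dep_choice (P := fun q (dK : {linear K q -> K (p q)}) =>
    forall x, k (p q) (dK x) = d X (k q x))) => q.
  apply: (fac_injM (m := k (p q)) (h := lin_comp (pc_d X q) (k q))) => x.
    by move=> kx; apply: (kE (p q)).1; rewrite linear0.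
  by apply/(kE (p q)).2; apply: Pd; apply/(kE q).2; exists x.
have dd q x : dK (p q) (dK q x) = 0.
  by apply: (kE _).1; rewrite !dKE pc_dd linear0.
pose KC := @PComplex R N K dK dd.
by exists KC, (@PCMap R N KC X k dKE).
Qed.

Lemma quo_ex X (P : forall q, X q -> Prop) :
  (forall q, lin_closed (P q)) -> (forall q x, P q x -> P (p q) (d X x)) ->
  exists (C : pcomplex R N) (c : pcmap X C), forall q,
    (forall y, exists x, c q x = y) /\ forall x, c q x = 0 <-> P q x.
Proof.
move=> PP Pd.
have [C /dep_choice[c cE]] := dep_choice (fun q => quo_exM (PP q)).
have [dC dCE] : exists dC : forall q, {linear C q -> C (p q)},
    forall q x, dC q (c q x) = c (p q) (d X x).
  apply: (dep_choice (P := fun q (dC : {linear C q -> C (p q)}) =>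
    forall x, dC (c q x) = c (p q) (d X x))) => q.
  apply: (fac_surjM (p := c q) (h := lin_comp (c (p q)) (pc_d X q))) => x.
    exact: (cE q).1.
  by move=> /(cE q).2 Px; apply/(cE (p q)).2; apply: Pd.
have dd q x : dC (p q) (dC q x) = 0.
  by have [y <-] := (cE q).1 x; rewrite !dCE pc_dd linear0.
pose CC := @PComplex R N C dC dd.
by exists CC, (@PCMap R N X CC c (fun q x => esym (dCE q x))).
Qed.

Lemma prod_pc_ex X Y : exists (P : pcomplex R N) (p1 : pcmap P X) (p2 : pcmap P Y),
  [/\ forall q x y, exists z, p1 q z = x /\ p2 q z = y,
      forall q z, p1 q z = 0 -> p2 q z = 0 -> z = 0 &
      forall Z (f : pcmap Z X) (g : pcmap Z Y), exists h : pcmap Z P,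
        forall q x, p1 q (h q x) = f q x /\ p2 q (h q x) = g q x].
Proof.
have dl q : linear (fun z : (X q * Y q)%type => (d X z.1, d Y z.2)).
  by move=> a x y; rewrite !linearP.
pose P := @PComplex R N (fun q => (X q * Y q)%type) (fun q => mklin (dl q))
  (fun q z => congr2 pair (pc_dd z.1) (pc_dd z.2)).
exists P, (@PCMap R N P X (fun q => mklin (@fst_linear _ (X q) (Y q))) (fun _ _ => erefl)).
exists (@PCMap R N P Y (fun q => mklin (@snd_linear _ (X q) (Y q))) (fun _ _ => erefl)).
split=> [q x y|q z z1 z2|Z f g]; [by exists (x, y)|exact: pair_eq0 z1 z2|].
have hc q x : (f (p q) (d Z x), g (p q) (d Z x)) = (d X (f q x), d Y (g q x)).
  by rewrite !pc_comm.
by exists (@PCMap R N Z P (fun q => mklin (pair_linear (f q) (g q))) hc).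
Qed.

Fact pc_sub_comm X Y (f g : pcmap X Y) q (x : X q) :
  (f (p q) \- g (p q))%R (d X x) = d Y ((f q \- g q)%R x).
Proof. by rewrite /= !pc_comm linearB. Qed.

Definition pc_sub X Y (f g : pcmap X Y) : pcmap X Y :=
  @PCMap R N X Y (fun q => (f q \- g q)%R) (pc_sub_comm f g).

Definition pcConc : concrete (pcCat R N).
Proof.
pose el (A : pcCat R N) (i : 'I_N) : zmodType := (A : pcomplex R N) i.
pose ap (A B : pcCat R N) (f : Mor A B) i (x : el A i) : el B i :=
  (f : pcmap _ _) i x.
apply: (@Concrete (pcCat R N) _ el ap pc_sub).
- by [].
- by move=> A B f i x y; apply: linearB.
- by move=> A B f g e; apply: pcmap_ext.
- by [].
- by [].
- by [].
- move=> A B f; have [|K [k kE]] := sub_ex (X := A) (fun q => ker_lin_closed (f q)).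
    by move=> q x fx0; rewrite pc_comm fx0 linear0.
  exists K, k; split=> i x; last exact: (kE i).2.
  by move=> kx; apply: (kE i).1; rewrite linear0.
- move=> A B f; have [|K [k kE]] := quo_ex (X := B) (fun q => im_lin_closed (f q)).
    by move=> q x [y <-]; exists (d _ y); rewrite pc_comm.
  by exists K, k; split=> i x; [apply: (kE i).1|apply: (kE i).2].
- move=> A B; have [P [p1 [p2 [H1 H2 H3]]]] := prod_pc_ex A B.
  exists P, p1, p2; split=> // T f g; have [h hE] := H3 T f g.
  by exists h; split; apply: pcmap_ext => q x; case: (hE q x).
- move=> A B T m h mi hE.
  have /dep_choice[u uE] : forall q, exists u : {linear T q -> A q}, forall x, m q (u x) = h q x.
    by move=> q; apply: fac_injM; [apply: mi|apply: hE].
  have uc q x : u (p q) (d T x) = d A (u q x).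
    by apply: (inj_linear (mi _)); rewrite pc_comm !uE pc_comm.
  by exists (@PCMap R N T A u uc); apply: pcmap_ext => q x; apply: uE.
- move=> A B T m h mi hE.
  have /dep_choice[u uE] : forall q, exists u : {linear B q -> T q}, forall x, u (m q x) = h q x.
    by move=> q; apply: fac_surjM; [apply: mi|apply: hE].
  have uc q x : u (p q) (d B x) = d T (u q x).
    by have [y <-] := mi q x; rewrite -pc_comm !uE pc_comm.
  by exists (@PCMap R N B T u uc); apply: pcmap_ext => q x; apply: uE.
Defined.

End Complexes.

(** * Vanishing of Ext for modules, in terms of elements *)

Section ModuleExt.
Variable R : pzRingType.
Implicit Types U V W C D : lmodType R.

Definition ExtM U V : Prop := @Ext1_zero (modCat R) U V.
Definition sexM U V W (f : {linear U -> V}) (g : {linear V -> W}) : Prop :=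
  @sex (modCat R) (modConc R) U V W f g.

Lemma sexMP U V W (f : {linear U -> V}) (g : {linear V -> W}) :
  sexM f g <-> [/\ forall x, f x = 0 -> x = 0,
                 forall y, g y = 0 <-> (exists x, f x = y) &
                 forall z, exists y, g y = z].
Proof.
split=> -[fi ex gs]; split; [exact: (fi tt)|exact: (ex tt)|exact: (gs tt)| | |].
- by move=> i; apply: fi.
- by move=> i; apply: ex.
- by move=> i; apply: gs.
Qed.

Lemma ExtM_split U V : ExtM U V <-> forall W (f : {linear V -> W}) (g : {linear W -> U}),
  sexM f g -> exists s : {linear U -> W}, forall x, g (s x) = x.
Proof.
apply: (iff_trans (Ext0P (modConc R) _ _)).
split=> H E f g fg; have [s sE] := H E f g fg; exists s.
  by move=> x; have /(congr1 (fun h : {linear U -> U} => h x)) := sE.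
exact: linear_ext.
Qed.

Lemma ExtM_extend U V W D (f : {linear U -> V}) (g : {linear V -> W}) (h : {linear U -> D}) :
  sexM f g -> ExtM W D -> exists h' : {linear V -> D}, forall x, h' (f x) = h x.
Proof.
move=> fg ext0; have [h' h'E] := @Ext0_extend _ (modConc R) U V W D f g h fg ext0.
by exists h' => x; rewrite -h'E.
Qed.

Lemma ExtM_lift U V W C (f : {linear U -> V}) (g : {linear V -> W}) (h : {linear C -> W}) :
  sexM f g -> ExtM C U -> exists h' : {linear C -> V}, forall x, g (h' x) = h x.
Proof.
move=> fg ext0; have [h' h'E] := @Ext0_lift _ (modConc R) U V W C f g h fg ext0.
by exists h' => x; rewrite -h'E.
Qed.

Lemma ExtM_retractl U V D (f : {linear U -> V}) (g : {linear V -> U}) :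
  (forall x, g (f x) = x) -> ExtM V D -> ExtM U D.
Proof. by move=> gf; apply: (@Ext0_retractl _ (modConc R) U V D f g); apply: linear_ext. Qed.

Lemma ExtM_retractr U V C (f : {linear U -> V}) (g : {linear V -> U}) :
  (forall x, g (f x) = x) -> ExtM C V -> ExtM C U.
Proof. by move=> gf; apply: (@Ext0_retractr _ (modConc R) C U V f g); apply: linear_ext. Qed.

Lemma ExtM_free V : ExtM (R^o : lmodType R) V.
Proof.
apply/ExtM_split => W f g /sexMP[_ _ gs]; have [w wE] := gs 1.
have sl : linear (fun a : R^o => a *: w).
  by move=> a x y; rewrite scalerDl scalerA.
by exists (mklin sl) => x; rewrite linearZ /= wE -[RHS]mulr1.
Qed.

(** Classes are bare predicates, while cokernels, cycles and spliced modules are only known up to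
    isomorphism. Orthogonal classes have this closure property. *)
Definition iso_closed (A : modCat R -> Prop) := forall U V (f : {linear U -> V}),
  (forall x, f x = 0 -> x = 0) -> (forall y, exists x, f x = y) -> A U <-> A V.

Lemma lin_inverse U V (f : {linear U -> V}) :
  (forall x, f x = 0 -> x = 0) -> (forall y, exists x, f x = y) ->
  exists g : {linear V -> U}, (forall x, g (f x) = x) /\ forall y, f (g y) = y.
Proof.
move=> fi fs; have [|g gE] := fac_injM (h := lin_id V) fi.
  by move=> y; have [x <-] := fs y; exists x.
by exists g; split=> // x; apply: (inj_linear fi).
Qed.

Lemma lperp_iso (D : modCat R -> Prop) : iso_closed (lperp D).
Proof.
move=> U V f fi fs; have [g [gf fg]] := lin_inverse fi fs.
split=> H X DX; [apply: (ExtM_retractl (f := g) (g := f))|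
  apply: (ExtM_retractl (f := f) (g := g))] => //; exact: H.
Qed.

Lemma rperp_iso (D : modCat R -> Prop) : iso_closed (rperp D).
Proof.
move=> U V f fi fs; have [g [gf fg]] := lin_inverse fi fs.
split=> H X DX; [apply: (ExtM_retractr (f := g) (g := f))|
  apply: (ExtM_retractr (f := f) (g := g))] => //; exact: H.
Qed.

End ModuleExt.

(** * Ext of complexes against cones and stalks *)

Section ComplexExt.
Variables (R : pzRingType) (N : nat).
Local Notation p := (@ord_pred N).
Local Notation d X := (pc_d X _).
Implicit Types X Y Z C D E : pcomplex R N.
Implicit Types U V W M A B : lmodType R.
Implicit Type F : 'I_N -> lmodType R.

Definition ExtC X Y : Prop := @Ext1_zero (pcCat R N) X Y.
Definition sexC X Y Z (f : pcmap X Y) (g : pcmap Y Z) : Prop :=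
  @sex (pcCat R N) (pcConc R N) X Y Z f g.

Lemma sexC_deg X Y Z (f : pcmap X Y) (g : pcmap Y Z) :
  sexC f g <-> forall q, sexM (f q) (g q).
Proof.
split=> [[fi ex gs] q|H].
  by apply/sexMP; split; [apply: fi|apply: ex|apply: gs].
by split=> q; have /sexMP[] := H q.
Qed.

Lemma pcE X Y (f g : pcmap X Y) : f = g -> forall q x, f q x = g q x.
Proof. by move=> ->. Qed.

Lemma ExtC_split X Y : ExtC X Y <-> forall E (f : pcmap Y E) (g : pcmap E X),
  sexC f g -> exists s : pcmap X E, forall q x, g q (s q x) = x.
Proof.
apply: (iff_trans (Ext0P (pcConc R N) _ _)).
split=> H E f g fg; have [s sE] := H E f g fg; exists s.
  by move=> q x; have := pcE sE x.
exact: pcmap_ext.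
Qed.

Lemma ExtC_retraction X Y : ExtC X Y <-> forall E (f : pcmap Y E) (g : pcmap E X),
  sexC f g -> exists r : pcmap E Y, forall q x, r q (f q x) = x.
Proof.
apply: (iff_trans (Ext0P (pcConc R N) _ _)); split=> H E f g fg.
  have [s sE] := H E f g fg; have [r [rf _]] := section_retraction fg sE.
  by exists r => q x; have := pcE rf x.
have [r rE] := H E f g fg; apply: (@retraction_section _ (pcConc R N) Y E X f g r fg).
exact: pcmap_ext.
Qed.

Lemma ExtC_extend X Y Z D (f : pcmap X Y) (g : pcmap Y Z) (h : pcmap X D) :
  sexC f g -> ExtC Z D -> exists h' : pcmap Y D, forall q x, h' q (f q x) = h q x.
Proof.
move=> fg ext0; have [h' h'E] := @Ext0_extend _ (pcConc R N) X Y Z D f g h fg ext0; exists h' => q x.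
exact: (pcE h'E).
Qed.

Lemma ExtC_lift X Y Z C (f : pcmap X Y) (g : pcmap Y Z) (h : pcmap C Z) :
  sexC f g -> ExtC C X -> exists h' : pcmap C Y, forall q x, g q (h' q x) = h q x.
Proof.
move=> fg ext0; have [h' h'E] := @Ext0_lift _ (pcConc R N) X Y Z C f g h fg ext0; exists h' => q x.
exact: (pcE h'E).
Qed.

Lemma ExtC_shiftl X Y Z D (f : pcmap X Y) (g : pcmap Y Z) : sexC f g -> ExtC Y D ->
  (forall h : pcmap X D, exists h' : pcmap Y D, forall q x, h' q (f q x) = h q x) ->
  ExtC Z D.
Proof.
move=> fg ext0 H; apply: (@Ext0_shiftl _ (pcConc R N) X Y Z D f g fg ext0) => h; have [h' h'E] := H h.
by exists h'; apply: pcmap_ext.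
Qed.

Lemma ExtC_shiftr X Y Z C (f : pcmap X Y) (g : pcmap Y Z) : sexC f g -> ExtC C Y ->
  (forall h : pcmap C Z, exists h' : pcmap C Y, forall q x, g q (h' q x) = h q x) ->
  ExtC C X.
Proof.
move=> fg ext0 H; apply: (@Ext0_shiftr _ (pcConc R N) X Y Z C f g fg ext0) => h; have [h' h'E] := H h.
by exists h'; apply: pcmap_ext.
Qed.

(** ** Cones and stalks *)

Section Cone.
Variable F : 'I_N -> lmodType R.
Definition cone_d q (z : (F q * F (p q))%type) : (F (p q) * F (p (p q)))%type := (z.2, 0).
Fact cone_d_linear q : linear (@cone_d q).
Proof. by move=> a x y; congr (_, _) => /=; rewrite scaler0 addr0. Qed.
(** The contractible complex on a graded module, a sum of disks. It is right adjoint to forgetting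
    the differential ([to_cone]) and, up to a shift of the index, left adjoint to it
    ([from_cone]). *)
Definition cone : pcomplex R N :=
  @PComplex R N (fun q => (F q * F (p q))%type) (fun q => mklin (@cone_d_linear q))
    (fun q z => erefl).
End Cone.

Lemma to_cone X F (f : forall q, {linear X q -> F q}) :
  exists g : pcmap X (cone F), forall q x, g q x = (f q x, f (p q) (d X x)).
Proof.
have gl q : linear (fun x : X q => (f q x, f (p q) (d X x)) : cone F q).
  by move=> a x y; rewrite !linearP.
have gc q (x : X q) : mklin (gl (p q)) (d X x) = d (cone F) (mklin (gl q) x).
  by congr (_, _); rewrite pc_dd linear0.
by exists (@PCMap R N X (cone F) (fun q => mklin (gl q)) gc).
Qed.

Lemma to_coneE X F (g : pcmap X (cone F)) q x : (g q x).2 = (g (p q) (d X x)).1.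
Proof. by rewrite pc_comm. Qed.

Lemma from_cone X F (f : forall q, {linear F (p q) -> X q}) :
  exists g : pcmap (cone F) X, forall q,
    (forall y, g q (0, y) = f q y) /\ forall y, g (p q) (y, 0) = d X (f q y).
Proof.
(* Since [(y, 0) = d (0, y)], the value on first coordinates is forced to be [d f]. *)
have [h hE] := pred_fam (T := fun q => {linear F q -> X q})
  (fun q => lin_comp (pc_d X q) (f q)).
have dh : forall q x, d X (h q x) = 0.
  by apply: pred_all => q x; rewrite hE /= pc_dd.
have gl q : linear (fun z : cone F q => h q z.1 + f q z.2).
  by move=> a x y; rewrite !linearP scalerDr addrACA.
have gc q (z : cone F q) : mklin (gl (p q)) (d (cone F) z) = d X (mklin (gl q) z).
  by rewrite /= /mklin_fun /= hE linear0 addr0 linearD dh add0r.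
exists (@PCMap R N (cone F) X (fun q => mklin (gl q)) gc) => q.
by rewrite /= /mklin_fun /= hE; split=> y /=; rewrite ?linear0 ?add0r ?addr0.
Qed.

Lemma cone_gen F (P : forall q, cone F q -> Prop) :
  (forall q y, P q (0, y)) -> (forall q x, P q x -> P (p q) (d (cone F) x)) ->
  (forall q x y, P q x -> P q y -> P q (x + y)) -> forall q z, P q z.
Proof.
move=> P2 Pd PD q [x y]; have -> : (x, y) = (x, 0) + (0, y) :> (F q * F (p q))%type.
  by congr (_, _); rewrite /= ?addr0 ?add0r.
apply: (PD); last exact: P2.
by move: q x {y}; apply: pred_all => q x; have := Pd _ _ (P2 q x).
Qed.

Lemma cone_ext X F (g g' : pcmap (cone F) X) :
  (forall q y, g q (0, y) = g' q (0, y)) -> forall q z, g q z = g' q z.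
Proof.
move=> H; apply: cone_gen => // [q x e|q x y ex ey]; first by rewrite !pc_comm e.
by rewrite !linearD ex ey.
Qed.

Definition stalk M : pcomplex R N :=
  @PComplex R N (fun=> M) (fun=> lin_zero M M) (fun _ _ => erefl).

Section Stalk.
Variable M : lmodType R.
Let K := cone (fun=> M).
Fact stalk_in_linear q : linear (fun m : M => (m, 0) : K q).
Proof. by move=> a x y; congr (_, _) => /=; rewrite scaler0 addr0. Qed.
Definition stalk_in : pcmap (stalk M) K :=
  @PCMap R N (stalk M) K (fun q => mklin (stalk_in_linear q)) (fun _ _ => erefl).
Definition stalk_out : pcmap K (stalk M) :=
  @PCMap R N K (stalk M) (fun q => mklin (@snd_linear _ M M)) (fun _ _ => erefl).

(** Ext against a cone is computed degreewise, so this sequence turns Ext against a stalk into a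
    lifting or extension problem for maps. *)
Lemma stalk_sex : sexC stalk_in stalk_out.
Proof.
apply/sexC_deg => q; apply/sexMP; split=> [x [] //|[x y]|y]; last by exists (0, y).
split=> [/= y0|[m [_ <-]] //]; exists x; congr (_, _); exact/esym.
Qed.
End Stalk.

Lemma sexC_cone U V W (f : {linear U -> V}) (g : {linear V -> W}) : sexM f g ->
  exists (F : pcmap (cone (fun=> U)) (cone (fun=> V)))
         (G : pcmap (cone (fun=> V)) (cone (fun=> W))),
  [/\ sexC F G, forall q z, F q z = (f z.1, f z.2) & forall q z, G q z = (g z.1, g z.2)].
Proof.
have coneM U' V' (h : {linear U' -> V'}) : exists H : pcmap (cone (fun=> U')) (cone (fun=> V')),
    forall q z, H q z = (h z.1, h z.2).
  have [H HE] := to_cone (X := cone (fun=> U')) (F := fun=> V')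
    (fun q => lin_comp h (mklin (@fst_linear _ U' U'))).
  by exists H => q z; rewrite HE.
move=> /sexMP[fi ex gs]; have [F FE] := coneM _ _ f; have [G GE] := coneM _ _ g.
exists F, G; split=> //; apply/sexC_deg => q; apply/sexMP; split.
- by move=> [x y]; rewrite FE => -[/= /fi-> /fi->].
- move=> [x y]; rewrite GE; split=> [[/= /ex[u <-] /ex[v <-]]|[[u v]]].
    by exists (u, v); rewrite FE.
  by rewrite FE => -[/= <- <-]; congr (_, _); apply/ex; [exists u|exists v].
- move=> [x y]; have [u <-] := gs x; have [v <-] := gs y.
  by exists (u, v); rewrite GE.
Qed.

Lemma delta_out (F : 'I_N -> lmodType R) q : exists f : forall r, {linear F r -> F q},
  (forall x, f q x = x) /\ forall r x, r <> q -> f r x = 0.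
Proof.
exists (fun r => match r =P q with
  | ReflectT e => ecast i {linear F r -> F i} e (lin_id (F r))
  | ReflectF _ => lin_zero (F r) (F q) end).
split=> [x|r x]; case: eqP => // e; by rewrite (eq_axiomK e).
Qed.

Lemma delta_in (F : 'I_N -> lmodType R) q : exists f : forall r, {linear F q -> F r},
  (forall x, f q x = x) /\ forall r x, r <> q -> f r x = 0.
Proof.
exists (fun r => match q =P r with
  | ReflectT e => ecast i {linear F q -> F i} e (lin_id (F q))
  | ReflectF _ => lin_zero (F q) (F r) end).
split=> [x|r x rq]; case: eqP => // e; by [rewrite (eq_axiomK e)|case: rq].
Qed.

(** The adjunction of [to_cone]: degreewise retractions, with no compatibility between them,
    assemble to a chain map into the cone. *)
Lemma Ext_to_cone X F : (forall q, ExtM (X q) (F q)) -> ExtC X (cone F).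
Proof.
move=> ext0; apply/ExtC_retraction => E f g fg.
have /dep_choice[e eE] : forall q, exists e : {linear E q -> F q}, forall z, e (f q z) = z.1.
  move=> q; have /(_ q) fgq := (sexC_deg _ _).1 fg.
  exact: (ExtM_extend (mklin (@fst_linear _ (F q) (F (p q)))) fgq (ext0 q)).
have [r rE] := to_cone e; exists r => q [x y].
by rewrite rE -pc_comm !eE.
Qed.

Lemma Ext_from_cone X F : (forall q, ExtM (F (p q)) (X q)) -> ExtC (cone F) X.
Proof.
move=> ext0; apply/ExtC_split => E f g fg.
have in2 q : linear (fun y : F (p q) => (0, y) : cone F q).
  by move=> a x y; congr (_, _); rewrite /= scaler0 addr0.
have /dep_choice[e eE] : forall q, exists e : {linear F (p q) -> E q},
    forall y, g q (e y) = (0, y).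
  move=> q; have /(_ q) fgq := (sexC_deg _ _).1 fg.
  exact: (ExtM_lift (mklin (in2 q)) fgq (ext0 q)).
have [s sE] := from_cone e; exists s.
apply: (cone_ext (g := pc_comp g s) (g' := pc_id (cone F))) => q y.
by rewrite /= (sE q).1 eE.
Qed.

Lemma Ext_cone_comp X B : ExtC X (cone (fun=> B)) -> forall q, ExtM (X q) B.
Proof.
move=> ext0 q; apply/ExtM_split => E f g fg.
have [F [G [FG _ GE]]] := sexC_cone fg.
have [e [eq _]] := delta_out X q; have [D DE] := to_cone e.
have [l lE] := ExtC_lift D FG ext0.
exists (lin_comp (mklin (@fst_linear _ E E)) (l q)) => x /=.
by have := lE q x; rewrite GE DE => -[]; rewrite eq.
Qed.

Lemma Ext_comp_cone Y A : ExtC (cone (fun=> A)) Y -> forall q, ExtM A (Y q).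
Proof.
move=> ext0 q; apply/ExtM_split => E f g fg.
have [F [G [FG FE _]]] := sexC_cone fg.
have [e [eq _]] := delta_in Y q; have [D DE] := from_cone (F := fun=> Y q) e.
have [l lE] := ExtC_extend D FG ext0.
have in2 : linear (fun y : E => (0, y) : (E * E)%type).
  by move=> a x y; congr (_, _); rewrite /= scaler0 addr0.
pose r := lin_comp (l q) (mklin in2).
suff rf : @compm (modCat R) _ _ _ r f = idm (Y q : modCat R).
  have [s sE] := @retraction_section _ (modConc R) _ _ _ f g r fg rf.
  by exists s => x; have /(congr1 (fun h : {linear A -> A} => h x)) := sE.
apply: linear_ext => x /=; rewrite /mklin_fun.
by rewrite -[in LHS](linear0 f) -(FE q (0, x)) lE (DE q).1 eq.
Qed.

(** ** Cycles *)

(** Exactness is stated at [p q] to avoid the transported differential [pc_din]; [pc_H0P] connects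
    it with the homology modules. *)
Definition exactc X : Prop :=
  forall q (x : X (p q)), d X x = 0 -> exists y : X q, d X y = x.

Definition Zc X q : lmodType R := Ker (pc_d X q).

Fact zin_linear X q : linear (fun z : Zc X q => submod_val z).
Proof. by []. Qed.
Definition zin X q : {linear Zc X q -> X q} := mklin (@zin_linear X q).

Lemma zinP X q (z : Zc X q) : d X (zin X q z) = 0.
Proof. by apply/eqP; have := submod_in z. Qed.

Lemma zin_inj X q : injective (zin X q).
Proof. by move=> x y e; apply: val_inj. Qed.

Lemma zin_ex X q (x : X q) : d X x = 0 -> exists z, zin X q z = x.
Proof.
move=> dx; have xP : x \in ker_pred (pc_d X q) by rewrite unfold_in dx.
by exists (Submod xP).
Qed.

Lemma zd_ex X q : exists f : {linear X q -> Zc X (p q)}, forall x, zin X (p q) (f x) = d X x.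
Proof.
apply: (fac_injM (h := pc_d X q)) => x; first by move=> ?; apply: zin_inj; rewrite linear0.
by apply: zin_ex; apply: pc_dd.
Qed.
Definition zd X q := sval (cid (zd_ex X q)).
Lemma zdE X q (x : X q) : zin X (p q) (zd X q x) = d X x.
Proof. exact: (svalP (cid (zd_ex X q))). Qed.

Lemma zin_eq0 X q z : zin X q z = 0 -> z = 0.
Proof. by move=> e; apply: zin_inj; rewrite linear0. Qed.

Lemma sexZ X q : exactc X -> sexM (zin X q) (zd X q).
Proof.
move=> eX; apply/sexMP; split=> [z|x|z]; first exact: zin_eq0.
  split=> [e|[z <-]]; first by apply: zin_ex; rewrite -zdE e linear0.
  by apply: zin_inj; rewrite zdE linear0 zinP.
have [y yE] := eX q _ (zinP z); exists y; apply: zin_inj; by rewrite zdE.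
Qed.

Lemma Ext_ZX X B : exactc X -> (forall q, ExtM (Zc X q) B) -> forall q, ExtM (X q) B.
Proof. by move=> eX ext0 q; apply: (Ext0_extl (sexZ q eX)); apply: ext0. Qed.

Lemma Ext_XZ X A : exactc X -> (forall q, ExtM A (Zc X q)) -> forall q, ExtM A (X q).
Proof. by move=> eX ext0 q; apply: (Ext0_extr (sexZ q eX)); apply: ext0. Qed.

Lemma exact_ker X : exactc X -> forall q B (f : {linear X q -> B}),
  (forall z, f (zin X q z) = 0) -> exists g : {linear Zc X (p q) -> B}, forall x, g (zd X q x) = f x.
Proof.
move=> eX q B f f0; have /sexMP[_ ex zs] := sexZ q eX.
by apply: fac_surjM => // x /ex[z <-].
Qed.

(** A map [h] to the stalk kills boundaries, hence cycles, so it factors through [zd]. The factor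
    extends from the cycles to some [k] with [k d = h], and [(k, k d)] lifts [h] to the cone. *)
Lemma Ext_stalk_r X B : exactc X -> (forall q, ExtM (Zc X q) B) -> ExtC X (stalk B).
Proof.
move=> eX ext0; apply: (ExtC_shiftr (stalk_sex B)).
  by apply: Ext_to_cone => q; apply: Ext_ZX.
move=> h; have h0 : forall q (x : X q), d X x = 0 -> h q x = 0.
  by apply: pred_all => q x /eX[y <-]; rewrite pc_comm.
have /dep_choice[k kE] : forall q, exists k : {linear X (p q) -> B}, forall x, k (d X x) = h q x.
  move=> q; have [z|g gE] := exact_ker eX (f := h q); first by apply: h0; apply: zinP.
  have [k kE] := ExtM_extend g (sexZ _ eX) (ext0 _).
  by exists k => x; rewrite -gE -kE zdE.
have [k' k'E] := pred_fam (T := fun q => {linear X q -> B}) k.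
have [F FE] := to_cone k'; exists F => q x.
by rewrite FE /= /mklin_fun /= k'E kE.
Qed.

(** Placed in degree [p q] and zero elsewhere, [f] is a chain map to the stalk. The first coordinate
    of its lift to the cone is [h]. *)
Lemma stalk_r_fac X B : ExtC X (stalk B) -> forall q (f : {linear X (p q) -> B}),
  (forall x, f (d X x) = 0) -> exists h : {linear X (p (p q)) -> B}, forall x, f x = h (d X x).
Proof.
move=> ext0 q f f0; have [e [eq e0]] := delta_out X (p q).
have hc r (x : X r) : lin_comp f (e (p r)) (d X x) = pc_d (stalk B) r (lin_comp f (e r) x).
  rewrite /=; case: (r =P q) => [rq|nrq]; first by subst r; rewrite eq f0.
  by rewrite e0 ?linear0 // => /(can_inj (@ord_predK N)).
pose phi := @PCMap R N X (stalk B) (fun r => lin_comp f (e r)) hc.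
have [F FE] := ExtC_lift phi (stalk_sex B) ext0.
exists (lin_comp (mklin (@fst_linear _ B B)) (F (p (p q)))) => x.
by rewrite /= /mklin_fun -to_coneE -[LHS]/(f x) -[in LHS](eq x) -[LHS]/(phi _ x) -FE.
Qed.

Lemma stalk_r_exact X :
  (forall M, exists (E : lmodType R) (f : {linear M -> E}),
     (forall x, f x = 0 -> x = 0) /\ ExtC X (stalk E)) -> exactc X.
Proof.
move=> emb q x dx; have [M [g [gs gE]]] := quo_exM (im_lin_closed (pc_d X q)).
have [E [f [fi ext0]]] := emb M; apply/gE/fi.
have [y|h hE] := stalk_r_fac ext0 (f := lin_comp f g).
  by rewrite /= (_ : g _ = 0) ?linear0 //; apply/gE; exists y.
by have /= -> := hE x; rewrite dx linear0.
Qed.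

Lemma stalk_r_X X B : ExtC X (stalk B) -> forall q, ExtM (X q) B.
Proof. by move=> ext0 q; apply: Ext_cone_comp; apply: (Ext0_extr (stalk_sex B)). Qed.

Lemma stalk_r_Z X B : exactc X -> ExtC X (stalk B) -> forall q, ExtM (Zc X q) B.
Proof.
move=> eX ext0; pose P q := ExtM (Zc X q) B.
(* A test map on the cycles in degree [p (p q)] is pulled back to [X (p q)], where it kills the
   image of [X q]; the Ext group that it controls belongs to the cycles one degree further down. *)
suff H q : P (p (p (p q))).
  by apply: (@pred_all N P); apply: (@pred_all N (P \o p)); apply: (@pred_all N (P \o p \o p)).
apply: (@Ext0_shiftl _ (modConc R) _ _ _ _ _ _ (sexZ (p (p q)) eX)).
  exact: stalk_r_X.
move=> h; have [x|g gE] := stalk_r_fac ext0 (f := lin_comp h (zd X (p q))).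
  by rewrite /= (_ : zd X (p q) _ = 0) ?linear0 //; apply: zin_inj; rewrite zdE pc_dd linear0.
exists g; apply: linear_ext => z /=; have /sexMP[_ _ zs] := sexZ (p q) eX.
by have [x <-] := zs z; rewrite zdE -gE.
Qed.

(** A map from the stalk takes values in cycles and, by exactness and the vanishing of Ext, lifts
    through [d]. The lift [k] defines a map on the cone whose restriction to first coordinates is
    [d k]. *)
Lemma Ext_stalk_l Y M : exactc Y -> (forall q, ExtM M (Zc Y q)) -> ExtC (stalk M) Y.
Proof.
move=> eY ext0; apply: (ExtC_shiftl (stalk_sex M)).
  by apply: Ext_from_cone => q; apply: Ext_XZ.
move=> h; have /dep_choice[k kE] : forall q, exists k : {linear M -> Y q},
    forall m, d Y (k m) = h (p q) m.
  move=> q; have [|x|g gE] := fac_injM (m := zin Y (p q)) (h := h (p q)).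
  - exact: zin_eq0.
  - by apply: zin_ex; rewrite -pc_comm /= linear0.
  have [k kE] := ExtM_lift g (sexZ q eY) (ext0 q).
  by exists k => m; rewrite -zdE kE gE.
have [G GE] := from_cone (F := fun=> M) k; exists G; apply: pred_all => q m.
by rewrite (GE q).2 kE.
Qed.

Lemma stalk_l_fac Y M : ExtC (stalk M) Y -> forall q (f : {linear M -> Y (p q)}),
  (forall m, d Y (f m) = 0) -> exists g : {linear M -> Y q}, forall m, d Y (g m) = f m.
Proof.
move=> ext0 q f f0; have [e [eq e0]] := delta_in Y (p q).
have hc r (x : stalk M r) : lin_comp (e (p r)) f (pc_d (stalk M) r x) = d Y (lin_comp (e r) f x).
  rewrite /= !linear0; case: (r =P p q) => [rq|nrq]; first by subst r; rewrite eq f0.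
  by rewrite (e0 r) ?linear0.
pose phi := @PCMap R N (stalk M) Y (fun r => lin_comp (e r) f) hc.
have [G GE] := ExtC_extend phi (stalk_sex M) ext0.
have in2 : linear (fun y : M => (0, y) : (M * M)%type).
  by move=> a x y; congr (_, _); rewrite /= scaler0 addr0.
exists (lin_comp (G q) (mklin in2)) => m.
have := GE (p q) m; rewrite /= eq => <-.
exact: (esym (@pc_comm _ _ _ _ G q (0, m))).
Qed.

(** Maps from [R] are elements, so [stalk_l_fac] for [R] says that every cycle is a boundary. *)
Lemma stalk_l_exact Y : ExtC (stalk (R^o : lmodType R)) Y -> exactc Y.
Proof.
move=> ext0 q x dx.
have fl : linear (fun a : R^o => (a : R) *: x : Y (p q)).
  by move=> a u v; rewrite scalerDl scalerA.
have [m|g gE] := stalk_l_fac ext0 (f := mklin fl).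
  by rewrite linearZ /= dx scaler0.
by exists (g 1); rewrite gE /= /mklin_fun scale1r.
Qed.

Lemma stalk_l_X Y M : ExtC (stalk M) Y -> forall q, ExtM M (Y q).
Proof. by move=> ext0 q; apply: Ext_comp_cone; apply: (Ext0_extl (stalk_sex M)). Qed.

Lemma stalk_l_Z Y M : exactc Y -> ExtC (stalk M) Y -> forall q, ExtM M (Zc Y q).
Proof.
move=> eY ext0 q; apply: (@Ext0_shiftr _ (modConc R) _ _ _ _ _ _ (sexZ q eY)) => [|h]; first exact: stalk_l_X.
have [m|g gE] := stalk_l_fac ext0 (f := lin_comp (zin Y (p q)) h); first exact: zinP.
by exists g; apply: linear_ext => m; apply: zin_inj; rewrite /= zdE gE.
Qed.

End ComplexExt.

(** * Enough injective modules *)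

(** [Zorn_bigcup] includes the empty chain. Its union, the empty predicate, is adjoined to [good]; a
    maximal element is not empty because good predicates are inhabited. *)
Lemma zorn_pred (X : Type) (good : (X -> Prop) -> Prop) :
  (exists G, good G) -> (forall G, good G -> exists x, G x) ->
  (forall C : (X -> Prop) -> Prop, (exists G, C G) -> (forall G, C G -> good G) ->
    (forall G H, C G -> C H -> (forall x, G x -> H x) \/ (forall x, H x -> G x)) ->
    good (fun x => exists2 G, C G & G x)) ->
  exists M, good M /\ forall G, good G -> (forall x, M x -> G x) -> forall x, G x -> M x.
Proof.
move=> [G0 gG0] ne chain.
have [F FP tF|M [MP Mmax]] := @classical_sets.Zorn_bigcup X
    (fun G => good G \/ forall x, ~ G x).
  have [[G [FG [x Gx]]]|none] := pselect (exists G, F G /\ exists x, G x); last first.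
    by right=> x [G FG Gx]; apply: none; exists G; split=> //; exists x.
  left; have gF H : F H -> (exists x, H x) -> good H.
    by move=> /FP[//|H0] [y /H0].
  have -> : (\bigcup_(H in F) H)%classic =
      (fun x => exists2 H, (F H /\ exists x, H x) & H x) :> (X -> Prop).
    apply: funext => y; apply: propext; split=> [[H FH Hy]|[H [FH _] Hy]].
      by exists H => //; split=> //; exists y.
    by exists H.
  apply: chain => [|H [FH neH]|H K [FH _] [FK _]].
  - by exists G; split=> //; exists x.
  - exact: gF.
  - exact: tF.
have gM : good M.
  case: MP => // M0; exfalso; have [x G0x] := ne _ gG0.
  apply: (Mmax G0); last by left.
  by split=> [y /M0//|]; apply/existsNP; exists x => /(_ G0x)/M0.
exists M; split=> // G gG MG x Gx; apply: contrapT => Mx.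
apply: (Mmax G); last by left.
by split=> // GM; apply: Mx; apply: GM.
Qed.

Definition enough_injectives (R : pzRingType) : Prop :=
  forall V : lmodType R, exists (E : lmodType R) (f : {linear V -> E}),
    (forall x, f x = 0 -> x = 0) /\ forall U, ExtM U E.

Section Coinduced.
Variables (k : fieldType) (R : pzRingType) (eta : {rmorphism k -> R}).
Implicit Types (U V W M : lmodType R).

Definition klinear V W (f : V -> W) : Prop :=
  forall c x y, f (eta c *: x + y) = eta c *: f x + f y.

(** Extension of a k-linear map from a subspace, by Zorn's lemma on graphs that are closed under
    linear combinations and single-valued. *)
Lemma klinear_extend W V (G0 : W -> V -> Prop) :
  G0 0 0 ->
  (forall c x y a b, G0 x a -> G0 y b -> G0 (eta c *: x + y) (eta c *: a + b)) ->
  (forall a, G0 0 a -> a = 0) ->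
  exists f : W -> V, klinear f /\ forall x a, G0 x a -> f x = a.
Proof.
move=> G00 G0D G0f.
pose good (G : W * V -> Prop) := [/\ forall x a, G0 x a -> G (x, a),
  forall c x y a b, G (x, a) -> G (y, b) -> G (eta c *: x + y, eta c *: a + b) &
  forall a, G (0, a) -> a = 0].
have [||C [G CG] Cg Cc|M [[M0 MD Mf] Mmax]] := @zorn_pred (W * V)%type good.
- by exists (fun z => G0 z.1 z.2); split.
- by move=> G [G1 _ _]; exists (0, 0); apply: G1.
- have [G1 _ _] := Cg _ CG; split=> [x a xa|c x y a b [H CH Hx] [K CK Ky]|a [H CH]].
  + by exists G => //; apply: G1.
  + have [HK|KH] := Cc _ _ CH CK.
      by exists K => //; have [_ + _] := Cg _ CK; apply=> //; apply: HK.
    by exists H => //; have [_ + _] := Cg _ CH; apply=> //; apply: KH.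
  + by have [_ _] := Cg _ CH; apply.
have M00 : M (0, 0) by apply: M0.
have MN x a : M (x, a) -> forall c, M (eta c *: x, eta c *: a).
  by move=> xa c; rewrite -[eta c *: x]addr0 -[eta c *: a]addr0; apply: MD.
have MDD x y a b : M (x, a) -> M (y, b) -> M (x + y, a + b).
  by move=> xa yb; have := MD 1 _ _ _ _ xa yb; rewrite rmorph1 !scale1r.
have Mtot x : exists a, M (x, a).
  apply: contrapT => nx.
  (* [x] is independent of the domain of [M]; this is where scalars are inverted. *)
  have key c y a : M (y, a) -> eta c *: x + y = 0 -> c = 0.
    move=> ya e; apply: contrapT => /eqP c0; apply: nx; exists (eta (- c^-1) *: a).
    have -> : x = eta (- c^-1) *: y; last exact: MN.
    have -> : y = - (eta c *: x) by apply/eqP; rewrite -addr_eq0 addrC e.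
    by rewrite scalerN scalerA -rmorphM mulNr mulVf // rmorphN rmorph1 scaleN1r opprK.
  (* The enlarged graph sends [x] to 0. *)
  pose G z := exists c y a, M (y, a) /\ z = (eta c *: x + y, a : V).
  have GP : good G.
    split=> [y a ya|c y z a b [c1 [y1 [a1 [m1 [-> ->]]]]] [c2 [y2 [a2 [m2 [-> ->]]]]]|a].
    - by exists 0, y, a; rewrite rmorph0 scale0r add0r; split=> //; apply: M0.
    - exists (c * c1 + c2), (eta c *: y1 + y2), (eta c *: a1 + a2); split; first exact: MD.
      congr (_, _); rewrite scalerDr scalerA -rmorphM addrACA -scalerDl.
      by rewrite -rmorphD.
    - move=> [c [y [b [yb [e ->]]]]]; apply: Mf; have c0 := key _ _ _ yb (esym e).
      by move: e yb; rewrite c0 rmorph0 scale0r add0r => <-.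
  apply: nx; exists 0; apply: (Mmax _ GP).
    move=> [y a] ya; exists 0, y, a; by rewrite rmorph0 scale0r add0r.
  by exists 1, 0, 0; rewrite rmorph1 scale1r addr0.
have [f fM] := choice Mtot.
have Mu x a b : M (x, a) -> M (x, b) -> a = b.
  move=> xa xb; apply/eqP; rewrite -subr_eq0; apply/eqP/Mf.
  rewrite -(subrr x) -[- x]scaleN1r -[- b]scaleN1r.
  have -> : -1 = eta (-1) by rewrite rmorphN rmorph1.
  by apply: MDD => //; apply: MN.
exists f; split=> [c x y|x a xa]; last by apply: (Mu x) => //; apply: M0.
by apply: (Mu (eta c *: x + y)) => //; apply: MD.
Qed.

Section Module.
Variable V : lmodType R.

Definition coind_lin (f : R -> V) : Prop :=
  forall c r s, f (eta c * r + s) = eta c *: f r + f s.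

(* Hom_k(R, V), with a . f = f (_ * a) *)
Record coind := Coind { coind_fun :> R -> V; coindP : coind_lin coind_fun }.
Lemma coind_ext (f g : coind) : coind_fun f =1 coind_fun g -> f = g.
Proof.
case: f g => [f fP] [g gP] /= /funext e; subst g; congr Coind; exact: Prop_irrelevance.
Qed.
HB.instance Definition _ := gen_eqMixin coind.
HB.instance Definition _ := gen_choiceMixin coind.
Fact coind_addP (f g : coind) : coind_lin (fun r => f r + g r).
Proof. by move=> c r s; rewrite !coindP scalerDr addrACA. Qed.
Fact coind_oppP (f : coind) : coind_lin (fun r => - f r).
Proof. by move=> c r s; rewrite !coindP scalerN opprD. Qed.
Fact coind_0P : coind_lin (fun r => 0).
Proof. by move=> c r s; rewrite scaler0 addr0. Qed.
Fact coind_scaleP a (f : coind) : coind_lin (fun r => f (r * a)).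
Proof. by move=> c r s; rewrite mulrDl -mulrA coindP. Qed.
Fact coind_addA : associative (fun f g => Coind (coind_addP f g)).
Proof. by move=> f g h; apply: coind_ext => r; apply: addrA. Qed.
Fact coind_addC : commutative (fun f g => Coind (coind_addP f g)).
Proof. by move=> f g; apply: coind_ext => r; apply: addrC. Qed.
Fact coind_add0 : left_id (Coind coind_0P) (fun f g => Coind (coind_addP f g)).
Proof. by move=> f; apply: coind_ext => r; apply: add0r. Qed.
Fact coind_addN : left_inverse (Coind coind_0P) (fun f => Coind (coind_oppP f))
  (fun f g => Coind (coind_addP f g)).
Proof. by move=> f; apply: coind_ext => r; apply: addNr. Qed.
HB.instance Definition _ := GRing.isZmodule.Build coind
  coind_addA coind_addC coind_add0 coind_addN.
Definition coind_scale a f := Coind (coind_scaleP a f).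
Fact coind_scaleA a b f : coind_scale a (coind_scale b f) = coind_scale (a * b) f.
Proof. by apply: coind_ext => r /=; rewrite mulrA. Qed.
Fact coind_scale1 : left_id 1 coind_scale.
Proof. by move=> f; apply: coind_ext => r /=; rewrite mulr1. Qed.
Fact coind_funD (f : coind) r s : f (r + s) = f r + f s.
Proof. by rewrite -[r]mul1r -(rmorph1 eta) coindP rmorph1 scale1r mul1r. Qed.
Fact coind_scaleDr : right_distributive coind_scale +%R.
Proof. by move=> a f g; apply: coind_ext. Qed.
Fact coind_scaleDl f : {morph coind_scale^~ f : a b / a + b}.
Proof. by move=> a b; apply: coind_ext => r /=; rewrite mulrDr coind_funD. Qed.
HB.instance Definition _ := GRing.Zmodule_isLmodule.Build R coind
  coind_scaleA coind_scale1 coind_scaleDr coind_scaleDl.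

Lemma coind_eta (f : coind) c : f (eta c) = eta c *: f 1.
Proof.
have f0 : f 0 = 0 by have /eqP := coind_funD f 0 0; rewrite addr0 eq_sym -subr_eq0 addrK => /eqP.
by have := coindP f c 1 0; rewrite mulr1 f0 !addr0.
Qed.

Lemma to_coind W (f : W -> V) : klinear f ->
  exists g : {linear W -> coind}, forall v r, g v r = f (r *: v).
Proof.
move=> fP; have gP v : coind_lin (fun r => f (r *: v)).
  by move=> c r s; rewrite scalerDl -scalerA fP.
have gl : linear (fun v => Coind (gP v)).
  move=> a u v; apply: coind_ext => r /=; rewrite scalerDr scalerA.
  by have := fP 1 ((r * a) *: u) (r *: v); rewrite rmorph1 !scale1r.
by exists (mklin gl).
Qed.

(** Coinduction is right adjoint to restriction of scalars to k. Evaluation at 1, defined on the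
    image of [e], extends k-linearly to [W], and its transpose is a retraction of [e]. *)
Lemma ExtM_coind U : ExtM U (coind : lmodType R).
Proof.
apply/ExtM_split => W e g eg; have /sexMP[ei _ _] := eg.
pose G (w : W) (a : V) := exists f : coind, e f = w /\ f 1 = a.
have [||_ [f [e0 <-]]|f [fP fG]] := @klinear_extend W V G.
- by exists 0; rewrite linear0.
- move=> c _ _ _ _ [f [<- <-]] [f' [<- <-]]; exists (eta c *: f + f').
  by rewrite linearP; split=> //=; rewrite mul1r coind_eta.
- by rewrite (ei _ e0).
have [r rE] := to_coind fP.
suff re : @compm (modCat R) _ _ _ r e = idm (coind : modCat R).
  have [s sE] := @retraction_section _ (modConc R) _ _ _ e g r eg re.
  by exists s => x; have /(congr1 (fun h : {linear U -> U} => h x)) := sE.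
apply: linear_ext => h /=; apply: coind_ext => a; rewrite rE; apply: fG.
by exists (a *: h); rewrite linearZ; split=> //=; rewrite mul1r.
Qed.

End Module.

Lemma enough_injM : enough_injectives R.
Proof.
move=> V; have [f fE] := @to_coind V V id (fun _ _ _ => erefl).
exists (coind V), f; split=> [x fx0|U]; last exact: ExtM_coind.
by rewrite -[x]scale1r -fE fx0.
Qed.

End Coinduced.


(** * The induced cotorsion pairs *)

Section Induced.
Variables (R : pzRingType) (N : nat).
Local Notation p := (@ord_pred N).
Local Notation d X := (pc_d X _).
Implicit Types X Y Z F P C : pcomplex R N.
Implicit Types U V W M : lmodType R.
Implicit Types A B : modCat R -> Prop.

Lemma pc_dinP X q (x : X (p q)) :
  (exists y, pc_din X (p q) y = x) <-> exists y, pc_d X q y = x.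
Proof.
rewrite /pc_din; move: (ordSK (p q)); move: (ord_predK q).
move: (ordS (p q)) => r rq; subst r => e; by rewrite (eq_axiomK e).
Qed.

Lemma homology0P U V W (f : {linear U -> V}) (g : {linear V -> W}) :
  zero_module (homology f g) <-> forall x, g x = 0 -> exists y, f y = x.
Proof.
split=> [H x gx|H z].
  have xP : x \in ker_pred g by rewrite unfold_in gx.
  have := H (quotmod_pi (bound_pred f (g := g)) (Submod xP)).
  rewrite -(linear0 (@quotmod_pi _ _ (bound_pred f (g := g)))) => /eqP.
  by rewrite quotmod_pi_eq subr0 => /asboolP.
have [v <-] := quotmod_piP z.
rewrite -(linear0 (@quotmod_pi _ _ (bound_pred f (g := g)))); apply/eqP.
rewrite quotmod_pi_eq subr0; apply/asboolP; apply: H.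
by apply/eqP; have := submod_in v.
Qed.

Lemma pc_H0P X : (forall q, zero_module (pc_H X q)) <-> exactc X.
Proof.
split=> [H q x dx|H].
  by apply/pc_dinP; have /homology0P := H (p q); apply.
by apply: (@pred_all N (fun q => zero_module (pc_H X q))) => q;
  apply/homology0P => x /H/pc_dinP.
Qed.

Lemma PsiP B X : Psi B X <-> exactc X /\ forall q, B (Zc X q).
Proof.
split=> [H|[eX BX] q].
  by split=> [|q]; [apply/pc_H0P => q|]; case: (H q).
by split; [apply: BX|move: q; apply/pc_H0P].
Qed.

Lemma coker_iso X q : exactc X ->
  exists f : {linear Coker (pc_d X q) -> Zc X (p (p q))},
    (forall x, f x = 0 -> x = 0) /\ forall y, exists x, f x = y.
Proof.
move=> eX; have /sexMP[_ ex zs] := sexZ (p q) eX.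
pose c : {linear X (p q) -> Coker (pc_d X q)} := @quotmod_pi _ _ (im_pred (pc_d X q)).
have cs y : exists x, c x = y by apply: quotmod_piP.
have c0 x : c x = 0 <-> exists y, d X y = x.
  rewrite -(linear0 c); split=> [/eqP|H].
    by rewrite quotmod_pi_eq subr0 => /asboolP.
  by apply/eqP; rewrite quotmod_pi_eq subr0; apply/asboolP.
have [|x /c0[y <-]|f fE] := @fac_surjM _ _ _ _ c (zd X (p q)) => //.
  by apply: zin_inj; rewrite zdE pc_dd linear0.
exists f; split=> [y|y].
  have [x <-] := cs y; rewrite fE => /ex[z zx]; apply/c0; apply: eX.
  by rewrite -zx zinP.
by have [x <-] := zs y; exists (c x).
Qed.

(** In an exact complex the cokernel of [d] on [X q] is isomorphic to the cycles in degree
    [p (p q)]; over all [q] these are all cycle modules. *)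
Lemma PhiP A X : iso_closed A -> Phi A X <-> exactc X /\ forall q, A (Zc X q).
Proof.
move=> Aiso; split=> [H|[eX AX] q].
  have eX : exactc X by apply/pc_H0P => q; case: (H q).
  split=> //; apply: (@pred_all N (fun q => A (Zc X q))) => q'.
  move: q'; apply: (@pred_all N (fun q => A (Zc X (p q)))) => q.
  by have [f [f1 f2]] := coker_iso q eX; apply/(Aiso _ _ f f1 f2); case: (H q).
split; last by move: q; apply/pc_H0P.
by have [f [f1 f2]] := coker_iso q eX; apply/(Aiso _ _ f f1 f2).
Qed.

(** ** Exact sequences of complexes *)

Section ExactSeq.
Variables (X Y Z : pcomplex R N) (f : pcmap X Y) (g : pcmap Y Z).
Hypothesis fg : sexC f g.
Let fi q x : f q x = 0 -> x = 0. Proof. by case: fg => + _ _; apply. Qed.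
Let ex q y : g q y = 0 <-> exists x, f q x = y. Proof. by case: fg => _ + _; apply. Qed.
Let gs q z : exists y, g q y = z. Proof. by case: fg => _ _; apply. Qed.
Let gf q x : g q (f q x) = 0. Proof. by apply/ex; exists x. Qed.

Lemma exactc_coker : exactc X -> exactc Y -> exactc Z.
Proof.
move=> eX eY q z dz; have [y yz] := gs z.
have /ex[x xy] : g _ (d Y y) = 0 by rewrite pc_comm yz.
have [|x' x'E] := eX (p q) x.
  by apply: fi; rewrite pc_comm xy pc_dd.
have [|y' y'E] := eY q (y - f _ x').
  by rewrite linearB -pc_comm x'E xy subrr.
by exists (g _ y'); rewrite -pc_comm y'E linearB gf subr0 yz.
Qed.

Lemma exactc_ker : exactc Y -> exactc Z -> exactc X.
Proof.
move=> eY eZ; apply: (@pred_all N (fun q => forall x : X (p q), d X x = 0 ->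
  exists y : X q, d X y = x)) => q x dx.
have [|y yE] := eY (p q) (f _ x); first by rewrite -pc_comm dx linear0.
have [|z zE] := eZ q (g _ y); first by rewrite -pc_comm yE gf.
have [y' y'z] := gs z.
have /ex[x' x'E] : g _ (y - d Y y') = 0 by rewrite linearB pc_comm y'z zE subrr.
exists x'; apply: (inj_linear (@fi _)); rewrite pc_comm x'E linearB pc_dd subr0.
exact: yE.
Qed.

Lemma sex_cycles q : exactc X ->
  exists (f' : {linear Zc X q -> Zc Y q}) (g' : {linear Zc Y q -> Zc Z q}),
    sexM f' g' /\ forall z, zin Y q (f' z) = f q (zin X q z).
Proof.
move=> eX.
have [||f' f'E] := fac_injM (m := zin Y q) (h := lin_comp (f q) (zin X q)).
- exact: zin_eq0.
- by move=> z; apply: zin_ex; rewrite /= -pc_comm zinP linear0.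
have [||g' g'E] := fac_injM (m := zin Z q) (h := lin_comp (g q) (zin Y q)).
- exact: zin_eq0.
- by move=> z; apply: zin_ex; rewrite /= -pc_comm zinP linear0.
exists f', g'; split; last exact: f'E.
apply/sexMP; split=> [x x0|y|z].
- by apply: zin_eq0; apply: fi; rewrite -[LHS]f'E x0 linear0.
- split=> [y0|[x <-]]; last first.
    by apply: zin_inj; rewrite g'E [LHS]/= f'E linear0; apply: gf.
  have /ex[x xE] : g q (zin Y q y) = 0 by rewrite -[LHS]g'E y0 linear0.
  have [|x' x'E] := zin_ex (x := x).
    by apply: fi; rewrite pc_comm xE zinP.
  by exists x'; apply: zin_inj; rewrite f'E /= x'E.
(* A lift of the cycle has its boundary in [X], where exactness provides the correction that makes
   the lift a cycle. *)
- have [y yE] := gs (zin Z q z).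
  have /ex[x xE] : g _ (d Y y) = 0 by rewrite pc_comm yE zinP.
  have [|x' x'E] := eX q x; first by apply: fi; rewrite pc_comm xE pc_dd.
  have [|y' y'E] := zin_ex (x := y - f _ x').
    by rewrite linearB -pc_comm x'E xE subrr.
  by exists y'; apply: zin_inj; rewrite g'E /= y'E linearB gf subr0.
Qed.

End ExactSeq.

(** This inverts the index shift up to isomorphism, as [F (ordS (p q))] and [F q] are not
    convertible; [from_cone] and [unshift] need modules indexed by [p q]. *)
Lemma pred_reindex (F : 'I_N -> lmodType R) : exists (G : 'I_N -> lmodType R)
    (u : forall q, {linear G (p q) -> F q}) (v : forall q, {linear F q -> G (p q)}),
  forall q, (forall x, v q (u q x) = x) /\ forall y, u q (v q y) = y.
Proof.
exists (fun q => F (ordS q)).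
have H q : exists uv : {linear F (ordS (p q)) -> F q} * {linear F q -> F (ordS (p q))},
    (forall x, uv.2 (uv.1 x) = x) /\ forall y, uv.1 (uv.2 y) = y.
  by case: _ / (esym (ord_predK q)); exists (lin_id _, lin_id _).
have [uv uvE] := dep_choice H.
by exists (fun q => (uv q).1), (fun q => (uv q).2).
Qed.

Lemma cone_exact (F : 'I_N -> lmodType R) : exactc (cone F).
Proof. by move=> q [x y] [/= ->]; exists (0, x). Qed.

Lemma cone_cycles (F : 'I_N -> lmodType R) A q : iso_closed A -> A (F q) <-> A (Zc (cone F) q).
Proof.
move=> Aiso.
have il : linear (fun x : F q => (x, 0) : cone F q).
  by move=> a x y; congr (_, _); rewrite /= scaler0 addr0.
have [||f fE] := fac_injM (m := zin (cone F) q) (h := mklin il).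
- exact: zin_eq0.
- by move=> x; apply: zin_ex.
apply: (Aiso _ _ f) => [x x0|y].
  by have := fE x; rewrite x0 linear0 => -[].
have := zinP y; case E: (zin _ _ y) => [x x'] [x'0]; exists x.
by apply: zin_inj; rewrite fE E x'0.
Qed.

(** ** The orthogonality of the two classes *)

(** The sign makes [y - d x] a chain map from the cone to the shift. *)
Definition shift_d X q : {linear X (p q) -> X (p (p q))} := (\- pc_d X (p q))%R.
Fact shift_dd X q x : shift_d X (p q) (shift_d X q x) = 0.
Proof. by rewrite /= linearN pc_dd !oppr0. Qed.
Definition shift X : pcomplex R N := @PComplex R N (fun q => X (p q)) (shift_d X) (@shift_dd X).

Lemma shift_sex X : exists (f : pcmap X (cone X)) (g : pcmap (cone X) (shift X)),
  [/\ sexC f g, forall q x, f q x = (x, d X x) & forall q z, g q z = z.2 - d X z.1].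
Proof.
have [f fE] := to_cone (X := X) (F := X) (fun q => lin_id (X q)).
have gl q : linear (fun z : cone X q => z.2 - d X z.1 : shift X q).
  by move=> a [x x'] [y y'] /=; rewrite linearP scalerBr opprD addrACA.
have gc q (z : cone X q) : mklin (gl (p q)) (d (cone X) z) = d (shift X) (mklin (gl q) z).
  by rewrite /= /mklin_fun /= linearB pc_dd subr0 sub0r.
exists f, (PCMap gc); split=> //; apply/sexC_deg => q; apply/sexMP; split.
- by move=> x; rewrite fE => -[].
- move=> [x y]; split=> [|[u]]; last by rewrite fE => -[<- <-]; rewrite /= /mklin_fun /= subrr.
  by move=> /eqP; rewrite /= /mklin_fun /= subr_eq0 => /eqP ->; exists x; rewrite fE.
- by move=> y; exists (0, y); rewrite /= /mklin_fun /= linear0 subr0.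
Qed.

(** Lifting [a] to the cone amounts to maps [s] from [F q] to [P q] with [s d - d s = a]. The cycle
    sequences of [F] and [P] reduce each step of their construction to Ext between cycle modules. *)
Lemma Ext_Phi_Psi F P : exactc F -> exactc P ->
  (forall q r, ExtM (Zc F q) (Zc P r)) -> ExtC F P.
Proof.
move=> eF eP ext0.
have extX q r : ExtM (Zc F q) (P r) by apply: Ext_XZ.
have extXX q r : ExtM (F q) (P r) by apply: (Ext_ZX eF).
have [f [g [fg fE gE]]] := shift_sex P.
apply: (ExtC_shiftr fg) => [|a]; first by apply: Ext_to_cone.
have aP q x : a (p q) (d F x) = - d P (a q x) by rewrite pc_comm.
(* [al] satisfies the equation on cycles, where the term [s d] is absent. *)
have /dep_choice[al alE] : forall q, exists al : {linear F q -> P q},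
    forall z, d P (al (zin F q z)) = - a q (zin F q z).
  move=> q; have [||b bE] := fac_injM (m := zin P (p q)) (h := lin_comp (\- a q)%R (zin F q)).
  - exact: zin_eq0.
  - move=> z; apply: zin_ex; rewrite /= linearN -[d P _]opprK.
    by have /= <- := aP q (zin F q z); rewrite zinP linear0 !oppr0.
  have [c cE] := ExtM_lift b (sexZ q eP) (ext0 _ _).
  have [al alE] := ExtM_extend c (sexZ q eF) (extX _ _).
  by exists al => z; rewrite alE -zdE cE bE.
(* [ga] gives the values that [s] must take on boundaries if [d s] is to equal [d al]. *)
have /dep_choice[ga gaE] : forall q, exists ga : {linear F (p q) -> P (p q)},
    forall x, ga (d F x) = a q x + d P (al q x).
  move=> q.
  have [z|c cE] := exact_ker eF (f := (a q \+ lin_comp (pc_d P q) (al q))%R).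
    by rewrite /= alE addrN.
  have [ga gaE] := ExtM_extend c (sexZ (p q) eF) (extX _ _).
  by exists ga => x; rewrite -zdE gaE cE.
have [ga' ga'E] := pred_fam (T := fun q => {linear F q -> P q}) ga.
have diff : forall q z, d P (al q (zin F q z) - ga' q (zin F q z)) = 0.
  apply: pred_all => q z; have /sexMP[_ _ zs] := sexZ q eF.
  have [x <-] := zs z; rewrite linearB alE zdE ga'E gaE aP linearD pc_dd addr0.
  by rewrite opprK subrr.
(* On cycles [al] and [ga'] differ by cycles. Subtracting a cycle-valued extension [de] of the
   difference corrects [al] on boundaries and leaves [d al] unchanged. *)
have /dep_choice[de deE] : forall q, exists de : {linear F q -> Zc P q},
    forall z, zin P q (de (zin F q z)) = al q (zin F q z) - ga' q (zin F q z).
  move=> q; have [||c cE] := fac_injM (m := zin P q)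
     (h := lin_comp (al q \- ga' q)%R (zin F q)).
  - exact: zin_eq0.
  - by move=> z; apply: zin_ex; apply: diff.
  have [de deE] := ExtM_extend c (sexZ q eF) (ext0 _ _).
  by exists de => z; rewrite deE cE.
have [h hE] := to_cone (X := F) (F := P) (fun q => (al q \- lin_comp (zin P q) (de q))%R).
exists h => q x; rewrite gE hE /=.
have := deE (p q) (zd F q x); rewrite zdE => ->.
rewrite subKr ga'E gaE linearB zinP subr0.
by rewrite addrK.
Qed.

(** Every complex is a shift up to isomorphism; the sign in [e] cancels the one in [shift_d]. *)
Lemma unshift X : exists Y (t : pcmap (shift Y) X) (t' : pcmap X (shift Y)),
  (forall q x, t' q (t q x) = x) /\ forall q x, t q (t' q x) = x.
Proof.
have [G [u [v uv]]] := pred_reindex X.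
have vu q x : v q (u q x) = x by case: (uv q).
have {}uv q x : u q (v q x) = x by case: (uv q).
pose e q : {linear G (p q) -> G (p (p q))} := lin_comp (v (p q)) (lin_comp (\- pc_d X q)%R (u q)).
have [dG dGE] := pred_fam (T := fun q => {linear G q -> G (p q)}) e.
have dd : forall q x, dG (p q) (dG q x) = 0.
  by apply: pred_all => q x; rewrite !dGE /= uv !linearN /= pc_dd !linear0 ?oppr0 ?linear0.
pose Y := @PComplex R N G dG dd.
have tc q (x : shift Y q) : u (p q) (d (shift Y) x) = d X (u q x).
  by rewrite /= dGE /= linearN uv opprK.
have tc' q (x : X q) : v (p q) (d X x) = d (shift Y) (v q x).
  by rewrite -[LHS](vu (p q)) -[RHS](vu (p q)) uv tc uv.
exists Y, (@PCMap R N (shift Y) X u tc), (@PCMap R N X (shift Y) v tc').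
by split=> q x; [apply: vu|apply: uv].
Qed.

Lemma shift_cycles X q A : iso_closed A -> A (Zc (shift X) q) <-> A (Zc X (p q)).
Proof.
move=> Aiso; have [||f fE] := fac_injM (m := zin X (p q)) (h := zin (shift X) q).
- exact: zin_eq0.
- by move=> x; apply: zin_ex; have /= := zinP x => /eqP; rewrite oppr_eq0 => /eqP.
apply: (Aiso _ _ f) => [x x0|y]; first by apply: zin_eq0; rewrite -fE x0 linear0.
have [|x xE] := @zin_ex _ _ (shift X) q (zin X (p q) y); first by rewrite /= zinP oppr0.
by exists x; apply: zin_inj; rewrite fE xE.
Qed.

Lemma shift_exact X : exactc (shift X) <-> exactc X.
Proof.
split=> eX.
  apply: (@pred_all N (fun q => forall x : X (p q), d X x = 0 ->
    exists y : X q, d X y = x)) => q x dx.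
  have [|y yE] := eX q x; first by rewrite /= dx oppr0.
  by exists (- y); rewrite linearN -yE.
move=> q x /= /eqP; rewrite oppr_eq0 => /eqP /eX[y yE].
by exists (- y); rewrite /= linearN opprK.
Qed.

(* A splitting of 0 -> X -> cone X -> shift X -> 0 is a contraction. *)
Lemma contraction X : ExtC (shift X) X -> exists s : forall q, {linear X (p q) -> X q},
  forall q x, d X x = 0 -> d X (s q x) = x.
Proof.
move=> ext0; have [f [g [fg fE _]]] := shift_sex X.
have [r rE] := (ExtC_retraction _ _).1 ext0 _ _ _ fg.
have in2 q : linear (fun y : X (p q) => (0, y) : cone X q).
  by move=> a x y; congr (_, _); rewrite /= scaler0 addr0.
exists (fun q => lin_comp (r q) (mklin (in2 q))) => q x dx.
rewrite [LHS](esym (@pc_comm _ _ _ _ r q (0, x))) -[RHS](rE (p q)) fE dx //.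
Qed.

End Induced.

(** * The two cotorsion pairs, their heredity and compatibility *)

Section CotorsionPairs.
Variables (R : pzRingType) (N : nat).
Local Notation p := (@ord_pred N).
Local Notation d X := (pc_d X _).
Variables (A B : modCat R -> Prop).
Hypothesis AB_cotorsion : cotorsion_pair A B.
Hypothesis AB_hereditary : hereditary_pair A B.
Hypothesis injR : enough_injectives R.
Implicit Types X Y Z F P C K Q : pcomplex R N.
Implicit Types U V W M : lmodType R.
Local Notation Phi := (@Phi R N A).
Local Notation Psi := (@Psi R N B).

Lemma cot_left M : A M <-> forall V, B V -> ExtM M V.
Proof. by case: AB_cotorsion => H _; apply: H. Qed.

Lemma cot_right V : B V <-> forall M, A M -> ExtM M V.
Proof. by case: AB_cotorsion => _ H; apply: iff_sym; apply: H. Qed.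

Lemma cot_ext U V : A U -> B V -> ExtM U V.
Proof. by move=> AU; apply: ((cot_left U).1 AU). Qed.

Lemma left_iso : iso_closed A.
Proof.
move=> U V f fi fs.
exact: iff_trans (cot_left U) (iff_trans (lperp_iso B fi fs) (iff_sym (cot_left V))).
Qed.

Lemma right_iso : iso_closed B.
Proof.
move=> U V f fi fs.
exact: iff_trans (cot_right U) (iff_trans (rperp_iso A fi fs) (iff_sym (cot_right V))).
Qed.

Lemma left_free : A (R^o : lmodType R).
Proof. by apply/cot_left => V _; apply: ExtM_free. Qed.

Lemma left_ker U V W (f : {linear U -> V}) (g : {linear V -> W}) :
  sexM f g -> A V -> A W -> A U.
Proof.
move=> fg; have [H _] := AB_hereditary; apply: (H U V W f g).
  by case: fg => _ _ /msurj_epic.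
by have [] := (short_exactP (modConc R) _ _).2 fg.
Qed.

Lemma right_coker U V W (f : {linear U -> V}) (g : {linear V -> W}) :
  sexM f g -> B U -> B V -> B W.
Proof.
move=> fg; have [_ H] := AB_hereditary; apply: (H U V W f g).
  by case: fg => /minj_monic.
by have [] := (short_exactP (modConc R) _ _).2 fg.
Qed.

Lemma PhiE X : Phi X <-> forall V, B V -> ExtC X (stalk N V).
Proof.
split=> [/(PhiP _ left_iso)[eX AX] V BV|H].
  by apply: Ext_stalk_r => // q; apply: cot_ext.
apply/(PhiP _ left_iso); have eX : exactc X.
  apply: stalk_r_exact => M; have [E [f [fi injE]]] := injR M; exists E, f; split=> //.
  by apply: H; apply/cot_right.
by split=> // q; apply/cot_left => V BV; apply: stalk_r_Z => //; apply: H.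
Qed.

(** For [S = A] this gives the cotorsion pair; for a generating set it presents Psi as the right
    class of a set of stalks. The ring itself is added to test exactness. *)
Lemma PsiE_gen (S : modCat R -> Prop) : (forall M, S M -> A M) ->
  (forall V, (forall M, S M -> ExtM M V) -> B V) ->
  forall Y, Psi Y <-> forall M, S M \/ M = (R^o : lmodType R) -> ExtC (stalk N M) Y.
Proof.
move=> SA SB Y; split=> [/PsiP[eY BY] M|H].
  move=> SM; apply: Ext_stalk_l => // q; apply: cot_ext => //.
  by case: SM => [/SA//|->]; apply: left_free.
apply/PsiP; have eY : exactc Y by apply: stalk_l_exact; apply: H; right.
by split=> // q; apply: SB => M SM; apply: stalk_l_Z => //; apply: H; left.
Qed.

Lemma Phi_X X q : Phi X -> A (X q).
Proof.
move=> /(PhiP _ left_iso)[eX AX]; apply/cot_left => V BV.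
by apply: Ext_ZX => // r; apply: cot_ext.
Qed.

Lemma Psi_X X q : Psi X -> B (X q).
Proof.
move=> /PsiP[eX BX]; apply/cot_right => M AM.
by apply: Ext_XZ => // r; apply: cot_ext.
Qed.

Lemma cone_Phi (F : 'I_N -> lmodType R) : (forall q, A (F q)) -> Phi (cone F).
Proof.
move=> AF; apply/(PhiP _ left_iso); split=> [|q]; first exact: cone_exact.
by apply: (@cone_cycles _ _ F A q left_iso).1.
Qed.

Lemma cone_Psi (F : 'I_N -> lmodType R) : (forall q, B (F q)) -> Psi (cone F).
Proof.
move=> BF; apply/PsiP; split=> [|q]; first exact: cone_exact.
by apply: (@cone_cycles _ _ F B q right_iso).1.
Qed.

Lemma Phi_Psi_ext F P : Phi F -> Psi P -> ExtC F P.
Proof.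
move=> /(PhiP _ left_iso)[eF AF] /PsiP[eP BP]; apply: Ext_Phi_Psi => // q r.
exact: cot_ext.
Qed.

Lemma rperp_Phi_X X q : rperp Phi X -> B (X q).
Proof.
move=> H; apply/cot_right => M AM; apply: Ext_comp_cone.
by apply: H; apply: cone_Phi.
Qed.

Lemma lperp_Psi_X X q : lperp Psi X -> A (X q).
Proof.
move=> H; apply/cot_left => V BV; apply: Ext_cone_comp.
by apply: H; apply: cone_Psi.
Qed.

Lemma Phi_ker X Y Z (f : pcmap X Y) (g : pcmap Y Z) : sexC f g -> Phi Y -> Phi Z -> Phi X.
Proof.
move=> fg /(PhiP _ left_iso)[eY AY] /(PhiP _ left_iso)[eZ AZ].
have eX := exactc_ker fg eY eZ; apply/(PhiP _ left_iso); split=> // q.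
by have [f' [g' [fg' _]]] := sex_cycles fg q eX; apply: (left_ker fg').
Qed.

Lemma Psi_coker X Y Z (f : pcmap X Y) (g : pcmap Y Z) : sexC f g -> Psi X -> Psi Y -> Psi Z.
Proof.
move=> fg /PsiP[eX BX] /PsiP[eY BY]; have eZ := exactc_coker fg eX eY.
apply/PsiP; split=> // q.
by have [f' [g' [fg' _]]] := sex_cycles fg q eX; apply: (right_coker fg').
Qed.

(** By [PhiE] the class is already a left orthogonal, that of the stalks on [B], hence equal to its
    double orthogonal. *)
Lemma Phi_cotorsion : cotorsion_pair Phi (rperp Phi).
Proof.
split=> // X; split=> [PX Y|H]; first by apply.
by apply/PhiE => V BV; apply: H => C /PhiE; apply.
Qed.

Lemma PsiE Y : Psi Y <-> forall M, A M \/ M = (R^o : lmodType R) -> ExtC (stalk N M) Y.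
Proof. by apply: PsiE_gen => // V H; apply/cot_right. Qed.

Lemma Psi_cotorsion : cotorsion_pair (lperp Psi) Psi.
Proof.
split=> // X; split=> [H|PX Y]; last exact.
by apply/PsiE => M AM; apply: H => Y /PsiE; apply.
Qed.

Lemma sexC_epi X Y Z (f : pcmap X Y) (g : pcmap Y Z) :
  @epic (pcCat R N) _ _ g -> @is_kernel (pcCat R N) _ _ _ f g -> sexC f g.
Proof. by move=> ge fk; apply: kernel_sex. Qed.

Lemma sexC_mono X Y Z (f : pcmap X Y) (g : pcmap Y Z) :
  @Defs.monic (pcCat R N) _ _ f -> @is_cokernel (pcCat R N) _ _ _ g f -> sexC f g.
Proof. by move=> ge fk; apply: cokernel_sex. Qed.

(* Instead of by a projective, F is covered by the cone of its own components. *)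
Lemma Phi_hereditary : hereditary_pair Phi (rperp Phi).
Proof.
split=> [K P F i f fe ik PP PF|D1 D2 C f g fm gc HD1 HD2 F PF].
  exact: (Phi_ker (sexC_epi fe ik) PP PF).
have fg := sexC_mono fm gc.
have BC q : B (C q).
  have /(_ q) := (sexC_deg _ _).1 fg => /right_coker; apply; exact: rperp_Phi_X.
have [G [u [v uv]]] := pred_reindex (pc_ob F); have [c cE] := from_cone u.
have cs : @msurj _ (pcConc R N) (cone G) F c.
  by move=> q y; exists (0, v q y); rewrite [LHS](cE q).1; case: (uv q).
have [K [m mc]] := sex_ker cs.
have AG : forall q, A (G q).
  apply: (@pred_all N (fun q => A (G q))) => q; have [vu uv'] := uv q.
  apply: (@left_iso _ _ (u q) _ _).2.
  - by move=> x x0; rewrite -(vu x) x0 linear0.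
  - by move=> y; exists (v q y).
  - exact: Phi_X.
have PG := cone_Phi AG.
apply: (ExtC_shiftl mc) => [|h].
  by apply: Ext_from_cone => q; apply: cot_ext.
(* A map from [K] to [C] lifts to [D2] because [K] is again in Phi, and the lift then extends over
   the cone. *)
have [l lE] := ExtC_lift h fg (HD1 _ (Phi_ker mc PG PF)).
have [e eE] := ExtC_extend l mc (HD2 _ PF).
by exists (pc_comp g e) => q x; rewrite /= eE lE.
Qed.

(** The dual device: [P] is embedded in the cone of its own components, with cokernel [shift P]
    again in Psi. *)
Lemma Psi_hereditary : hereditary_pair (lperp Psi) Psi.
Proof.
split=> [K C1 C2 i f fe ik HC1 HC2 P PP|D1 D2 C f g fm gc].
  have fg := sexC_epi fe ik.
  have AK q : A (K q).
    have /(_ q) := (sexC_deg _ _).1 fg => /left_ker; apply; exact: lperp_Psi_X.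
  have [m [g [mg _ _]]] := shift_sex P.
  have BP q : B (P q) by apply: Psi_X.
  have PQ : Psi (shift P) by apply: Psi_coker mg PP (cone_Psi BP).
  apply: (ExtC_shiftr mg) => [|h].
    by apply: Ext_to_cone => q; apply: cot_ext.
  have [e eE] := ExtC_extend h fg (HC2 _ PQ).
  have [l lE] := ExtC_lift e mg (HC1 _ PP).
  by exists (pc_comp l i) => q x; rewrite /= lE eE.
exact: (Psi_coker (sexC_mono fm gc)).
Qed.

(** In either intersection a contraction makes the cycles direct summands of the components. The
    components lie in the missing module class, as Ext against cones shows. *)
Lemma Phi_Psi_compatible : compatible_pairs Phi (rperp Phi) (lperp Psi) Psi.
Proof.
split=> [F P|X]; first exact: Phi_Psi_ext.
split=> [[PX RX]|[LX PX]].
  split=> [P|]; first exact: Phi_Psi_ext.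
  have [eX AX] := (PhiP X left_iso).1 PX; apply/PsiP; split=> //.
  have [|s sE] := @contraction _ _ X.
    apply: RX; apply/(PhiP _ left_iso); split; first by apply/shift_exact.
    by move=> q; apply: (@shift_cycles _ _ X q A left_iso).2; apply: AX.
  apply: (@pred_all N (fun q => B (Zc X q))) => q; apply/cot_right => M AM.
  apply: (ExtM_retractr (f := zin X (p q)) (g := lin_comp (zd X q) (s q))).
    by move=> z; apply: zin_inj; rewrite /= zdE sE // zinP.
  by apply: cot_ext => //; apply: rperp_Phi_X.
split=> [|F PF]; last exact: Phi_Psi_ext.
(* [X] has to play the role of the shift: Ext(shift Y, Y) vanishes because [shift Y] is left
   orthogonal to Psi and [Y] lies in Psi. *)
have [Y [t [t' [tK tK']]]] := unshift X.
have PsY : Psi (shift Y).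
  apply/PsiE => M AM; have /PsiE/(_ M AM) ext0 := PX.
  apply: (@Ext0_retractr _ (pcConc R N) _ _ _ t t' _ ext0).
  exact: pcmap_ext.
have PY : Psi Y.
  have [eY BY] := (PsiP B _).1 PsY; apply/PsiP; split; first by apply/shift_exact.
  apply: (@pred_all N (fun q => B (Zc Y q))) => q.
  by apply: (@shift_cycles _ _ Y q B right_iso).1; apply: BY.
have eY : exactc Y by case/PsiP: PY.
have LY : ExtC (shift Y) Y.
  apply: (@Ext0_retractl _ (pcConc R N) _ _ _ t t' _ (LX _ PY)).
  exact: pcmap_ext.
have [s sE] := contraction LY.
have AY : forall q, A (Y q).
  apply: (@pred_all N (fun q => A (Y q))) => q.
  apply: (@left_iso _ _ (t q) _ _).2; last exact: lperp_Psi_X.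
    by move=> x x0; rewrite -(tK q x) x0 linear0.
  by move=> y; exists (t' q y).
have PhY : Phi (shift Y).
  apply/(PhiP _ left_iso); split; first by apply/shift_exact.
  move=> q; apply: (@shift_cycles _ _ Y q A left_iso).2.
  apply/cot_left => V BV.
  apply: (ExtM_retractl (f := lin_comp (s q) (zin Y (p q))) (g := zd Y q)).
    by move=> z; apply: zin_inj; rewrite /= zdE sE // zinP.
  exact: cot_ext.
apply/PhiE => V BV; have /PhiE/(_ V BV) ext0 := PhY.
apply: (@Ext0_retractl _ (pcConc R N) _ _ _ t' t _ ext0).
exact: pcmap_ext.
Qed.

End CotorsionPairs.

(** * Initial algebras *)

Section TermModel.
Variables (R : pzRingType) (N : nat).
Local Notation p := (@ord_pred N).
Local Notation d X := (pc_d X _).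
Variables (X : pcomplex R N) (b : bool) (I : Type) (K P : I -> pcomplex R N).
Variable m : forall i, pcmap (K i) (P i).

Definition is_pcmap (Z D : pcomplex R N) (f : forall q, Z q -> D q) : Prop :=
  exists F : pcmap Z D, forall q x, F q x = f q x.

(* Complexes under the elements of X (under the complex X if b is true) with a
   chosen extension along m i of every morphism from K i. The operations are
   total, with junk values on families of functions that are not morphisms. *)
Record alg := Alg {
  al_ob :> pcomplex R N;
  al_var : forall q, X q -> al_ob q;
  al_op : forall i, (forall r, K i r -> al_ob r) -> forall q, P i q -> al_ob q;
  al_varP : b -> is_pcmap al_var;
  al_opP : forall i f, is_pcmap f ->
    is_pcmap (al_op (i := i) f) /\ forall q x, al_op f (m i q x) = f q x }.

Arguments al_var a {q} x.
Arguments al_op a {i} f {q} y.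

Definition alg_mor (A A' : alg) (h : pcmap A A') : Prop :=
  (forall q x, h q (al_var A x) = al_var A' x) /\
  forall i f q y, h q (al_op A f y) =
    al_op A' (i := i) (fun r x => h r (f r x)) y.

Inductive term : 'I_N -> Type :=
  | Tvar q of X q : term q
  | Tzero q : term q
  | Tlin q of R & term q & term q : term q
  | Tdif q of term q : term (p q)
  | Top i (f : forall r, K i r -> term r) q of P i q : term q.

Fixpoint eval (A : alg) q (t : term q) : A q :=
  match t with
  | Tvar q x => al_var A x
  | Tzero q => 0
  | Tlin q a s t => a *: eval A s + eval A t
  | Tdif q t => d A (eval A t)
  | Top i f q y => al_op A (fun r x => eval A (f r x)) y
  end.

(** Terms modulo equality of their values in every algebra, as equivalence classes. The algebras
    form a large type, but quantifying over them in [Prop] keeps the quotient as small as the terms,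
    and all laws are checked after evaluation. *)
Record tq q := Tq { tq_class : term q -> Prop;
  tqP : exists t, tq_class = fun s => forall A, eval A s = eval A t }.

Definition tpi q (t : term q) : tq q := Tq (ex_intro _ t erefl).
Definition trep q (x : tq q) : term q := sval (cid (tqP x)).

Lemma tq_eq q (x y : tq q) : tq_class x = tq_class y -> x = y.
Proof. case: x y => [c cP] [c' cP'] /= e; subst c'; congr Tq; exact: Prop_irrelevance. Qed.

Lemma trepK q (x : tq q) : tpi (trep x) = x.
Proof. by apply: tq_eq; rewrite /= -(svalP (cid (tqP x))). Qed.

Lemma tpi_eq q (s t : term q) : (forall A, eval A s = eval A t) -> tpi s = tpi t.
Proof.
move=> st; apply: tq_eq; apply: funext => u /=; apply: propext.
by split=> H A; rewrite H st.
Qed.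

Lemma eq_tpi q (s t : term q) : tpi s = tpi t -> forall A, eval A s = eval A t.
Proof.
by move=> /(congr1 (fun x : tq q => tq_class x s)) /= <-.
Qed.

Definition teval (A : alg) q (x : tq q) : A q := eval A (trep x).

Lemma teval_pi A q (t : term q) : teval A (tpi t) = eval A t.
Proof. by apply: eq_tpi; rewrite trepK. Qed.

Lemma teval_inj q (x y : tq q) : (forall A, teval A x = teval A y) -> x = y.
Proof. by move=> H; rewrite -[x]trepK -[y]trepK; apply: tpi_eq. Qed.

Definition tlin q (a : R) (x y : tq q) := tpi (Tlin a (trep x) (trep y)).
Lemma teval_lin A q a (x y : tq q) : teval A (tlin a x y) = a *: teval A x + teval A y.
Proof. by rewrite teval_pi. Qed.

Definition tzero q : tq q := tpi (Tzero q).
Lemma teval0 A q : teval A (tzero q) = 0.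
Proof. by rewrite teval_pi. Qed.

Definition tadd q (x y : tq q) := tlin 1 x y.
Definition topp q (x : tq q) := tlin (-1) x (tzero q).
Definition tscale q a (x : tq q) := tlin a x (tzero q).
Lemma teval_add A q (x y : tq q) : teval A (tadd x y) = teval A x + teval A y.
Proof. by rewrite teval_lin scale1r. Qed.
Lemma teval_opp A q (x : tq q) : teval A (topp x) = - teval A x.
Proof. by rewrite teval_lin teval0 addr0 scaleN1r. Qed.
Lemma teval_scale A q a (x : tq q) : teval A (tscale a x) = a *: teval A x.
Proof. by rewrite teval_lin teval0 addr0. Qed.

HB.instance Definition _ q := gen_eqMixin (tq q).
HB.instance Definition _ q := gen_choiceMixin (tq q).
Let tevalE := (teval_add, teval_opp, teval_scale, teval0).
Fact taddA q : associative (@tadd q).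
Proof. by move=> x y z; apply: teval_inj => A; rewrite !tevalE addrA. Qed.
Fact taddC q : commutative (@tadd q).
Proof. by move=> x y; apply: teval_inj => A; rewrite !tevalE addrC. Qed.
Fact tadd0 q : left_id (tzero q) (@tadd q).
Proof. by move=> x; apply: teval_inj => A; rewrite !tevalE add0r. Qed.
Fact taddN q : left_inverse (tzero q) (@topp q) (@tadd q).
Proof. by move=> x; apply: teval_inj => A; rewrite !tevalE addNr. Qed.
HB.instance Definition _ q :=
  GRing.isZmodule.Build (tq q) (@taddA q) (@taddC q) (@tadd0 q) (@taddN q).
Fact tscaleA q a c (x : tq q) : tscale a (tscale c x) = tscale (a * c) x.
Proof. by apply: teval_inj => A; rewrite !tevalE scalerA. Qed.
Fact tscale1 q : left_id 1 (@tscale q).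
Proof. by move=> x; apply: teval_inj => A; rewrite !tevalE scale1r. Qed.
Fact tscaleDr q : right_distributive (@tscale q) +%R.
Proof. by move=> a x y; apply: teval_inj => A; rewrite /= !tevalE scalerDr. Qed.
Fact tscaleDl q x : {morph (@tscale q)^~ x : a c / a + c}.
Proof. by move=> a c; apply: teval_inj => A; rewrite /= !tevalE scalerDl. Qed.
HB.instance Definition _ q := GRing.Zmodule_isLmodule.Build R (tq q)
  (@tscaleA q) (@tscale1 q) (@tscaleDr q) (@tscaleDl q).

Fact teval_linear A q : linear (@teval A q).
Proof. by move=> a x y; rewrite -teval_scale -teval_add. Qed.

Definition tdif q (x : tq q) : tq (p q) := tpi (Tdif (trep x)).
Lemma teval_dif A q (x : tq q) : teval A (tdif x) = d A (teval A x).
Proof. by rewrite teval_pi. Qed.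
Fact tdif_linear q : linear (@tdif q).
Proof.
move=> a x y; apply: teval_inj => A.
by rewrite teval_dif !teval_linear !teval_dif linearP.
Qed.

Fact tdif_tdif q (x : tq q) : tdif (tdif x) = 0.
Proof.
apply: teval_inj => A; rewrite !teval_dif pc_dd.
exact: (esym (teval0 A (p (p q)))).
Qed.

Definition tmodel : pcomplex R N :=
  @PComplex R N (fun q => tq q) (fun q => mklin (@tdif_linear q)) tdif_tdif.

Definition teval_map (A : alg) : pcmap tmodel A :=
  @PCMap R N tmodel A (fun q => mklin (@teval_linear A q)) (fun q x => teval_dif A x).

Lemma is_pcmapP (Z D : pcomplex R N) (f : forall q, Z q -> D q) :
  is_pcmap f <-> (forall q, linear (f q)) /\ forall q x, f (p q) (d Z x) = d D (f q x).
Proof.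
split=> [[F FE]|[fl fd]].
  by split=> [q a x y|q x]; rewrite -!FE ?linearP ?pc_comm.
by exists (@PCMap R N Z D (fun q => mklin (fl q)) fd).
Qed.

(** The laws of an algebra are conditional on [f] being a chain map. As evaluations detect this too,
    the conditional laws hold in the quotient. *)
Lemma is_pcmap_model (Z : pcomplex R N) (f : forall q, Z q -> tmodel q) :
  is_pcmap f <-> forall A, is_pcmap (fun q x => teval A (f q x)).
Proof.
split=> [[F FE] A|H].
  by exists (pc_comp (teval_map A) F) => q x; rewrite -FE.
apply/is_pcmapP; split=> [q a x y|q x]; apply: teval_inj => A;
    have /is_pcmapP[fl fd] := H A.
  by rewrite teval_linear fl.
by rewrite [RHS]teval_dif fd.
Qed.

Definition top i (f : forall r, K i r -> tmodel r) q (y : P i q) : tmodel q :=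
  tpi (Top (fun r x => trep (f r x)) y).
Lemma teval_op A i (f : forall r, K i r -> tmodel r) q (y : P i q) :
  teval A (top f y) = al_op A (fun r x => teval A (f r x)) y.
Proof. by rewrite teval_pi. Qed.

Definition tmodel_alg : alg.
Proof.
apply: (@Alg tmodel (fun q x => tpi (Tvar x)) top).
  move=> bT; apply/is_pcmap_model => A; have [F FE] := al_varP A bT.
  by exists F => q x; rewrite teval_pi FE.
move=> i f /is_pcmap_model H; split.
  apply/is_pcmap_model => A; have [[F FE] _] := al_opP (H A).
  by exists F => q x; rewrite teval_op FE.
move=> q x; apply: teval_inj => A; rewrite teval_op.
by have [_] := al_opP (H A); apply.
Defined.

Lemma teval_mor A : alg_mor (A := tmodel_alg) (teval_map A).
Proof. by split=> [q x|i f q y]; [exact: teval_pi|exact: teval_op]. Qed.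

Lemma mor_eval (A A' : alg) (h : pcmap A A') : alg_mor h ->
  forall q (t : term q), h q (eval A t) = eval A' t.
Proof.
move=> [hv ho] q; elim=> {q} [q x|q|q a s IHs t IHt|q t IHt|i f IHf q y] /=.
- exact: hv.
- exact: linear0.
- by rewrite linearP IHs IHt.
- by rewrite pc_comm IHt.
- rewrite ho.
  suff -> : (fun r x => h r (eval A (f r x))) = (fun r x => eval A' (f r x)) by [].
  by apply: functional_extensionality_dep => r; apply: funext => x; apply: IHf.
Qed.

Lemma tmodel_eval q (t : term q) : eval tmodel_alg t = tpi t.
Proof.
apply: teval_inj => A; rewrite -[LHS]/(teval_map A q _) (mor_eval (teval_mor A)).
by rewrite teval_pi.
Qed.

(** Uniqueness is stated for endomorphisms, the form in which it identifies a composite through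
    another algebra with the identity. *)
Lemma initial_model : exists D : alg,
  (forall A : alg, exists h : pcmap D A, alg_mor h) /\
  forall h : pcmap D D, alg_mor h -> forall q x, h q x = x.
Proof.
exists tmodel_alg; split=> [A|h hm q x]; first by exists (teval_map A); apply: teval_mor.
have -> : x = eval tmodel_alg (trep x) by rewrite tmodel_eval trepK.
exact: mor_eval.
Qed.

End TermModel.

Arguments al_var {R N X b I K P m} a {q} x.
Arguments al_op {R N X b I K P m} a {i} f {q} y.


(** * The small object argument *)

Section SmallObject.
Variables (R : pzRingType) (N : nat).
Local Notation d X := (pc_d X _).
Implicit Types X Y Z D A B T W S Q E : pcomplex R N.

(** With no operations and [b = false] the initial algebra is the free complex on the elements of
    [X]. Lifts of the generators define a section of any extension, by uniqueness of
    endomorphisms. *)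
Lemma enough_proj X : exists F (s : pcmap F X),
  (forall q y, exists x, s q x = y) /\ forall Y, ExtC F Y.
Proof.
pose K (i : False) := X; pose m i : pcmap (K i) (K i) := pc_id (K i).
pose mk Z (v : forall q, X q -> Z q) : alg X false m :=
  @Alg R N X false False K K m Z v (fun i => False_rect _ i)
    (fun b0 => False_rect _ (notF b0)) (fun i => False_rect _ i).
have [F [Fi Fu]] := initial_model X false m.
have [s [sv _]] := Fi (mk X (fun q x => x)).
exists F, s; split=> [q y|Y]; first by exists (al_var F y); rewrite sv.
apply/ExtC_split => E f g fg; have [_ _ gs] := fg.
have /dep_choice[v vE] : forall q, exists v : X q -> E q, forall x, g q (v x) = al_var F x.
  by move=> q; apply: (@dep_choice (X q) (fun=> E q) (fun x e => g q e = al_var F x)) => x; apply: gs.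
have [h [hv _]] := Fi (mk E v); exists h => q x.
apply: (Fu (pc_comp g h)); split=> [r y|[]] /=.
by rewrite hv /= vE.
Qed.

Hypothesis injR : enough_injectives R.

Lemma enough_inj X : exists J (f : pcmap X J),
  (forall q x, f q x = 0 -> x = 0) /\ forall Z, ExtC Z J.
Proof.
have /dep_choice[E /dep_choice[e eE]] := fun q => injR (X q).
have [f fE] := to_cone e; exists (cone E), f; split=> [q x|Z].
  by rewrite fE => -[/(eE q).1].
by apply: Ext_to_cone => q; apply: (eE q).2.
Qed.

Lemma sexC_ker X Y (f : pcmap X Y) : (forall q y, exists x, f q x = y) ->
  exists K (k : pcmap K X), sexC k f.
Proof. exact: (sex_ker (cY := pcConc R N)). Qed.

Lemma sexC_coker X Y (f : pcmap X Y) : (forall q x, f q x = 0 -> x = 0) ->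
  exists C (c : pcmap Y C), sexC f c.
Proof. exact: (sex_coker (cY := pcConc R N)). Qed.

Lemma fac_injC A B T (j : pcmap A B) (h : pcmap T B) :
  (forall q x, j q x = 0 -> x = 0) -> (forall q x, exists y, j q y = h q x) ->
  exists u : pcmap T A, forall q x, j q (u q x) = h q x.
Proof.
move=> ji jh; have [u uE] := @fac_inj _ (pcConc R N) _ _ _ j h ji jh.
by exists u => q x; apply: (pcE uE).
Qed.

Lemma fac_surjC A B T (s : pcmap A B) (h : pcmap A T) :
  (forall q y, exists x, s q x = y) -> (forall q x, s q x = 0 -> h q x = 0) ->
  exists u : pcmap B T, forall q x, u q (s q x) = h q x.
Proof.
move=> ss sh; have [u uE] := @fac_surj _ (pcConc R N) _ _ _ s h ss sh.
by exists u => q x; apply: (pcE uE).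
Qed.

Lemma pullbackC X Y Z T (f : pcmap X Y) (g : pcmap Y Z) (h : pcmap T Z) : sexC f g ->
  exists W (a : pcmap X W) (b : pcmap W Y) (c : pcmap W T),
  [/\ sexC a c, forall q x, b q (a q x) = f q x, forall q w, g q (b q w) = h q (c q w) &
      forall S (u : pcmap S Y) (v : pcmap S T),
        (forall q s, g q (u q s) = h q (v q s)) ->
        exists w : pcmap S W, (forall q s, b q (w q s) = u q s) /\
          forall q s, c q (w q s) = v q s].
Proof.
move=> fg.
have [W [a [b [c [ac ba gb _ [_ U]]]]]] := @pullback _ (pcConc R N) _ _ _ _ f g h fg.
exists W, a, b, c; split=> // [q x|q w|S u v uv]; [exact: (pcE ba)|exact: (pcE gb)|].
have [|w [bw cw]] := U S u v; first exact: pcmap_ext.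
by exists w; split=> q s; [apply: (pcE bw)|apply: (pcE cw)].
Qed.

(** Each [S i] is the cokernel of [m i] from [K i] to a projective [P i], so Ext(S i, D) = 0 says
    that maps from [K i] to [D] extend along [m i]. [D] is the initial complex under [X] with chosen
    extensions. *)
Theorem small_object (I : Type) (S : I -> pcomplex R N) X :
  exists D Q (f : pcmap X D) (g : pcmap D Q),
    [/\ sexC f g, forall i, ExtC (S i) D &
        forall Y, (forall i, ExtC (S i) Y) -> ExtC Q Y].
Proof.
have [P /dep_choice[c cE]] := dep_choice (fun i => enough_proj (S i)).
have /dep_choice[K /dep_choice[m mc]] := fun i => sexC_ker (cE i).1.
have extP i Y : ExtC (P i) Y by apply: (cE i).2.
have [D [Di Du]] := initial_model X true m.
have [f fE] := al_varP D isT.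
have fi q x : f q x = 0 -> x = 0.
  (* An injective [J] containing [X] is itself an algebra, so the embedding of [X] factors through
     [f]. *)
  have [J [j [ji Jinj]]] := enough_inj X.
  have /dep_choice[op opE] : forall i, exists op : (forall r, K i r -> J r) ->
      forall q, P i q -> J q, forall h, is_pcmap h ->
      is_pcmap (op h) /\ forall q x, op h q (m i q x) = h q x.
    move=> i; apply: (@dep_choice (forall r, K i r -> J r) (fun=> forall q, P i q -> J q) (fun h e => is_pcmap h -> is_pcmap e /\
      forall q x, e q (m i q x) = h q x)) => h.
    have [[H HE]|nh] := pselect (is_pcmap h); last by exists (fun q _ => 0).
    have [e eE] := ExtC_extend H (mc i) (Jinj _); exists (fun q y => e q y) => _.
    split; first by exists e.
    by move=> r y; rewrite eE HE.
  have jP : true -> is_pcmap (fun q x => j q x) by exists j.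
  have [h [hv _]] := Di (Alg jP opE).
  by move=> fx0; apply: ji; rewrite -[LHS](hv q) -fE fx0 linear0.
have [Q [g fg]] := sexC_coker fi; exists D, Q, f, g; split=> // [i|Y extY].
  apply: (ExtC_shiftl (mc i)) => // h.
  have [[G GE] Gm] := al_opP (a := D) (i := i) (f := fun q x => h q x)
    (ex_intro _ h (fun _ _ => erefl)).
  by exists G => q x; rewrite GE Gm.
apply/ExtC_split => E j g' jg.
(* The extension of [Q] is pulled back to an extension [W] of [D]. An algebra structure on [W] over
   that of [D] yields a section by initiality; it descends to [Q] since [v], the lift of [f], has
   zero component in [E]. *)
have [W [a [b [w [aw ba gb U]]]]] := pullbackC g jg.
have [|v [bv wv]] := U X (pc_zero X E) f.
  by move=> q x /=; rewrite linear0; apply/esym; apply: (sex_ap0 fg).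
have [ai wex ws] := aw; have wa q x : w q (a q x) = 0 by apply: (sex_ap0 aw).
(* The operations must lie over those of [D] on every family, chain map or not, for [w] to respect
   them. *)
have /dep_choice[op opE] : forall i, exists op : (forall r, K i r -> W r) ->
    forall q, P i q -> W q, forall h,
    (forall q y, w q (op h q y) = al_op D (fun r x => w r (h r x)) y) /\
    (is_pcmap h -> is_pcmap (op h) /\ forall q x, op h q (m i q x) = h q x).
  move=> i; apply: (@dep_choice (forall r, K i r -> W r) (fun=> forall q, P i q -> W q)
    (fun h e => (forall q y, w q (e q y) = al_op D (fun r x => w r (h r x)) y) /\
      (is_pcmap h -> is_pcmap e /\ forall q x, e q (m i q x) = h q x))) => h.
  have [[H HE]|nh] := pselect (is_pcmap h); last first.
    have /dep_choice[e eE] : forall q, exists e : P i q -> W q, forall y,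
        w q (e y) = al_op D (fun r x => w r (h r x)) y.
      by move=> q; apply: (@dep_choice (P i q) (fun=> W q) (fun y z => w q z =
        al_op D (fun r x => w r (h r x)) y)) => y; apply: ws.
    by exists e.
  have [|[G GE] Gm] := al_opP (a := D) (f := fun r x => w r (h r x)).
    by exists (pc_comp w H) => q x /=; rewrite HE.
  have [l lE] := ExtC_lift G aw (extP i Y).
  (* The lift [l] agrees with [H] on [K i] up to a map [u] into [Y], and [u] extends to [P i]
     because Ext(S i, Y) = 0. *)
  have [//|q x|u uE] := fac_injC (j := a) (h := pc_sub H (pc_comp l (m i))).
    by apply/wex; rewrite [LHS](linearB (w q)) /= lE GE Gm HE subrr.
  have [u' u'E] := ExtC_extend u (mc i) (extY i).
  pose e q y := a q (u' q y) + l q y.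
  exists e; split=> [q y|_]; first by rewrite /e linearD /= lE GE wa add0r.
  split; last by move=> q x; rewrite /e u'E uE /= subrK HE.
  apply/is_pcmapP; split=> [q t x y|q x]; last by rewrite /e !pc_comm linearD.
  by rewrite /e !linearP scalerDr addrACA.
have vP : true -> is_pcmap (fun q x => v q x) by exists v.
pose A := Alg vP (fun i h => (opE i h).2).
have [h [hv ho]] := Di A.
have wh q x : w q (h q x) = x.
  apply: (Du (pc_comp w h)); split=> [r y|i e r y] /=; first by rewrite hv /= wv fE.
  by rewrite ho /= (opE _ _).1.
have [gi gex gs] := fg.
have [//|q x /gex[y <-]|s sE] := fac_surjC (s := g) (h := pc_comp b h).
  by rewrite /= [f q y]fE hv /= bv.
exists s => q x; have [y <-] := gs q x.
by rewrite [s q _]sE /= gb wh.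
Qed.

End SmallObject.

(** * Completeness *)

Section Complete.
Variables (R : pzRingType) (N : nat).
Local Notation p := (@ord_pred N).
Local Notation d X := (pc_d X _).
Hypothesis injR : enough_injectives R.
Implicit Types X Y Z F P C K Q : pcomplex R N.
Implicit Types U V W M : lmodType R.

Lemma complete_right (G D : pcCat R N -> Prop) :
  (forall X Y Z (f : pcmap X Y) (g : pcmap Y Z), sexC f g -> G X -> G Z -> G Y) ->
  (forall X, (forall Y, ExtC X Y) -> G X) ->
  (forall X, exists D1 G1 (f : pcmap X D1) (g : pcmap D1 G1), [/\ D D1, G G1 & sexC f g]) ->
  complete_pair G D.
Proof.
move=> Gext Gproj H X; split.
  have [F [s [ss Fproj]]] := enough_proj X; have [K [m ms]] := sexC_ker ss.
  have [D0 [G0 [f [g [DD GG fg]]]]] := @salce _ (pcConc R N) G D X F K m s Gext ms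
    (Gproj _ Fproj) (H K).
  by exists D0, G0, f, g; split=> //; apply/(short_exactP (pcConc R N)).
have [D1 [G1 [f [g [DD GG fg]]]]] := H X.
by exists D1, G1, f, g; split=> //; apply/(short_exactP (pcConc R N)).
Qed.

Lemma set_complete (I : Type) (S : I -> pcomplex R N) (D : pcCat R N -> Prop) :
  (forall X, D X <-> forall i, ExtC (S i) X) -> complete_pair (lperp D) D.
Proof.
move=> DE; apply: complete_right => [X Y Z f g fg HX HZ C DC|X pX C _|X].
- exact: Ext0_extl fg (HX _ DC) (HZ _ DC).
- exact: pX.
have [D1 [Q [f [g [fg SD DQ]]]]] := small_object injR S X.
by exists D1, Q, f, g; split=> //; [apply/DE|move=> Y /DE; apply: DQ].
Qed.

Variables (A B : modCat R -> Prop).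
Hypothesis AB_cotorsion : cotorsion_pair A B.
Hypothesis AB_hereditary : hereditary_pair A B.
Local Notation Phi := (@Phi R N A).
Local Notation Psi := (@Psi R N B).

Section Generated.
Variables (I : Type) (S : I -> modCat R).
Hypothesis S_gen : generated_by (fun T => exists i, T = S i) A B.

Lemma gen_left i : A (S i).
Proof.
apply/(cot_left AB_cotorsion) => V /S_gen; apply; by exists i.
Qed.

Lemma gen_right V : B V <-> forall i, ExtM (S i) V.
Proof.
split=> [/S_gen H i|H]; first by apply: H; exists i.
by apply/S_gen => _ [i ->]; apply: H.
Qed.

Lemma Psi_complete : complete_pair (lperp Psi) Psi.
Proof.
apply: (@set_complete (option I) (fun o => stalk N (if o is Some i then S i else (R^o : lmodType R)))).
move=> X.
have H := @PsiE_gen R N A B AB_cotorsion (fun T => exists i, T = S i).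
apply: (iff_trans (H _ _ X)) => [_ [i ->]|V SV|]; first exact: gen_left.
  by apply/gen_right => i; apply: SV; exists i.
split=> [HX [i|]|HX M [[i ->]|->]]; last exact: (HX None).
- by apply: HX; left; exists i.
- by apply: HX; right.
- exact: (HX (Some i)).
Qed.

(** The module case is read off in one degree: Ext from a constant cone tests the components of a
    complex, and [M] enters as a stalk. *)
Lemma module_approx (q0 : 'I_N) M : exists V W (f : {linear M -> V}) (g : {linear V -> W}),
  [/\ B V, A W & sexM f g].
Proof.
have [D [Q [f [g [fg SD DQ]]]]] :=
  small_object injR (fun i => cone (fun _ : 'I_N => S i : lmodType R)) (stalk N M).
exists (D q0), (Q q0), (f q0), (g q0); split.
- by apply/gen_right => i; apply: Ext_comp_cone.
- apply/(cot_left AB_cotorsion) => V BV; apply: Ext_cone_comp; apply: DQ => i.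
  apply: Ext_from_cone => q; apply: (cot_ext AB_cotorsion); first exact: gen_left.
  by apply: (Psi_X AB_cotorsion); apply: (cone_Psi AB_cotorsion).
- exact: (sexC_deg _ _).1 fg q0.
Qed.

End Generated.

Hypothesis approx : forall M, exists V W (f : {linear M -> V}) (g : {linear V -> W}),
  [/\ B V, A W & sexM f g].

(** The pushout [T], an extension of [U'] by [V], has to extend to one of [V']; the obstruction lies
    in Ext^2(W', V) and heredity removes it. Concretely, [T] embeds in [V2] in [B], the quotient
    [V3] of [V2] by [V] is in [B], so the induced map from [U'] to [V3] extends to [V'], and [M] is
    the pullback along it. *)
Lemma horseshoe U (X : lmodType R) U' V V' W W' (i : {linear U -> X}) (s : {linear X -> U'})
    (b : {linear U -> V}) (a : {linear V -> W}) (b' : {linear U' -> V'}) (a' : {linear V' -> W'}) :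
  sexM i s -> sexM b a -> sexM b' a' -> B V -> B V' -> A W' ->
  exists M (j : {linear V -> M}) (r : {linear M -> V'}) (f : {linear X -> M}),
    [/\ sexM j r, forall x, f (i x) = j (b x) & forall x, r (f x) = b' (s x)].
Proof.
move=> is_ ba ba' BV BV' AW'.
have [T [c [e [t [ct cb te _ _]]]]] := @pushout _ (modConc R) _ _ _ _ i s b is_.
have ctM : sexM c t := ct.
have cbE x : c (b x) = e (i x) by exact: (congr1 (fun h : {linear U -> T} => h x) cb).
have teE x : t (e x) = s x by exact: (congr1 (fun h : {linear X -> U'} => h x) te).
have [V2 [W2 [h [h' [BV2 AW2 hh']]]]] := approx T.
have /sexMP[hi _ _] := hh'; have /sexMP[ci cex ts] := ctM.
have [V3 [u [us uE]]] := quo_exM (im_lin_closed (lin_comp h c)).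
have hcu : sexM (lin_comp h c) u.
  by apply/sexMP; split=> // x hc0; apply/ci/hi.
have BV3 : B V3 by apply: (right_coker AB_hereditary hcu).
have [//|x /cex[v <-]|w wE] := fac_surjM (p := t) (h := lin_comp u h).
  by apply/uE; exists v.
have [w' w'E] := ExtM_extend w ba' (cot_ext AB_cotorsion AW' BV3).
have [M [j [be [r [jr bej ube mono [full U0]]]]]] := @pullback _ (modConc R) _ _ _ _ _ _ w' hcu.
have bejE x : be (j x) = h (c x) by exact: (congr1 (fun g : {linear V -> V2} => g x) bej).
have [|f [bef rf]] := U0 X (lin_comp h e) (lin_comp b' s).
  by apply: linear_ext => x /=; rewrite w'E -teE wE.
have befE x : be (f x) = h (e x) by exact: (congr1 (fun g : {linear X -> V2} => g x) bef).
have rfE x : r (f x) = b' (s x) by exact: (congr1 (fun g : {linear X -> V'} => g x) rf).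
exists M, j, r, f; split=> // x.
have rj y : r (j y) = 0 by exact: (sex_ap0 jr (i := tt) y).
have six : s (i x) = 0 by exact: (sex_ap0 is_ (i := tt) x).
apply/eqP; rewrite -subr_eq0; apply/eqP; apply: (mono tt).
  by rewrite [LHS](linearB be) befE bejE cbE subrr.
by rewrite [LHS](linearB r) rfE six linear0 rj subrr.
Qed.

(** The horseshoe is applied to the cycle sequences. The resulting sequences V q -> M q -> V (p q)
    are spliced by [d = j r], so the [V q] become the cycles of [P]. *)
Lemma exact_approx X : exactc X ->
  exists P Q (f : pcmap X P) (g : pcmap P Q), [/\ Psi P, Phi Q & sexC f g].
Proof.
move=> eX.
have [V /dep_choice[W /dep_choice[b /dep_choice[a H]]]] := dep_choice (fun q => approx (Zc X q)).
have BV q : B (V q) by case: (H q).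
have AW q : A (W q) by case: (H q).
have ba q : sexM (b q) (a q) by case: (H q).
have [M /dep_choice[j /dep_choice[r /dep_choice[f fE]]]] := dep_choice (fun q =>
  horseshoe (sexZ q eX) (ba q) (ba (p q)) (BV q) (BV (p q)) (AW (p q))).
have jr q : sexM (j q) (r q) by case: (fE q).
have fz q z : f q (zin X q z) = j q (b q z) by case: (fE q).
have {fE} rf q x : r q (f q x) = b (p q) (zd X q x) by case: (fE q).
have ji q x : j q x = 0 -> x = 0 by have /sexMP[+ _ _] := jr q; apply.
have rj q x : r q (j q x) = 0 by have /sexMP[_ rex _] := jr q; apply/rex; exists x.
pose dP q : {linear M q -> M (p q)} := lin_comp (j (p q)) (r q).
have dd q x : dP (p q) (dP q x) = 0 by rewrite /= rj linear0.
pose P := @PComplex R N M dP dd.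
have fc q (x : X q) : f (p q) (d X x) = d P (f q x).
  by rewrite /= rf -fz zdE.
pose fP := @PCMap R N X P f fc.
have eP : exactc P.
  move=> q x /= /ji; have /sexMP[_ rex _] := jr (p q); move=> /rex[v <-].
  by have /sexMP[_ _ rs] := jr q; have [y <-] := rs v; exists y.
have zj q : exists u : {linear V q -> Zc P q}, forall v, zin P q (u v) = j q v.
  apply: fac_injM; first exact: zin_eq0.
  by move=> v; apply: zin_ex; rewrite /= rj linear0.
have [u uE] := dep_choice zj.
have us q y : exists v, u q v = y.
  have /sexMP[_ rex _] := jr q; have := zinP y => /= /ji/rex[v vE].
  by exists v; apply: (@zin_inj _ _ P q); rewrite uE vE.
have ui q x : u q x = 0 -> x = 0.
  by move=> x0; apply: (ji q); rewrite -uE x0 linear0.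
have bi q x : b q x = 0 -> x = 0 by have /sexMP[+ _ _] := ba q; apply.
have fi q x : fP q x = 0 -> x = 0.
  move=> /= fx0; have zx0 : zd X q x = 0 by apply: (bi (p q)); rewrite -rf fx0 linear0.
  have [|z zx] := zin_ex (x := x); first by rewrite -zdE zx0 linear0.
  have z0 : z = 0 by apply: (bi q); apply: (ji q); rewrite -fz zx.
  by rewrite -zx z0 linear0.
have [Q [g fg]] := sexC_coker fi; exists P, Q, fP, g; split=> //.
  apply/PsiP; split=> // q.
  exact: (right_iso AB_cotorsion (ui q) (us q)).1 (BV q).
have eQ := exactc_coker fg eX eP.
apply/(PhiP _ (left_iso AB_cotorsion)); split=> // q.
(* The cycles of [Q] are those of [P] modulo those of [X], that is [V q] modulo the image of [b q],
   which is [W q]. *)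
have [f' [g' [fg' f'E]]] := sex_cycles fg q eX; have /sexMP[_ gex gs] := fg'.
have /sexMP[_ aex as_] := ba q.
have [//|v /aex[z <-]|w wE] := fac_surjM (p := a q) (h := lin_comp g' (u q)).
  by apply/gex; exists z; apply: zin_inj; rewrite f'E uE /= fz.
apply: (left_iso AB_cotorsion (f := w) _ _).1 (AW q).
  move=> x; have [v <-] := as_ x; rewrite wE => /gex[z zE]; apply/aex; exists z.
  by apply/eqP; rewrite -subr_eq0; apply/eqP/(ji q); rewrite linearB -fz -[f q _]f'E zE uE subrr.
move=> y; have [z <-] := gs y; have [v <-] := us q z.
by exists (a q v); rewrite wE.
Qed.

End Complete.

(** * Exact complexes are generated by a set *)

Section SmallExact.
Variables (R : pzRingType) (N : nat).
Local Notation p := (@ord_pred N).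
Local Notation d X := (pc_d X _).
Implicit Types X Y Z F E H : pcomplex R N.

(* The terms index the elements of the least subcomplex that contains given
   elements and is closed under a choice of preimages under the differential. *)
Inductive sterm : 'I_N -> Type :=
  | Sroot q : sterm q
  | Slin q of R & sterm q & sterm q : sterm q
  | Sdif q of sterm q : sterm (p q)
  | Ssol q of sterm (p q) : sterm q.

Fixpoint seval F (root : forall q, F q) (sol : forall q, F (p q) -> F q)
    q (t : sterm q) : F q :=
  match t with
  | Sroot q => root q
  | Slin q a s t => a *: seval root sol s + seval root sol t
  | Sdif q t => d F (seval root sol t)
  | Ssol q t => sol q (seval root sol t)
  end.

(** A complex covered by [sterm] is determined up to isomorphism by which terms have equal values;
    such relations index representatives. *)
Definition sindex : Type := forall q, sterm q -> sterm q -> Prop.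

Definition presents (j : sindex) X (ev : forall q, sterm q -> X q) : Prop :=
  [/\ forall q x, exists t, ev q t = x,
      forall q a s t, ev q (Slin a s t) = a *: ev q s + ev q t,
      forall q t, ev (p q) (Sdif t) = d X (ev q t) &
      forall q s t, j q s t <-> ev q s = ev q t].

Lemma presents_map j X Y (e : forall q, sterm q -> X q) (e' : forall q, sterm q -> Y q) :
  presents j e -> presents j e' -> exists u : pcmap X Y, forall q t, u q (e q t) = e' q t.
Proof.
move=> [es el ed ej] [es' el' ed' ej'].
have /dep_choice[r rE] : forall q, exists r : X q -> sterm q, forall x, e q (r x) = x.
  by move=> q; apply: (@dep_choice (X q) (fun=> sterm q) (fun x t => e q t = x)).
have eE q s t : e q s = e q t -> e' q s = e' q t by move=> /ej/ej'.
have /is_pcmapP[u uE] : (forall q, linear (fun x : X q => e' q (r q x))) /\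
    forall q (x : X q), e' (p q) (r (p q) (d X x)) = d Y (e' q (r q x)).
  split=> [q a x y|q x]; first by rewrite -el'; apply: eE; rewrite el !rE.
  by rewrite -ed'; apply: eE; rewrite ed !rE.
by exists u => q t; rewrite uE; apply: eE; rewrite rE.
Qed.

Lemma presents_Ext j X Y Z (e : forall q, sterm q -> X q) (e' : forall q, sterm q -> Y q) :
  presents j e -> presents j e' -> ExtC X Z -> ExtC Y Z.
Proof.
move=> pe pe'; have [u uE] := presents_map pe pe'; have [v vE] := presents_map pe' pe.
apply: (@Ext0_retractl _ (pcConc R N) _ _ _ v u); apply: pcmap_ext => q y /=.
by have [es _ _ _] := pe'; have [t <-] := es q y; rewrite vE uE.
Qed.

(** Closing [x0] under the operations and chosen preimages gives an exact subcomplex whose size is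
    bounded by the terms, independently of [F]. *)
Lemma lowenheim_skolem F q0 (x0 : F q0) : exactc F ->
  exists H (h : pcmap H F) j (ev : forall q, sterm q -> H q),
    [/\ exactc H, forall q x, h q x = 0 -> x = 0, exists y, h q0 y = x0 & presents j ev].
Proof.
move=> eF; have [del [del0 _]] := delta_in F q0.
have /dep_choice[sol solE] : forall q, exists sol : F (p q) -> F q,
    forall x, d F x = 0 -> d F (sol x) = x.
  move=> q; apply: (@dep_choice (F (p q)) (fun=> F q) (fun x y => d F x = 0 -> d F y = x)) => x.
  have [dx|ndx] := pselect (d F x = 0); last by exists 0.
  by have [y yx] := eF q x dx; exists y.
(* The root of degree [q0] is [x0]; the other roots are 0. *)
pose val q (t : sterm q) := seval (fun q => del q x0) sol t.
have [q|q x [t <-]|H [h hE]] := @sub_ex R N F (fun q x => exists t, val q t = x).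
- split=> [|a _ _ [s <-] [t <-]]; last by exists (Slin a s t).
  (* [sterm] has no constant for zero, so it is written as a difference of roots. *)
  by exists (Slin (-1) (Sroot q) (Sroot q)); rewrite /val /= scaleN1r addNr.
- by exists (Sdif t).
have hi q : injective (h q) by case: (hE q).
have hi0 q x : h q x = 0 -> x = 0 by move=> hx; apply: hi; rewrite linear0.
have /dep_choice[ev evE] : forall q, exists ev : sterm q -> H q, forall t, h q (ev t) = val q t.
  move=> q; apply: (@dep_choice (sterm q) (fun=> H q) (fun t y => h q y = val q t)) => t.
  by apply/(hE q).2; exists t.
exists H, h, (fun q s t => ev q s = ev q t), ev; split=> //.
- move=> q x dx; have /(hE (p q)).2[t tE] : exists y, h _ y = h (p q) x by exists x.
  exists (ev q (Ssol t)); apply: hi; rewrite pc_comm evE /val /= -/(val _ t) tE.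
  by apply: solE; rewrite -pc_comm dx linear0.
- by exists (ev q0 (Sroot q0)); rewrite evE /val /= del0.
- split=> // [q x|q a s t|q t].
  + have /(hE q).2[t tE] : exists y, h q y = h q x by exists x.
    by exists t; apply: hi; rewrite evE.
  + by apply: hi; rewrite linearP !evE.
  + by apply: hi; rewrite pc_comm !evE.
Qed.

(** Relations that present no exact complex are assigned a cone, so that every value is exact. *)
Definition small_exact (j : sindex) : pcomplex R N :=
  match pselect (exists X, exactc X /\ exists ev : forall q, sterm q -> X q, presents j ev) with
  | left e => sval (cid e)
  | right _ => cone (fun=> R^o : lmodType R)
  end.

Lemma small_exactP j : exactc (small_exact j).
Proof.
rewrite /small_exact; case: pselect => [e|_]; last exact: cone_exact.
by case: (svalP (cid e)).
Qed.

Lemma small_exact_Ext j X Y (ev : forall q, sterm q -> X q) : exactc X -> presents j ev ->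
  ExtC (small_exact j) Y -> ExtC X Y.
Proof.
move=> eX pX; rewrite /small_exact; case: pselect => [e|ne]; last first.
  by case: ne; exists X; split=> //; exists ev.
by have [_ [ev' pX']] := svalP (cid e); apply: presents_Ext pX' pX.
Qed.

Lemma sexCP X Y Z (f : pcmap X Y) (g : pcmap Y Z) : sexC f g <->
  [/\ forall q x, f q x = 0 -> x = 0, forall q y, g q y = 0 <-> (exists x, f q x = y) &
      forall q z, exists y, g q y = z].
Proof. by split=> -[]. Qed.

(** Zorn's lemma replaces a filtration of [F]: a good [G] is an exact subcomplex of [E] on which [g]
    is injective, hence a section over an exact subcomplex of [F]. A maximal one covers [F]. *)
Lemma exact_generated (q0 : 'I_N) Y : (forall j, ExtC (small_exact j) Y) ->
  forall F, exactc F -> ExtC F Y.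
Proof.
move=> smallY F eF; apply/ExtC_split => E j g jg; have /sexCP[ji jex gs] := jg.
have gj0 q y : g q (j q y) = 0 by apply: (sex_ap0 jg).
(* Graded predicates are packed on the sigma type to fit [zorn_pred]. *)
pose good (G : {q & E q} -> Prop) :=
  let G' q (x : E q) := G (existT (fun q => pc_ob E q : Type) q x) in
  [/\ forall q, lin_closed (G' q), forall q x, G' q x -> G' (p q) (d E x),
      forall q x, G' q x -> g q x = 0 -> x = 0 &
      forall q x, G' (p q) x -> d E x = 0 -> exists2 y, G' q y & d E y = x].
have [||C [G0 CG0] Cg Cc|G [[Glin Gd Gi Gex] Gmax]] := @zorn_pred {q & E q} good.
- exists (fun z : {q & E q} => projT2 z = 0); split=> [q|q x /= ->|q x /= -> //|q x /= -> _].
  + by split=> //= a x y -> ->; rewrite scaler0 addr0.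
  + by rewrite linear0.
  + by exists 0; rewrite ?linear0.
- by move=> G [Gl _ _ _]; exists (existT (fun q => E q : Type) q0 0); case: (Gl q0).
- split=> [q|q x [G CG Gx]|q x [G CG Gx]|q x [G CG Gx] dx].
  + split=> [|a x y [G CG Gx] [H CH Hy]].
      by exists G0 => //; have [Gl _ _ _] := Cg _ CG0; case: (Gl q).
    have [GH|HG] := Cc _ _ CG CH.
      by exists H => //; have [Hl _ _ _] := Cg _ CH; apply: (Hl q).2 => //; apply: GH.
    by exists G => //; have [Gl _ _ _] := Cg _ CG; apply: (Gl q).2 => //; apply: HG.
  + by exists G => //; have [_ Gd _ _] := Cg _ CG; apply: Gd.
  + by have [_ _ Gi _] := Cg _ CG; apply: Gi Gx.
  + have [_ _ _ Gex] := Cg _ CG; have [y Gy dy] := Gex q x Gx dx.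
    by exists y => //; exists G.
have [K [k kE]] := sub_ex Glin Gd.
have ki q x : k q x = 0 -> x = 0.
  by move=> kx; apply: (kE q).1; rewrite linear0.
have gki q x : pc_comp g k q x = 0 -> x = 0.
  by move=> /= gkx; apply/ki/Gi => //; apply/(kE q).2; exists x.
have eK : exactc K.
  move=> q x dx; have [||y /(kE q).2[z <-] dz] := Gex q (k _ x).
  - by apply/(kE _).2; exists x.
  - by rewrite -pc_comm dx linear0.
  by exists z; apply: (kE _).1; rewrite pc_comm.
suff gks q f0 : exists x, g q (k q x) = f0.
  have [//|q x|s sE] := fac_injC (j := pc_comp g k) (h := pc_id F).
    by have [y yx] := gks q x; exists y.
  by exists (pc_comp k s).
have [F' [c gkc]] := sexC_coker gki; have /sexCP[_ cex cs] := gkc.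
have eF' := exactc_coker gkc eK eF.
have [E' [e ke]] := sexC_coker ki; have /sexCP[_ eex es] := ke.
have [//|r x /eex[y <-]|g' g'E] := fac_surjC (s := e) (h := pc_comp c g).
  by apply/cex; exists y.
have ek0 r y : e r (k r y) = 0 by apply/eex; exists y.
(* Since [K] meets [Y] trivially, dividing [E] by [K] and [F] by its image leaves an extension by
   the same [Y]. *)
have ejg : sexC (pc_comp e j) g'.
  apply/sexCP; split=> [r y /= /eex[x kx]|r z|r z].
  - have x0 : x = 0 by apply: (gki r); rewrite /= kx gj0.
    by apply: ji; rewrite -kx x0 linear0.
  - have [x <-] := es r z; rewrite g'E /=; split=> [/cex[y /= yE]|[y yE]].
      have /jex[v vE] : g r (x - k r y) = 0 by rewrite linearB yE subrr.
      by exists v; rewrite vE linearB ek0 subr0.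
    have /eex[v vE] : e r (x - j r y) = 0 by rewrite linearB yE subrr.
    have -> : x = k r v + j r y by rewrite vE subrK.
    by rewrite linearD gj0 addr0; apply/cex; exists v.
  - have [y <-] := cs r z; have [x <-] := gs r y.
    by exists (e r x); rewrite g'E.
have [H [h [i [ev [eH hi [y0 y0E] pH]]]]] := lowenheim_skolem (c q f0) eF'.
have [l lE] := ExtC_lift h ejg (small_exact_Ext eH pH (smallY i)).
(* The preimage in [E] of the lifted small complex [H]. It is an extension of [H] by [K], both
   exact, and it still maps injectively to [F]. *)
pose G2 (z : {q & E q}) := exists y, e (projT1 z) (projT2 z) = l (projT1 z) y.
have GG2 z : G z -> G2 z.
  case: z => r x Gx; exists 0; rewrite /= linear0; apply/eex.
  exact: ((kE r).2 x).1 Gx.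
have gG2 : good G2.
  split=> [r|r x [y /= yE]|r x [y /= yE] gx|r x [y /= yE] dx].
  - split=> [|a x y [u /= uE] [v /= vE]]; first by exists 0; rewrite /= !linear0.
    by exists (a *: u + v); rewrite /= !linearP uE vE.
  - by exists (d H y); rewrite /= !pc_comm yE.
  - have y0' : y = 0 by apply: hi; rewrite -lE -yE g'E /= gx linear0.
    move: yE; rewrite y0' linear0 => /eex[v vE]; rewrite -vE.
    by rewrite (gki r v) ?linear0 //= vE.
  - have dy : d H y = 0 by apply: hi; rewrite -lE pc_comm -yE -pc_comm dx !linear0.
    have [y' y'E] := eH r y dy; have [x' x'E] := es r (l r y').
    have /eex[v vE] : e (p r) (x - d E x') = 0.
      by rewrite linearB pc_comm x'E -pc_comm y'E yE subrr.
    have dv : d K v = 0.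
      by apply: ki; rewrite pc_comm vE linearB pc_dd dx subrr.
    have [v' v'E] := eK r v dv; exists (x' + k r v').
      by exists y'; rewrite /= linearD x'E ek0 addr0.
    by rewrite linearD -pc_comm v'E vE addrC subrK.
have [x xE] := es q (l q y0).
have /((kE q).2 x).1[v vx] : G (existT _ q x).
  by apply: (Gmax _ gG2) => //; exists y0.
have : c q f0 = 0.
  rewrite -y0E -lE -xE g'E /= -vx; apply/cex; by exists v.
by move=> /cex[z zE]; exists z.
Qed.

End SmallExact.

(** * Completeness of the pair defined by Phi *)

Section PhiComplete.
Variables (R : pzRingType) (N : nat) (q0 : 'I_N).
Hypothesis injR : enough_injectives R.
Variables (A B : modCat R -> Prop).
Hypothesis AB_cotorsion : cotorsion_pair A B.
Hypothesis AB_hereditary : hereditary_pair A B.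
Hypothesis approx : forall M : lmodType R, exists (V W : lmodType R) (f : {linear M -> V}) (g : {linear V -> W}),
  [/\ B V, A W & sexM f g].
Implicit Types X Y Z F P C K Q : pcomplex R N.
Local Notation Phi := (@Phi R N A).
Local Notation Psi := (@Psi R N B).

Lemma Phi_exact X : Phi X -> exactc X.
Proof. by move=> /(PhiP _ (left_iso AB_cotorsion))[]. Qed.

Lemma Phi_ext X Y Z (f : pcmap X Y) (g : pcmap Y Z) : sexC f g -> Phi X -> Phi Z -> Phi Y.
Proof.
move=> fg PX PZ; apply/(PhiE AB_cotorsion injR) => V BV.
have /(PhiE AB_cotorsion injR)/(_ V BV) extX := PX.
have /(PhiE AB_cotorsion injR)/(_ V BV) extZ := PZ.
exact: Ext0_extl fg extX extZ.
Qed.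

Lemma Phi_proj X : (forall Y, ExtC X Y) -> Phi X.
Proof. by move=> pX; apply/(PhiE AB_cotorsion injR) => V _. Qed.

(** Salce's lemma among exact complexes: a projective cover lies in Phi, so its kernel is exact and
    [exact_approx] applies to it. *)
Lemma exact_cover X : exactc X ->
  exists P Q (f : pcmap P Q) (g : pcmap Q X), [/\ Psi P, Phi Q & sexC f g].
Proof.
move=> eX; have [F [s [ss Fproj]]] := enough_proj X.
have PF := Phi_proj Fproj; have [K [m ms]] := sexC_ker ss.
have eK : exactc K := exactc_ker ms (Phi_exact PF) eX.
have [D0 [G0 [f [g [DD GG fg]]]]] := @salce _ (pcConc R N) Phi Psi X F K m s Phi_ext ms PF
  (exact_approx AB_cotorsion AB_hereditary approx eK).
by exists D0, G0, f, g.
Qed.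

Lemma Phi_complete : complete_pair Phi (rperp Phi).
Proof.
apply: complete_right => [X Y Z f g|X|X]; [exact: Phi_ext|exact: Phi_proj|].
have [D [E [f [g [fg smallD DE]]]]] := small_object injR (@small_exact R N) X.
(* Stalks on injective modules are right orthogonal to all exact complexes, so [E] is left
   orthogonal to them, which forces exactness. *)
have eE : exactc E.
  apply: stalk_r_exact => M; have [J [e [ei injJ]]] := injR M.
  exists J, e; split=> //; apply: DE => j.
  by apply: Ext_stalk_r => //; apply: small_exactP.
have [P [Q [m [s [PP PQ ms]]]]] := exact_cover eE.
have [W [a [b [c [e [ac eb _ _]]]]]] := @pullback_sex _ (pcConc R N) _ _ _ _ _ m s f g ms fg.
exists W, Q, e, b; split=> // F PF.
(* [W] is an extension of [D] by [P], and both are right orthogonal to Phi. *)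
apply: (@Ext0_extr _ (pcConc R N) _ _ _ _ _ _ ac).
  exact: (Phi_Psi_ext AB_cotorsion).
exact: (exact_generated q0 smallD (Phi_exact PF)).
Qed.

End PhiComplete.

Theorem theoremB (N : nat) (N_ge1 : (1 <= N)%N)
    (k : fieldType) (R : pzRingType)
    (eta : {rmorphism k -> R})
    (eta_central : forall (c : k) (r : R), eta c * r = r * eta c)
    (A B : modCat R -> Prop)
    (AB_cotorsion : cotorsion_pair A B)
    (AB_hereditary : hereditary_pair A B) :
  [/\ cotorsion_pair (@Phi R N A) (rperp (@Phi R N A)),
      cotorsion_pair (lperp (@Psi R N B)) (@Psi R N B),
      hereditary_pair (@Phi R N A) (rperp (@Phi R N A)),
      hereditary_pair (lperp (@Psi R N B)) (@Psi R N B)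
    & compatible_pairs (@Phi R N A) (rperp (@Phi R N A))
                       (lperp (@Psi R N B)) (@Psi R N B)]
  /\
  (closed_pure_quotients A -> generated_by_set A B ->
     complete_pair (@Phi R N A) (rperp (@Phi R N A)) /\
     complete_pair (lperp (@Psi R N B)) (@Psi R N B)).
Proof.
have injR : enough_injectives R := enough_injM eta.
split; first split.
- exact: (Phi_cotorsion N AB_cotorsion injR).
- exact: (Psi_cotorsion N AB_cotorsion).
- exact: (Phi_hereditary N AB_cotorsion AB_hereditary).
- exact: (Psi_hereditary N AB_cotorsion AB_hereditary).
- exact: (Phi_Psi_compatible N AB_cotorsion injR).
move=> _ [I [S S_gen]]; split; last exact: (Psi_complete injR AB_cotorsion S_gen).
exact: (Phi_complete (Ordinal N_ge1) injR AB_cotorsion AB_hereditary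
  (module_approx injR AB_cotorsion S_gen (Ordinal N_ge1))).
Qed.
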